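(* Let $\widetilde{X}_n = X_n + P_n$, where $X_n$, $P_n$, $\mu_X$, $a$, $b$, $r$, $s$, $\theta_1,\ldots,\theta_r$ satisfy the standing assumptions given in the context. Let $i_0\in\{1,\ldots,r\}$ be such that $1/\theta_{i_0}\in(G_{\mu_X}(a^-),G_{\mu_X}(b^+))$. For each $n$, define $$\widetilde{\lambda}_{i_0}:=\begin{cases}\lambda_{i_0}(\widetilde{X}_n) & \text{if }\theta_{i_0}>0,\\ \lambda_{n-r+i_0}(\widetilde{X}_n) & \text{if }\theta_{i_0}<0,\end{cases}$$ and let $\widetilde{u}$ be a unit-norm eigenvector of $\widetilde{X}_n$ associated with the eigenvalue $\widetilde{\lambda}_{i_0}$. Then, as $n\to\infty$: (a) almost surely $$|\langle\widetilde{u},\ker(\theta_{i_0}I_n-P_n)\rangle|^2\longrightarrow\frac{-1}{\theta_{i_0}^2\,G_{\mu_X}'(\rho)},$$ where $\rho=G_{\mu_X}^{-1}(1/\theta_{i_0})$ is the almost sure limit of $\widetilde{\lambda}_{i_0}$; (b) almost surely $$\Big\langle\widetilde{u},\ \bigoplus_{\theta\in\{\theta_1,\ldots,\theta_r\}\setminus\{\theta_{i_0}\}}\ker(\theta I_n-P_n)\Big\rangle\longrightarrow0.$$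
   Context: Eigenvalues of an $n\times n$ Hermitian matrix $M$ are ordered as $\lambda_1(M)\ge\cdots\ge\lambda_n(M)$. For a function $f$ and $c\in\mathbb{R}$, $f(c^+)=\lim_{z\downarrow c}f(z)$ and $f(c^-)=\lim_{z\uparrow c}f(z)$. For a subspace $F$ of a Euclidean (or Hermitian) space $E$ and $x\in E$, $\langle x,F\rangle$ denotes the norm of the orthogonal projection of $x$ onto $F$. Standing assumptions. All random objects are defined on a common probability space. For each $n$, $X_n$ is an $n\times n$ real symmetric (or complex Hermitian) random matrix with empirical eigenvalue distribution $\mu_{X_n}=\frac1n\sum_{j=1}^n\delta_{\lambda_j(X_n)}$. Almost surely, $\mu_{X_n}$ converges weakly as $n\to\infty$ to a non-random compactly supported probability measure $\mu_X$ on $\mathbb{R}$. Let $a$ and $b$ be the infimum and supremum of the support of $\mu_X$; it is assumed that $\lambda_n(X_n)\to a$ and $\lambda_1(X_n)\to b$ almost surely. Let $r\ge1$ be fixed and let $\theta_1\ge\cdots\ge\theta_r$ be deterministic non-zero real numbers independent of $n$; let $s\in\{0,\ldots,r\}$ be such that $\theta_1\ge\cdots\ge\theta_s>0>\theta_{s+1}\ge\cdots\ge\theta_r$. For each $n$ ($n\ge r$), $P_n$ is an $n\times n$ symmetric (or Hermitian) random matrix of rank $r$ whose $r$ non-zero eigenvalues are $\theta_1,\ldots,\theta_r$. $X_n$ and $P_n$ are independent, and either $X_n$ or $P_n$ is orthogonally invariant (in the symmetric case) or unitarily invariant (in the Hermitian case), i.e. its distribution is invariant under conjugation by every orthogonal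 (respectively unitary) matrix. The Cauchy transform of $\mu_X$ is $G_{\mu_X}(z)=\int\frac{1}{z-t}\,d\mu_X(t)$ for $z\notin\operatorname{supp}\mu_X$. It realizes decreasing homeomorphisms from $(-\infty,a)$ onto $(G_{\mu_X}(a^-),0)$ and from $(b,+\infty)$ onto $(0,G_{\mu_X}(b^+))$, where $G_{\mu_X}(a^-)\in[-\infty,0)$ and $G_{\mu_X}(b^+)\in(0,+\infty]$; $G_{\mu_X}^{-1}$ denotes the inverses of these homeomorphisms. *)

(* Defs.v *)
From HB Require Import structures.
From mathcomp Require Import all_boot all_order all_algebra complex.
From mathcomp Require Import all_classical all_reals all_analysis.

Set Implicit Arguments.
Unset Strict Implicit.
Unset Printing Implicit Defensive.

Import Order.TTheory GRing.Theory Num.Theory.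
Import numFieldTopology.Exports numFieldNormedType.Exports.

Local Open Scope classical_set_scope.
Local Open Scope ring_scope.
Local Open Scope complex_scope.
Local Open Scope sesquilinear_scope.

(* Both symmetry classes live in matrices over R[i]. In the real symmetric
   class all matrices and vectors, including the conjugating orthogonal
   matrices, are required to have real entries. Following spectral.v, vectors
   are rows on which matrices act on the right: a row v satisfies
   v *m A = x *: v, for A Hermitian and x real, iff the column v^t*
   satisfies A *m v^t* = x *: v^t*. *)
Variant symmetry_class := RealSymmetric | ComplexHermitian.

Definition entries_in (beta : symmetry_class) (R : rcfType) m n
    (A : 'M[R[i]]_(m, n)) : Prop :=
  if beta is RealSymmetric then A \is a realmx else True.

Definition self_adjoint beta (R : rcfType) n (A : 'M[R[i]]_n) : Prop :=
  entries_in beta A /\ A \is hermsymmx.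

(* The orthogonal group O(n), resp. the unitary group U(n). *)
Definition isometry_group beta (R : rcfType) n : set 'M[R[i]]_n :=
  [set U | entries_in beta U /\ U \is unitarymx].

(* Meaningful for A Hermitian, in which case spectral_diag A is real. *)
Definition eigvals (R : rcfType) n (A : 'M[R[i]]_n) : seq R :=
  sort >=%R [seq complex.Re (spectral_diag A 0 i) | i <- enum 'I_n].

(* Indices start at 0: eigval A k is the (k+1)-st largest eigenvalue. *)
Definition eigval (R : rcfType) n (A : 'M[R[i]]_n) (k : nat) : R :=
  (eigvals A)`_k.

Lemma char_poly_eigvals (R : rcfType) n (A : 'M[R[i]]_n) : A \is hermsymmx ->
  char_poly A = \prod_(x <- eigvals A) ('X - (x%:C)%:P).
Proof.
move=> Ah; have /hermitian_normalmx /orthomx_spectralP A_eq := Ah.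
have Dreal i : complex.Im (spectral_diag A 0 i) = 0.
  have /mxOverP /(_ 0 i) /complex_realP[x ->] := hermitian_spectral_diag_real Ah.
  by [].
rewrite (perm_big [seq complex.Re (spectral_diag A 0 i) | i <- enum 'I_n]);
  last by rewrite perm_sort.
rewrite big_map big_enum /=.
transitivity (char_poly (diag_mx (spectral_diag A))).
  have PU := spectral_unit A.
  have PU' : map_mx (@polyC R[i]) (spectralmx A) \in unitmx by rewrite map_unitmx.
  rewrite {1}A_eq /char_poly /char_poly_mx !map_mxM map_invmx.
  set Q := map_mx _ (spectralmx A).
  have -> : 'X%:M - invmx Q *m map_mx polyC (diag_mx (spectral_diag A)) *m Q =
      invmx Q *m ('X%:M - map_mx polyC (diag_mx (spectral_diag A))) *m Q.
    by rewrite mulmxBr mulmxBl scalar_mxC mulmxKV.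
  by rewrite !det_mulmx mulrAC -det_mulmx mulVmx// det1 mul1r.
rewrite char_poly_trig ?diag_mx_is_trig//; apply: eq_bigr => i _.
rewrite !mxE eqxx mulr1n; congr ('X - _%:P).
by case: (spectral_diag A 0 i) (Dreal i) => x y /= ->.
Qed.

Definition sqnorm (R : rcfType) n (v : 'rV[R[i]]_n) : R :=
  complex.Re (dotmx v v).

(* The norm of the orthogonal projection of u onto the row space of F. *)
Definition proj_norm (R : rcfType) n m (u : 'rV[R[i]]_n) (F : 'M[R[i]]_(m, n))
    : R :=
  Num.sqrt (sqnorm (u *m proj_ortho F)).

Definition mx_cylinders (R : realType) n : set (set 'M[R[i]]_n) :=
  [set B | exists (i j : 'I_n) (S : set (measurableTypeR R)), measurable S /\
    (B = [set A : 'M[R[i]]_n | S (complex.Re (A i j))] \/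
     B = [set A : 'M[R[i]]_n | S (complex.Im (A i j))])].

(* Square matrices with their Borel sigma-algebra. *)
Definition mxBorel (R : realType) (n : nat) : Type := 'M[R[i]]_n.

Section mxBorel_measurable.
Context (R : realType) (n : nat).

Let mxBorelC (B : set 'M[R[i]]_n) :
  <<s @mx_cylinders R n >> B -> <<s @mx_cylinders R n >> (~` B).
Proof. by move=> mB; rewrite -setTD; exact: sigma_algebraCD. Qed.

HB.instance Definition _ := Choice.on (mxBorel R n).
HB.instance Definition _ := isPointed.Build (mxBorel R n) (0 : 'M[R[i]]_n).
HB.instance Definition _ :=
  @isMeasurable.Build (sigma_display (@mx_cylinders R n)) (mxBorel R n)
    <<s @mx_cylinders R n >> (@sigma_algebra0 _ setT (@mx_cylinders R n))
    mxBorelC (@sigma_algebra_bigcup _ setT (@mx_cylinders R n)).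

End mxBorel_measurable.

Section random_elements.
Context d (Omega : measurableType d) (R : realType) (Pr : probability Omega R).

Definition independent d1 d2 (T1 : measurableType d1) (T2 : measurableType d2)
    (X : {RV Pr >-> T1}) (Y : {RV Pr >-> T2}) : Prop :=
  forall A B, measurable A -> measurable B ->
    (Pr (X @^-1` A `&` Y @^-1` B) = Pr (X @^-1` A) * Pr (Y @^-1` B))%E.

Definition conj_invariant beta n (X : {RV Pr >-> mxBorel R n}) : Prop :=
  forall U : 'M[R[i]]_n, isometry_group beta U ->
  forall B : set (mxBorel R n), measurable B ->
    Pr [set w | B (U *m X w *m U^t*)] = Pr (X @^-1` B).

End random_elements.

Section spectral_measures.
Context (R : realType).

Definition esd n (A : 'M[R[i]]_n) : {measure set (measurableTypeR R) -> \bar R} :=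
  mscale (n%:R^-1)%:nng
    (msum (fun j => \d_(eigval A j : measurableTypeR R)) n).

Definition weak_cvg (nu : nat -> {measure set (measurableTypeR R) -> \bar R})
    (mu : {measure set (measurableTypeR R) -> \bar R}) : Prop :=
  forall f : R -> R, continuous f -> bounded_fun f ->
    (\int[nu n]_x (f x)%:E @[n --> \oo] --> \int[mu]_x (f x)%:E)%E.

Variable mu : {measure set (measurableTypeR R) -> \bar R}.

Definition msupport : set R :=
  [set x | forall U : set R, open U -> U x -> (0 < mu U)%E].

Definition Cauchy_transform (z : R) : R := (\int[mu]_t (z - t)^-1)%R.

Definition Cauchy_left : \bar R :=
  lim ((Cauchy_transform z)%:E @[z --> (inf msupport)^'-]).

Definition Cauchy_right : \bar R :=
  lim ((Cauchy_transform z)%:E @[z --> (sup msupport)^'+]).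

(* Positive y have their preimage in (b, +oo), negative y in (-oo, a), where
   a and b are the endpoints of the support. *)
Definition Cauchy_inv (y : R) : R :=
  get [set z | (z < inf msupport \/ sup msupport < z) /\
               Cauchy_transform z = y].

End spectral_measures.

(* Main.v *)
Require Import Defs.
From mathcomp Require Import all_boot all_order all_algebra complex.
From mathcomp Require Import all_classical all_reals all_analysis.
From mathcomp Require Import perm measurable_realfun ring lra.

(** The idea of the proof.

Write [P = V^H D V], where the [r] rows of [V] are orthonormal eigenvectors of
[P], [D] is the diagonal matrix of the [theta_j] and [V^H] is the adjoint of
[V]. The perturbed matrix [X + P] is controlled by the [r * r] matrices
[V f(X) V^H] for [f] the resolvent [1 / (z - t)] and its square, and these
become scalar: [V f(X) V^H] tends almost surely to the integral of [f] against
[mu], that is to [G z] and to [- G' z].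

Randomness enters only there, and for powers [f(t) = t ^ k]. The invariance is
applied to the Householder reflections along the [2 ^ n] sign vectors, which are
real and so belong to the isometry groups of both symmetry classes. Let [A] be the power of [X] minus its normalized trace and let
[q = V A V^H]. Averaged over the sign vectors, conjugating [A] by a reflection
shrinks [q] by the factor [1 - 4 / n], up to errors of order [n ^ -2]
([sum_drift]). But the pair [X, P] has a law for which such a conjugation is
stationary, whichever of the two is invariant, and a stationary quantity
cannot drift ([drift_swap], [drift_expectation]). Hence the fourth power of
the norm of [q], truncated to a bounded spectrum, has expectation of order
[n ^ -2], and summability gives [q -> 0] almost surely ([ae_compress_cvg0]).
Resolvents are uniform limits of polynomials near the spectrum, which yields
[compressed_resolvent_cvg].

From here on the realization is fixed. For [z > b] a dimension count compares
the eigenvalues of [X + P] above [z] with the [theta_j] above [1 / G z]: the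
form of [z - X - P] is positive on the vectors orthogonal to the corresponding
rows of [V], and negative on the images of these rows under the resolvent
([card_eigval_ge], [card_eigval_gt]). As [G] is strictly decreasing, the
eigenvalue number [i0] is squeezed to the solution [rho] of
[G rho = 1 / theta_i0]. Eigenvalues below [a] are treated by passing to opposite
matrices.

For the eigenvector [u] with eigenvalue [lam], multiplying the eigenvector
equation by [R = 1 / (rho - X)] gives [u = u P R + (rho - lam) u R]
([eigvec_split]). Put [c = u V^H]. Compressing to the rows of [V] gives
[c_j (1 - theta_j / theta_i0) -> 0], so only the coordinates with
[theta_j = theta_i0] survive; taking squared norms gives
[1 = - G' rho * theta_i0 ^ 2 * (sum of the surviving |c_j| ^ 2) + o(1)]. These
are the two limits, because the orthogonal projections of [u] onto sums of
eigenspaces of [P] have squared norms the corresponding sums of [|c_j| ^ 2]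
([proj_norm_eigenspace], [proj_norm_sum_eigenspaces]). *)

Set Implicit Arguments.
Unset Strict Implicit.
Unset Printing Implicit Defensive.

Import Order.TTheory GRing.Theory Num.Theory.
Import numFieldTopology.Exports numFieldNormedType.Exports.

Local Open Scope classical_set_scope.
Local Open Scope ring_scope.
Local Open Scope complex_scope.
Local Open Scope sesquilinear_scope.

(** * Complex scalars and the Frobenius norm *)

Local Notation re := complex.Re.
Local Notation im := complex.Im.

Section complex_scalars.
Context {R : rcfType}.
Implicit Types (x y : R) (z t : R[i]).

Lemma conj_conjc z : Num.conj z = z^*.
Proof.
apply/eqP; rewrite -subr_eq0; have [->|z0] := eqVneq z 0.
  by rewrite rmorph0 conjc0 subr0.
have := normCK z; rewrite sqr_normc => /(mulfI z0) <-.
by rewrite subrr.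
Qed.

Lemma conjCR x : Num.conj (x%:C : R[i]) = x%:C.
Proof. by rewrite conj_conjc conjc_real. Qed.

Lemma reD z t : re (z + t) = re z + re t. Proof. by case: z t => ? ? []. Qed.
Lemma imD z t : im (z + t) = im z + im t. Proof. by case: z t => ? ? []. Qed.
Lemma reN z : re (- z) = - re z. Proof. by case: z. Qed.
Lemma imN z : im (- z) = - im z. Proof. by case: z. Qed.
Lemma reM z t : re (z * t) = re z * re t - im z * im t.
Proof. by case: z t => ? ? []. Qed.
Lemma imM z t : im (z * t) = re z * im t + im z * re t.
Proof. by case: z t => ? ? []. Qed.
Lemma reC x : re x%:C = x. Proof. by []. Qed.
Lemma reZ x z : re (x%:C * z) = x * re z.
Proof. by rewrite reM /= mul0r subr0. Qed.
Lemma reJ z : re (Num.conj z) = re z. Proof. by rewrite conj_conjc; case: z. Qed.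
Lemma imJ z : im (Num.conj z) = - im z. Proof. by rewrite conj_conjc; case: z. Qed.

Lemma re_sum I (s : seq I) (Q : pred I) (F : I -> R[i]) :
  re (\sum_(i <- s | Q i) F i) = \sum_(i <- s | Q i) re (F i).
Proof. by apply: (big_ind2 (fun z x => re z = x)) => // ? ? ? ? <- <-; rewrite reD. Qed.

(** The squared modulus, as an element of [R] rather than of [R[i]]. *)
Definition nsq z : R := re z ^+ 2 + im z ^+ 2.

Lemma nsq_ge0 z : 0 <= nsq z. Proof. by rewrite addr_ge0 ?sqr_ge0. Qed.
Lemma nsqM z t : nsq (z * t) = nsq z * nsq t.
Proof. by rewrite /nsq reM imM; ring. Qed.
Lemma nsqR x : nsq x%:C = x ^+ 2. Proof. by rewrite /nsq /= expr0n addr0. Qed.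
Lemma nsq0 : nsq 0 = 0. Proof. by rewrite -[0]/(0%:C) nsqR expr0n. Qed.
Lemma nsq1 : nsq 1 = 1. Proof. by rewrite -[1]/(1%:C) nsqR expr1n. Qed.
Lemma nsqN z : nsq (- z) = nsq z. Proof. by rewrite /nsq reN imN !sqrrN. Qed.
Lemma nsqJ z : nsq (Num.conj z) = nsq z.
Proof. by rewrite /nsq reJ imJ !sqrrN. Qed.
Lemma nsqE z : (nsq z)%:C = z * Num.conj z.
Proof. by rewrite conj_conjc -sqr_normc add_Re2_Im2. Qed.
Lemma nsq_eq0 z : (nsq z == 0) = (z == 0).
Proof.
rewrite paddr_eq0 ?sqr_ge0// !sqrf_eq0.
by rewrite eq_complex.
Qed.
Lemma nsqD z t : nsq (z + t) <= 2 * nsq z + 2 * nsq t.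
Proof.
rewrite /nsq reD imD; have := sqr_ge0 (re z - re t).
by have := sqr_ge0 (im z - im t); nra.
Qed.
Lemma re_sqr_le z : re z ^+ 2 <= nsq z.
Proof. by rewrite /nsq lerDl sqr_ge0. Qed.

End complex_scalars.

Section frobenius.
Context {R : rcfType}.
Local Notation C := R[i].

Lemma adjM m n p (A : 'M[C]_(m, n)) (B : 'M[C]_(n, p)) :
  (A *m B)^t* = B^t* *m A^t*.
Proof. by rewrite trmx_mul map_mxM. Qed.
Lemma adjD m n (A B : 'M[C]_(m, n)) : (A + B)^t* = A^t* + B^t*.
Proof. by rewrite linearD map_mxD. Qed.
Lemma adjN m n (A : 'M[C]_(m, n)) : (- A)^t* = - A^t*.
Proof. by rewrite linearN map_mxN. Qed.
Lemma adjB m n (A B : 'M[C]_(m, n)) : (A - B)^t* = A^t* - B^t*.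
Proof. by rewrite adjD adjN. Qed.
Lemma adjZ m n x (A : 'M[C]_(m, n)) : (x%:C *: A)^t* = x%:C *: A^t*.
Proof. by rewrite linearZ /= map_mxZ /= conjCR. Qed.
Lemma adj_scalar n x : (x%:C%:M : 'M[C]_n)^t* = x%:C%:M.
Proof. by rewrite tr_scalar_mx map_scalar_mx /= conjCR. Qed.
Lemma adj1 n : (1%:M : 'M[C]_n)^t* = 1%:M.
Proof. exact: (adj_scalar n 1). Qed.

Lemma hermP n (A : 'M[C]_n) : reflect (A^t* = A) (A \is hermsymmx).
Proof.
apply: (iffP (is_hermitianmxP _ _ _)); rewrite expr0 scale1r.
  by move=> {2}->.
by move=> {1}<-.
Qed.

Lemma re_trJ n (A : 'M[C]_n) : re (\tr (A^t*)) = re (\tr A).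
Proof.
rewrite /mxtrace !re_sum; apply: eq_bigr => i _.
by rewrite !mxE reJ.
Qed.

(** The squared Frobenius norm. *)
Definition fro2 m n (A : 'M[C]_(m, n)) : R := \sum_i \sum_j nsq (A i j).

Lemma fro2_ge0 m n (A : 'M[C]_(m, n)) : 0 <= fro2 A.
Proof. by do 2 apply: sumr_ge0 => ? _; exact: nsq_ge0. Qed.

Lemma nsq_le_fro2 m n (A : 'M[C]_(m, n)) i j : nsq (A i j) <= fro2 A.
Proof.
rewrite /fro2 (bigD1 i)//= (bigD1 j)//= -addrA lerDl.
by rewrite addr_ge0// ?sumr_ge0// => *; rewrite ?nsq_ge0// sumr_ge0// => *;
  rewrite nsq_ge0.
Qed.

Lemma fro2CE m n (A : 'M[C]_(m, n)) : (fro2 A)%:C = \tr (A *m A^t*).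
Proof.
rewrite rmorph_sum; apply: eq_bigr => i _; rewrite mxE rmorph_sum.
by apply: eq_bigr => j _; rewrite !mxE -nsqE.
Qed.

Lemma fro2E m n (A : 'M[C]_(m, n)) : fro2 A = re (\tr (A *m A^t*)).
Proof. by rewrite -fro2CE. Qed.

Lemma fro2_adj m n (A : 'M[C]_(m, n)) : fro2 (A^t*) = fro2 A.
Proof.
rewrite /fro2 exchange_big; apply: eq_bigr => i _; apply: eq_bigr => j _.
by rewrite !mxE nsqJ.
Qed.

Lemma fro2_tr m n (A : 'M[C]_(m, n)) : fro2 (A^T) = fro2 A.
Proof.
rewrite /fro2 exchange_big; apply: eq_bigr => i _; apply: eq_bigr => j _.
by rewrite mxE.
Qed.

Lemma fro2_0 m n : fro2 (0 : 'M[C]_(m, n)) = 0.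
Proof. by rewrite /fro2 !big1// => i _; rewrite big1// => j _; rewrite mxE nsq0. Qed.

Lemma fro2_eq0 m n (A : 'M[C]_(m, n)) : fro2 A = 0 -> A = 0.
Proof.
move=> A0; apply/matrixP => i j; rewrite mxE; apply/eqP.
by rewrite -nsq_eq0 eq_le nsq_ge0 -A0 nsq_le_fro2.
Qed.

Lemma fro2N m n (A : 'M[C]_(m, n)) : fro2 (- A) = fro2 A.
Proof. by do 2 apply: eq_bigr => ? _; rewrite mxE nsqN. Qed.

Lemma fro2Z m n z (A : 'M[C]_(m, n)) : fro2 (z *: A) = nsq z * fro2 A.
Proof.
rewrite /fro2 mulr_sumr; apply: eq_bigr => i _; rewrite mulr_sumr.
by apply: eq_bigr => j _; rewrite mxE nsqM.
Qed.

Lemma fro2D m n (A B : 'M[C]_(m, n)) : fro2 (A + B) <= 2 * fro2 A + 2 * fro2 B.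
Proof.
rewrite /fro2 !mulr_sumr -big_split ler_sum// => i _.
rewrite !mulr_sumr -big_split ler_sum// => j _.
by rewrite mxE nsqD.
Qed.

Lemma fro2B m n (A B : 'M[C]_(m, n)) : fro2 (A - B) <= 2 * fro2 A + 2 * fro2 B.
Proof. by rewrite -(fro2N B) fro2D. Qed.

(** The real inner product whose squared norm is [fro2]. *)
Definition fdot m n (A B : 'M[C]_(m, n)) : R := re (\tr (A *m B^t*)).

Lemma fdotC m n (A B : 'M[C]_(m, n)) : fdot A B = fdot B A.
Proof. by rewrite /fdot -re_trJ adjM trmxCK. Qed.
Lemma fdotDl m n (A B D : 'M[C]_(m, n)) : fdot (A + B) D = fdot A D + fdot B D.
Proof. by rewrite /fdot mulmxDl mxtraceD reD. Qed.
Lemma fdotNl m n (A B : 'M[C]_(m, n)) : fdot (- A) B = - fdot A B.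
Proof. by rewrite /fdot mulNmx raddfN reN. Qed.
Lemma fdotBl m n (A B D : 'M[C]_(m, n)) : fdot (A - B) D = fdot A D - fdot B D.
Proof. by rewrite fdotDl fdotNl. Qed.
Lemma fdotZl m n x (A B : 'M[C]_(m, n)) : fdot (x%:C *: A) B = x * fdot A B.
Proof. by rewrite /fdot -scalemxAl mxtraceZ reZ. Qed.
Lemma fdot_suml m n I (s : seq I) (Q : pred I) (F : I -> 'M[C]_(m, n)) B :
  fdot (\sum_(i <- s | Q i) F i) B = \sum_(i <- s | Q i) fdot (F i) B.
Proof.
apply: (big_ind2 (fun A x => fdot A B = x)) => //.
  by rewrite /fdot mul0mx mxtrace0.
by move=> A x A' x' <- <-; rewrite fdotDl.
Qed.

Lemma fro2_fdot m n (A : 'M[C]_(m, n)) : fro2 A = fdot A A.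
Proof. exact: fro2E. Qed.

Lemma fro2_subE m n (A B : 'M[C]_(m, n)) :
  fro2 (A - B) = fro2 A + fro2 B - 2 * fdot A B.
Proof.
rewrite !fro2_fdot fdotBl (fdotC A) (fdotC B (A - B)) !fdotBl (fdotC B A); ring.
Qed.

Lemma fdot_CS m n (A B : 'M[C]_(m, n)) : (fdot A B) ^+ 2 <= fro2 A * fro2 B.
Proof.
have := fro2_ge0 ((fro2 B)%:C *: A - (fdot A B)%:C *: B).
rewrite fro2_subE !fro2Z !nsqR fdotZl (fdotC A (_ *: B)) fdotZl (fdotC B A).
have := fro2_ge0 B; rewrite le_eqVlt => /orP[/eqP B0 _|B0].
  by rewrite (fro2_eq0 (esym B0)) fro2_0 fdotC /fdot mul0mx mxtrace0 expr0n mulr0.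
set a := fro2 A; set b := fro2 B in B0 *; set c := fdot A B.
have -> : b ^+ 2 * a + c ^+ 2 * b - 2 * (b * (c * c)) = b * (a * b - c ^+ 2).
  by ring.
by rewrite pmulr_rge0// subr_ge0.
Qed.

(** Cauchy-Schwarz for the modulus follows from the real one by rotating [u] so
that the product becomes real. *)
Lemma row_col_nsq n (u : 'rV[C]_n) (v : 'cV[C]_n) :
  nsq ((u *m v) 0 0) <= fro2 u * fro2 v.
Proof.
set z := (u *m v) 0 0.
have dotE w : fdot (w *: u) (v^t*) = re (w * z).
  by rewrite /fdot trmxCK -scalemxAl mxtraceZ trace_mx11.
have := fdot_CS (Num.conj z *: u) (v^t*).
rewrite dotE fro2Z fro2_adj nsqJ mulrC -nsqE reC -mulrA expr2.
have [->|z0] := eqVneq z 0; first by rewrite nsq0 mulr_ge0 ?fro2_ge0.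
by rewrite ler_pM2l// lt0r nsq_eq0 z0 nsq_ge0.
Qed.

Lemma fro2_row_sum m n (A : 'M[C]_(m, n)) : fro2 A = \sum_i fro2 (row i A).
Proof.
apply: eq_bigr => i _; rewrite /fro2 big_ord1; apply: eq_bigr => j _.
by rewrite mxE.
Qed.

Lemma fro2_col_sum m n (A : 'M[C]_(m, n)) : fro2 A = \sum_j fro2 (col j A).
Proof.
rewrite /fro2 exchange_big; apply: eq_bigr => j _; apply: eq_bigr => i _.
by rewrite big_ord1 mxE.
Qed.

Lemma fro2M m n p (A : 'M[C]_(m, n)) (B : 'M[C]_(n, p)) :
  fro2 (A *m B) <= fro2 A * fro2 B.
Proof.
rewrite (fro2_row_sum A) mulr_suml [leLHS]/fro2 ler_sum// => i _.
rewrite (fro2_col_sum B) mulr_sumr ler_sum// => j _.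
have -> : (A *m B) i j = (row i A *m col j B) 0 0.
  by rewrite !mxE; apply: eq_bigr => k _; rewrite !mxE.
exact: row_col_nsq.
Qed.

Lemma fro2_unitaryr m n p (A : 'M[C]_(m, n)) (V : 'M[C]_(n, p)) :
  V \is unitarymx -> fro2 (A *m V) = fro2 A.
Proof.
by move=> /unitarymxP Vu; rewrite !fro2E adjM mulmxA -(mulmxA A) Vu mulmx1.
Qed.

(** Subtracting from [A] its projection onto the row space of [V] leaves a
nonnegative remainder. *)
Lemma fro2_projr m n p (A : 'M[C]_(m, p)) (V : 'M[C]_(n, p)) :
  V \is unitarymx -> fro2 (A *m V^t*) <= fro2 A.
Proof.
move=> Vu; have := fro2_ge0 (A - A *m V^t* *m V).
rewrite fro2_subE fro2_unitaryr// fdotC.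
have -> : fdot (A *m V^t* *m V) A = fro2 (A *m V^t*).
  by rewrite /fdot fro2E adjM trmxCK !mulmxA.
lra.
Qed.

Lemma fro2_unitaryl n p (V : 'M[C]_(n, p)) : V \is unitarymx -> fro2 V = n%:R.
Proof.
move=> /unitarymxP Vu; rewrite fro2E Vu mxtrace1.
by rewrite -(rmorph_nat (real_complex R)) reC.
Qed.

Lemma sqnormE n (u : 'rV[C]_n) : sqnorm u = fro2 u.
Proof. by rewrite /sqnorm fro2E trace_mx11 dotmxE. Qed.

End frobenius.

(** * Moments of sign vectors *)

Lemma mx11M (S : pzSemiRingType) (a b : 'M[S]_1) :
  (a *m b) 0 0 = a 0 0 * b 0 0.
Proof. by rewrite mxE big_ord1. Qed.

Section sign_vectors.
Context {R : rcfType} (n : nat).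
Local Notation C := R[i].
Local Notation signs := {ffun 'I_n -> bool}.

Definition sgn (e : signs) (i : 'I_n) : C := (-1) ^+ e i.

Lemma sgn_sq e i : sgn e i * sgn e i = 1.
Proof. by rewrite -expr2 sqrr_sign. Qed.

Let flip (m : 'I_n) (e : signs) : signs := [ffun x => e x (+) (x == m)].

Let flipK m : involutive (flip m).
Proof. by move=> e; apply/ffunP => x; rewrite !ffunE -addbA addbb addbF. Qed.

Let sgn_flip m e i : sgn (flip m e) i = (if i == m then - sgn e i else sgn e i).
Proof. by rewrite /sgn ffunE; case: ifP; case: (e i); rewrite /= ?expr0 ?expr1 ?opprK. Qed.

(** Flipping the coordinate [m] is a bijection of the sign vectors. *)
Let sum_flip m (F : signs -> C) : (forall e, F (flip m e) = - F e) ->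
  \sum_e F e = 0.
Proof.
move=> FN; suff : (\sum_e F e) *+ 2 == 0 by rewrite mulrn_eq0/= => /eqP.
rewrite mulr2n {1}(reindex_inj (inv_inj (flipK m))) -big_split big1//= => e _.
by rewrite FN addNr.
Qed.

Lemma sum_sgn2 i j : \sum_e sgn e i * sgn e j = (2 ^ n)%:R * (i == j)%:R.
Proof.
have [<-|ij] := eqVneq i j.
  under eq_bigr do rewrite sgn_sq.
  by rewrite sumr_const card_ffun card_bool card_ord mulr1.
rewrite mulr0; apply: (@sum_flip i) => e.
by rewrite !sgn_flip eqxx eq_sym (negbTE ij) mulNr.
Qed.

(** By independence only the patterns where the four indices pair up survive; the
last term corrects for the three pairings that coincide when all are equal. *)
Lemma sum_sgn4 i j k l :
  \sum_e sgn e i * sgn e j * (sgn e k * sgn e l) =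
  (2 ^ n)%:R * ((i == j)%:R * (k == l)%:R + (i == k)%:R * (j == l)%:R
    + (i == l)%:R * (j == k)%:R - 2 * ((i == j)%:R * (k == l)%:R * (i == k)%:R)).
Proof.
have [<-|ij] := eqVneq i j.
  under eq_bigr do rewrite sgn_sq mul1r.
  rewrite sum_sgn2; congr (_ * _); have [<-|kl] := eqVneq k l.
    by case: (i == k) => /=; ring.
  have [ik|ik] := eqVneq i k; first by rewrite ik (negbTE kl) /=; ring.
  by rewrite /=; ring.
rewrite eq_sym in ij.
have [<-|ik] := eqVneq i k.
  under eq_bigr => e _ do rewrite mulrACA sgn_sq mul1r.
  by rewrite sum_sgn2 (negbTE ij) /=; congr (_ * _); ring.
have [<-|il] := eqVneq i l.
  under eq_bigr => e _ do rewrite (mulrC (sgn e k)) mulrACA sgn_sq mul1r.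
  by rewrite sum_sgn2 /=; congr (_ * _); ring.
rewrite /= !mul0r !mulr0 !addr0 subr0 mulr0; apply: (@sum_flip i) => e.
rewrite !sgn_flip eqxx (negbTE ij) eq_sym (negbTE ik) eq_sym (negbTE il).
by rewrite !mulNr.
Qed.

Definition sgv (e : signs) : 'rV[C]_n := \row_i sgn e i.

Lemma sgv_conj e : (sgv e)^t* = (sgv e)^T.
Proof.
apply/matrixP => i j; rewrite !mxE /sgn rmorphXn /=.
by rewrite rmorphN1.
Qed.

Lemma sgv_norm e : sgv e *m (sgv e)^T = n%:R%:M.
Proof.
apply/matrixP => i j; rewrite !ord1 !mxE.
under eq_bigr do rewrite !mxE sgn_sq.
by rewrite sumr_const card_ord.
Qed.

Lemma fro2_sgv e : fro2 (sgv e) = n%:R.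
Proof.
rewrite fro2E sgv_conj sgv_norm trace_mx11 mxE eqxx mulr1n.
by rewrite -(rmorph_nat (real_complex R)) reC.
Qed.

Lemma sum_sgv2 : \sum_e (sgv e)^T *m sgv e = (2 ^ n)%:R%:M.
Proof.
apply/matrixP => i j; rewrite summxE !mxE.
under eq_bigr do rewrite !mxE big_ord1 !mxE.
by rewrite sum_sgn2 mulr_natr.
Qed.

Lemma sgv_quadE e (A : 'M[C]_n) :
  (sgv e *m A *m (sgv e)^T) 0 0 = \sum_k \sum_l A k l * (sgn e k * sgn e l).
Proof.
rewrite mxE exchange_big; apply: eq_bigr => l _.
rewrite !mxE mulr_suml; apply: eq_bigr => k _; rewrite !mxE.
by rewrite (mulrC (sgn e k)) mulrA.
Qed.

Definition diag_of (A : 'M[C]_n) : 'M[C]_n := diag_mx (\row_i A i i).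

Lemma sum_sgv4 (A : 'M[C]_n) :
  \sum_e (sgv e *m A *m (sgv e)^T) 0 0 *: ((sgv e)^T *m sgv e) =
  (2 ^ n)%:R *: (A + A^T + (\tr A)%:M - 2 *: diag_of A).
Proof.
apply/matrixP => i j; rewrite summxE.
transitivity (\sum_e \sum_k \sum_l
    A k l * (sgn e i * sgn e j * (sgn e k * sgn e l))).
  apply: eq_bigr => e _; rewrite mxE sgv_quadE mulr_suml.
  have -> : ((sgv e)^T *m sgv e) i j = sgn e i * sgn e j.
    by rewrite mxE big_ord1 !mxE.
  apply: eq_bigr => k _; rewrite mulr_suml; apply: eq_bigr => l _; ring.
rewrite exchange_big.
under eq_bigr => k _.
  rewrite exchange_big.
  under eq_bigr => l _ do rewrite -mulr_sumr sum_sgn4 mulrCA.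
  rewrite -mulr_sumr; over.
rewrite -mulr_sumr !mxE; congr (_ * _).
under eq_bigr => k _.
  under eq_bigr => l _ do rewrite mulrBr !mulrDr.
  rewrite sumrB !big_split /=; over.
rewrite sumrB !big_split /=.
have delta (F : 'I_n -> C) a : \sum_k F k * (a == k)%:R = F a.
  rewrite (bigD1 a)//= eqxx mulr1 big1 ?addr0// => k /negbTE ka.
  by rewrite eq_sym ka mulr0.
have delta' (F : 'I_n -> C) a : \sum_k F k * (k == a)%:R = F a.
  by rewrite -[RHS]delta; under eq_bigr do rewrite eq_sym.
have -> : \sum_k \sum_l A k l * ((i == j)%:R * (k == l)%:R) = \tr A *+ (i == j).
  rewrite -[RHS]mulr_natr /mxtrace mulr_suml; apply: eq_bigr => k _.
  under eq_bigr do rewrite mulrCA mulrC.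
  by rewrite -mulr_suml delta.
have -> : \sum_k \sum_l A k l * ((i == k)%:R * (j == l)%:R) = A i j.
  under eq_bigr => k _.
    under eq_bigr do rewrite mulrCA mulrC.
    rewrite -mulr_suml delta; over.
  by rewrite delta.
have -> : \sum_k \sum_l A k l * ((i == l)%:R * (j == k)%:R) = A j i.
  under eq_bigr => k _.
    under eq_bigr do rewrite mulrA.
    rewrite -mulr_suml delta; over.
  by rewrite delta.
have -> : \sum_k \sum_l A k l * (2 * ((i == j)%:R * (k == l)%:R * (i == k)%:R))
    = 2 * (A i i *+ (i == j)).
  under eq_bigr => k _.
    rewrite (eq_bigr (fun l => (2 * (i == j)%:R * (i == k)%:R) *
      (A k l * (k == l)%:R))); last by move=> l _; ring.
    rewrite -mulr_sumr delta -mulrA (mulrC _ (A k k)); over.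
  by rewrite -mulr_sumr delta -[in RHS]mulr_natr; ring.
by ring.
Qed.

(** Khintchine-type bound: [3] is the fourth moment of a Gaussian, and dropping
the diagonal correction of [sum_sgv4] only increases the sum. *)
Lemma sum_nsq_sgv (x y : 'rV[C]_n) :
  \sum_e nsq ((x *m (sgv e)^T) 0 0) * nsq ((y *m (sgv e)^T) 0 0)
  <= (2 ^ n)%:R * (3 * (fro2 x * fro2 y)).
Proof.
pose A := x^t* *m x; pose B := y^t* *m y.
have quadE (z : 'rV[C]_n) e : (nsq ((z *m (sgv e)^T) 0 0))%:C =
    (sgv e *m (z^t* *m z) *m (sgv e)^T) 0 0.
  rewrite mulmxA -[_ *m _ *m (sgv e)^T]mulmxA mx11M mulrC nsqE; congr (_ * _).
  have -> : sgv e *m z^t* = (z *m (sgv e)^T)^t*.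
    by rewrite adjM -sgv_conj trmxCK.
  by rewrite !mxE.
have trE (D : 'M[C]_n) : \sum_i \sum_j B i j * D i j = (y *m D^T *m y^t*) 0 0.
  rewrite mxE; apply: eq_bigr => i _; rewrite [(y *m D^T) 0 i]mxE mulr_suml.
  by apply: eq_bigr => j _; rewrite /B !mxE big_ord1 !mxE -mulrA mulrC.
have key : (\sum_e nsq ((x *m (sgv e)^T) 0 0) * nsq ((y *m (sgv e)^T) 0 0))%:C =
    (2 ^ n)%:R * (nsq ((x *m y^T) 0 0) + nsq ((x *m y^t*) 0 0)
      + fro2 x * fro2 y - 2 * \sum_i nsq (x 0 i) * nsq (y 0 i))%:C.
  rewrite rmorph_sum /=.
  transitivity (\sum_i \sum_j B i j * (\sum_e (sgv e *m A *m (sgv e)^T) 0 0 *: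
      ((sgv e)^T *m sgv e)) i j).
    transitivity (\sum_e \sum_i \sum_j B i j *
        ((sgv e *m A *m (sgv e)^T) 0 0 * (sgn e i * sgn e j))).
      apply: eq_bigr => e _; rewrite rmorphM/= quadE quadE -/A -/B (sgv_quadE e B).
      rewrite mulr_sumr; apply: eq_bigr => i _; rewrite mulr_sumr.
      by apply: eq_bigr => j _; rewrite mulrCA.
    rewrite exchange_big; apply: eq_bigr => i _.
    rewrite exchange_big; apply: eq_bigr => j _.
    rewrite -mulr_sumr summxE; congr (_ * _); apply: eq_bigr => e _.
    by rewrite [RHS]mxE; congr (_ * _); rewrite [RHS]mxE big_ord1 !mxE.
  have -> : \sum_i \sum_j B i j * (\sum_e (sgv e *m A *m (sgv e)^T) 0 0 *:
      ((sgv e)^T *m sgv e)) i j = (2 ^ n)%:R * (\sum_i \sum_j B i j *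
      (A + A^T + (\tr A)%:M - 2 *: diag_of A) i j).
    rewrite sum_sgv4 mulr_sumr; apply: eq_bigr => i _; rewrite mulr_sumr.
    by apply: eq_bigr => j _; rewrite [X in _ * X]mxE mulrCA.
  congr (_ * _); pose S (D : 'M[C]_n) := \sum_i \sum_j B i j * D i j.
  have SD D D' : S (D + D') = S D + S D'.
    rewrite /S -big_split; apply: eq_bigr => i _; rewrite -big_split.
    by apply: eq_bigr => j _; rewrite [X in _ * X]mxE mulrDr.
  have SZ z D : S (z *: D) = z * S D.
    rewrite /S mulr_sumr; apply: eq_bigr => i _; rewrite mulr_sumr.
    by apply: eq_bigr => j _; rewrite [X in _ * X]mxE mulrCA.
  have trQ (a b : 'rV[C]_n) : (a *m b^T) 0 0 = (b *m a^T) 0 0.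
    by rewrite -[a *m b^T]trmxK trmx_mul trmxK mxE.
  have adjQ (a b : 'rV[C]_n) : (a *m b^t*) 0 0 = Num.conj ((b *m a^t*) 0 0).
    have -> : a *m b^t* = (b *m a^t*)^t* by rewrite adjM trmxCK.
    by rewrite mxE mxE.
  transitivity (S (A + A^T + (\tr A)%:M - 2 *: diag_of A)); first by [].
  have -> : (nsq ((x *m y^T) 0 0) + nsq ((x *m y^t*) 0 0) + fro2 x * fro2 y
      - 2 * \sum_i nsq (x 0 i) * nsq (y 0 i))%:C = (nsq ((x *m y^T) 0 0))%:C
      + (nsq ((x *m y^t*) 0 0))%:C + (fro2 x)%:C * (fro2 y)%:C
      - 2 * \sum_i (nsq (x 0 i))%:C * (nsq (y 0 i))%:C.
    have CE (a b c d s : R) : (a + b + c * d - 2 * s)%:C =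
        a%:C + b%:C + c%:C * d%:C - 2 * s%:C.
      by rewrite rmorphB !rmorphD !rmorphM rmorph_nat.
    rewrite CE; congr (_ - _ * _); rewrite rmorph_sum; apply: eq_bigr => i _.
    exact: rmorphM.
  rewrite !SD -scaleNr SZ; congr (_ + _ + _ + _).
  - rewrite /S trE trmx_mul mulmxA -[y *m _ *m _ *m _]mulmxA mx11M nsqE trQ.
    congr (_ * _); have -> : (x^t*)^T *m y^t* = (x *m y^T)^t*.
      apply/matrixP => i j; rewrite !ord1 !mxE rmorph_sum; apply: eq_bigr => k _.
      by rewrite !mxE rmorphM.
    by rewrite [LHS]mxE; congr (Num.conj _); rewrite [LHS]mxE.
  - by rewrite /S trE trmxK mulmxA -[y *m _ *m _ *m _]mulmxA mx11M nsqE mulrC -adjQ.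
  - rewrite /S trE tr_scalar_mx mul_mx_scalar -scalemxAl mxE.
    by rewrite !fro2CE /A [\tr (_ *m x)]mxtrace_mulC !trace_mx11.
  - rewrite mulNr; congr (- (_ * _)).
    rewrite /S; apply: eq_bigr => i _; rewrite (bigD1 i)//= big1 ?addr0.
      rewrite !mxE eqxx mulr1n !big_ord1 !mxE !nsqE; ring.
    by move=> j ji; rewrite [X in _ * X]mxE eq_sym (negbTE ji) mulr0.
move/(congr1 (@complex.Re R)): key; rewrite reC -(rmorph_nat (real_complex R)) reZ reC => ->.
rewrite ler_wpM2l//; set c := fro2 x * fro2 y.
rewrite (_ : 3 * c = c + c + c - 0); last by ring.
rewrite lerB ?lerD//.
- by rewrite /c -(fro2_tr y) row_col_nsq.
- by rewrite /c -(fro2_adj y) row_col_nsq.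
- by rewrite mulr_ge0// sumr_ge0// => i _; rewrite mulr_ge0 ?nsq_ge0.
Qed.

Lemma sum_fro2_sgv m p (V : 'M[C]_(m, n)) (Y : 'M[C]_(p, n)) :
  \sum_e fro2 (V *m (sgv e)^T) * fro2 (Y *m (sgv e)^T)
  <= (2 ^ n)%:R * (3 * (fro2 V * fro2 Y)).
Proof.
have colE q (Z : 'M[C]_(q, n)) e :
    fro2 (Z *m (sgv e)^T) = \sum_i nsq ((row i Z *m (sgv e)^T) 0 0).
  apply: eq_bigr => i _; rewrite big_ord1; congr nsq; rewrite !mxE.
  by apply: eq_bigr => j _; rewrite !mxE.
under eq_bigr => e _.
  rewrite !colE mulr_suml; under eq_bigr do rewrite mulr_sumr; over.
rewrite exchange_big (fro2_row_sum V) mulr_suml !mulr_sumr ler_sum// => a _.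
rewrite exchange_big (fro2_row_sum Y) !mulr_sumr ler_sum// => b _.
exact: sum_nsq_sgv.
Qed.

End sign_vectors.

(** * Random reflections of a compressed matrix *)

Section operator_bound.
Context {R : rcfType} (n : nat).
Local Notation C := R[i].
Implicit Types (A : 'M[C]_n) (M : R).

(** A bound on the operator norm, phrased without a supremum. *)
Definition opbound M A := forall x : 'rV[C]_n, fro2 (x *m A) <= M ^+ 2 * fro2 x.

Lemma opboundM M A m (Y : 'M[C]_(m, n)) :
  opbound M A -> fro2 (Y *m A) <= M ^+ 2 * fro2 Y.
Proof.
move=> bA; rewrite !fro2_row_sum mulr_sumr ler_sum// => i _.
by rewrite row_mul.
Qed.

Lemma opbound_tr M A : A \is hermsymmx -> opbound M A -> opbound M A^T.
Proof.
move=> /hermP Ah bA x.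
have -> : x *m A^T = map_mx Num.conj (map_mx Num.conj x *m A).
  rewrite map_mxM /=; congr (_ *m _).
    by apply/matrixP => i j; rewrite !mxE conjCK.
  by rewrite -[in LHS]Ah; apply/matrixP => i j; rewrite !mxE.
have conjE m (y : 'M[C]_(m, n)) : fro2 (map_mx Num.conj y) = fro2 y.
  by do 2 apply: eq_bigr => ? _; rewrite mxE nsqJ.
by rewrite conjE (le_trans (bA _))// conjE.
Qed.

(** Each diagonal entry is an entry of the image of a unit vector. *)
Lemma opbound_diag M A : opbound M A -> opbound M (diag_of A).
Proof.
move=> bA x; rewrite /fro2 !big_ord1 mulr_sumr ler_sum// => j _.
rewrite mul_mx_diag !mxE nsqM mulrC ler_wpM2r ?nsq_ge0//.
have := bA (delta_mx 0 j); rewrite -rowE.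
rewrite [X in _ * X](_ : _ = 1) ?mulr1; last first.
  rewrite /fro2 big_ord1 (bigD1 j)//= mxE !eqxx nsq1 big1 ?addr0// => k /negbTE kj.
  by rewrite mxE kj andbF nsq0.
by apply: le_trans; have := nsq_le_fro2 (row j A) 0 j; rewrite mxE.
Qed.

End operator_bound.

Section reflections.
Context {R : rcfType} (n : nat).
Hypothesis n_gt0 : (0 < n)%N.
Local Notation C := R[i].
Local Notation signs := {ffun 'I_n -> bool}.
Local Notation k := (2 / n%:R : R).

Let n0 : n%:R != 0 :> R. Proof. by rewrite pnatr_eq0 -lt0n. Qed.
(* The side condition of [field] over the complex scalars. *)
Let n0C : n%:R != 0 :> C. Proof. by rewrite pnatr_eq0 -lt0n. Qed.

(** The Householder reflection along the sign vector [e]. It is real, so it lies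
in the isometry group of both symmetry classes. *)
Definition refl (e : signs) : 'M[C]_n :=
  1%:M - (2 / n%:R)%:C *: ((sgv e)^T *m sgv e).

Lemma refl_adj e : (refl e)^t* = refl e.
Proof.
rewrite adjB adj1 adjZ adjM sgv_conj; congr (_ - _ *: (_ *m _)).
by rewrite -[RHS]trmxCK sgv_conj.
Qed.

Lemma reflK e : refl e *m refl e = 1%:M.
Proof.
rewrite /refl mulmxBl mul1mx mulmxBr mulmx1 -scalemxAl -scalemxAr scalerA.
have -> : (sgv e)^T *m sgv e *m ((sgv e)^T *m sgv e) =
    n%:R *: ((sgv e)^T *m sgv e) :> 'M[C]_n.
  by rewrite mulmxA -[_ *m _ *m (sgv e)^T]mulmxA sgv_norm mul_mx_scalar -scalemxAl.
rewrite scalerA.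
have -> : k%:C * k%:C * n%:R = k%:C + k%:C :> C.
  by rewrite -(rmorph_nat (real_complex R)) -!rmorphM -rmorphD/=; congr _%:C; field.
by rewrite scalerDl opprB addrK subrK.
Qed.

Lemma refl_real e : refl e \is a realmx.
Proof.
apply/mxOverP => i j; rewrite !mxE big_ord1 !mxE; apply: rpredB.
  by rewrite realn.
apply: rpredM; first by apply/CrealP; rewrite conjCR.
by apply: rpredM; rewrite /sgn rpredX// rpredN rpred1.
Qed.

Lemma refl_unitary e : refl e \is unitarymx.
Proof. by apply/unitarymxP; rewrite refl_adj reflK. Qed.

Lemma refl_isometry beta e : isometry_group beta (refl e).
Proof. by split; [case: beta => //; exact: refl_real|exact: refl_unitary]. Qed.

Lemma refl_conjE e (A : 'M[C]_n) : refl e *m A *m refl e =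
  A - k%:C *: ((sgv e)^T *m sgv e *m A + A *m ((sgv e)^T *m sgv e))
  + (k ^+ 2)%:C *: ((sgv e *m A *m (sgv e)^T) 0 0 *: ((sgv e)^T *m sgv e)).
Proof.
set W := (sgv e)^T *m sgv e.
have -> : (sgv e *m A *m (sgv e)^T) 0 0 *: W = W *m A *m W.
  transitivity ((sgv e)^T *m (sgv e *m A *m (sgv e)^T) *m sgv e).
    by rewrite [in RHS](mx11_scalar (sgv e *m A *m _)) mul_mx_scalar -scalemxAl.
  by rewrite /W !mulmxA.
rewrite /refl -/W mulmxBr mulmx1 (mulmxBl _ _ A) mul1mx -scalemxAl -scalemxAr.
rewrite (mulmxBl A) -scalemxAl scalerBr scalerA opprB scalerDr opprD.
by rewrite [LHS]addrA [LHS]addrAC !addrA rmorphXn expr2.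
Qed.

(** Expand the two reflections: the linear terms average by the second moments of
the signs, the quadratic one by the fourth moments in [sum_sgv4]. *)
Lemma sum_refl_conj (A : 'M[C]_n) : \tr A = 0 ->
  \sum_e refl e *m A *m refl e = (2 ^ n)%:R *:
    ((1 - 4 / n%:R)%:C *: A + (4 / n%:R ^+ 2)%:C *: (A + A^T - 2 *: diag_of A)).
Proof.
move=> trA; under eq_bigr do rewrite refl_conjE.
rewrite big_split/= -scaler_sumr sum_sgv4 trA [0%:M]raddf0 addr0.
rewrite sumrB sumr_const card_ffun card_bool card_ord -scaler_sumr big_split/=.
rewrite -mulmx_suml -mulmx_sumr sum_sgv2 mul_scalar_mx mul_mx_scalar.
have kE : k%:C = 2 / n%:R :> C by rewrite rmorphM fmorphV !rmorph_nat.
have k2E : (k ^+ 2)%:C = (2 / n%:R) ^+ 2 :> C by rewrite -kE; exact: rmorphXn.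
have c1E : (1 - 4 / n%:R)%:C = 1 - 4 / n%:R :> C.
  by rewrite rmorphB rmorph1 rmorphM fmorphV !rmorph_nat.
have c2E : (4 / n%:R ^+ 2)%:C = 4 / n%:R ^+ 2 :> C.
  by rewrite rmorphM fmorphV rmorphXn !rmorph_nat.
rewrite kE k2E c1E c2E -scaler_nat.
set N := _%:R; move: (2 *: diag_of A) => D; apply/matrixP => i j; rewrite !mxE.
by move: (A i j) (A j i) (D i j) => x y z; field.
Qed.

Section compression.
Context (r : nat) (V : 'M[C]_(r, n)) (A : 'M[C]_n) (M : R).
Hypotheses (Vu : V \is unitarymx) (Ah : A \is hermsymmx) (trA : \tr A = 0)
  (bA : opbound M A).
Local Notation q := (V *m A *m V^t*).
Local Notation qe e := (V *m (refl e *m A *m refl e) *m V^t*).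

Lemma fro2_compress_le (B : 'M[C]_n) : opbound M B ->
  fro2 (V *m B *m V^t*) <= M ^+ 2 * r%:R.
Proof.
move=> bB; rewrite (le_trans (fro2_projr _ Vu))//.
by rewrite (le_trans (opboundM _ bB))// fro2_unitaryl.
Qed.

(** By [sum_refl_conj] the average of the reflected [A] is [A] shrunk by the factor
[1 - 4/n], plus matrices of bounded norm weighted by [n^-2]. *)
Lemma sum_fdot_refl : \sum_e fdot (qe e) q <=
  (2 ^ n)%:R * ((1 - 4 / n%:R) * fro2 q + 4 / n%:R ^+ 2 * (9 * (M ^+ 2 * r%:R))).
Proof.
rewrite -fdot_suml -mulmx_suml -mulmx_sumr sum_refl_conj//.
set B := A + A^T - _.
rewrite -scalemxAr -scalemxAl -(rmorph_nat (real_complex R)) fdotZl.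
rewrite ler_wpM2l// mulmxDr mulmxDl fdotDl -!scalemxAr -!scalemxAl !fdotZl.
rewrite -fro2_fdot lerD2l ler_wpM2l ?divr_ge0 ?exprn_ge0//.
have qle : fro2 q <= M ^+ 2 * r%:R by exact: fro2_compress_le.
have Ble : fro2 (V *m B *m V^t*) <= 16 * (M ^+ 2 * r%:R).
  have := fro2_unitaryl Vu => Vr.
  rewrite (le_trans (fro2_projr _ Vu))// /B mulmxBr mulmxDr -scalemxAr.
  rewrite (le_trans (fro2B _ _))// fro2Z -[2]/(2%:R) -(rmorph_nat (real_complex R)) nsqR.
  have := opboundM V bA; have := opboundM V (opbound_tr Ah bA).
  have := opboundM V (opbound_diag bA); rewrite Vr.
  have := fro2D (V *m A) (V *m A^T); lra.
have := mulr_ge0 (sqr_ge0 M) (ler0n R r).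
(* Twice the inner product is at most the sum [(16 + 1) * (M ^+ 2 * r)] of the
squared norms. *)
have := fro2_ge0 (V *m B *m V^t* - q); rewrite fro2_subE; lra.
Qed.

(** A reflection differs from the identity by a rank one term of size [n^-1], so
its square is of order [n^-2] once the fourth moments of the signs are bounded. *)
Lemma sum_dist_refl : \sum_e fro2 (q - qe e) <=
  (2 ^ n)%:R * (192 * r%:R ^+ 2 * M ^+ 2 / n%:R ^+ 2).
Proof.
have stepE e : q - qe e = k%:C *: ((V *m (sgv e)^T) *m (V *m A *m (sgv e)^T)^t*
    + (V *m A *m (sgv e)^T) *m (V *m (sgv e)^T)^t*)
    - (k ^+ 2)%:C *: ((sgv e *m A *m (sgv e)^T) 0 0 *:
      ((V *m (sgv e)^T) *m (V *m (sgv e)^T)^t*)).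
  have adjV : (V *m (sgv e)^T)^t* = sgv e *m V^t*.
    by rewrite adjM -sgv_conj trmxCK.
  have adjVA : (V *m A *m (sgv e)^T)^t* = sgv e *m A *m V^t*.
    by rewrite !adjM -sgv_conj trmxCK (hermP _ Ah) mulmxA.
  rewrite adjV adjVA refl_conjE mulmxDr mulmxDl mulmxBr mulmxBl.
  rewrite opprD addrA subKr -!scalemxAr -!scalemxAl mulmxDr mulmxDl.
  by rewrite !mulmxA; congr (_ - _ *: _); rewrite -scalemxAl.
have pw e : fro2 (q - qe e) <= 32 / n%:R ^+ 2 *
    (fro2 (V *m (sgv e)^T) * fro2 (V *m A *m (sgv e)^T)
     + M ^+ 2 * (fro2 (V *m (sgv e)^T) * fro2 (V *m (sgv e)^T))).
  rewrite stepE; set p := V *m (sgv e)^T; set s := V *m A *m (sgv e)^T.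
  set c := (sgv e *m A *m (sgv e)^T) 0 0.
  have cle : nsq c <= M ^+ 2 * n%:R ^+ 2.
    rewrite (le_trans (row_col_nsq _ _))// fro2_tr fro2_sgv.
    by rewrite expr2 mulrA ler_wpM2r// (le_trans (bA _))// fro2_sgv.
  rewrite (le_trans (fro2B _ _))// !fro2Z !nsqR.
  have h1 : fro2 (p *m s^t* + s *m p^t*) <= 4 * (fro2 p * fro2 s).
    rewrite (le_trans (fro2D _ _))//.
    have := fro2M p (s^t*); have := fro2M s (p^t*); rewrite !fro2_adj; lra.
  have h2 : nsq c * fro2 (p *m p^t*) <= M ^+ 2 * n%:R ^+ 2 * (fro2 p * fro2 p).
    rewrite ler_pM ?nsq_ge0 ?fro2_ge0//.
    by have := fro2M p (p^t*); rewrite fro2_adj.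
  set K : R := n%:R; rewrite -/K in h2 *.
  apply: (@le_trans _ _ (2 * ((2 / K) ^+ 2 * (4 * (fro2 p * fro2 s)))
    + 2 * (((2 / K) ^+ 2) ^+ 2 * (M ^+ 2 * K ^+ 2 * (fro2 p * fro2 p))))).
    by rewrite lerD// ler_wpM2l// ler_wpM2l// ?sqr_ge0.
  by rewrite le_eqVlt; apply/orP; left; apply/eqP; field.
rewrite (le_trans (ler_sum _ (fun e _ => pw e)))// -mulr_sumr big_split/=.
rewrite -mulr_sumr.
have h1 := sum_fro2_sgv V (V *m A); have h2 := sum_fro2_sgv V V.
have Vr := fro2_unitaryl Vu; have VA := opboundM V bA.
rewrite Vr in h1 h2 VA.
have h3 : (2 ^ n)%:R * (3 * (r%:R * fro2 (V *m A))) <=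
    (2 ^ n)%:R * (3 * (r%:R * (M ^+ 2 * r%:R))) :> R.
  by rewrite !ler_wpM2l.
have h4 := ler_wpM2l (sqr_ge0 M) h2.
set K : R := n%:R; set NN : R := (2 ^ n)%:R; rewrite -/NN in h1 h3 h4.
apply: (@le_trans _ _ (32 / K ^+ 2 * (NN * (3 * (r%:R * (M ^+ 2 * r%:R)))
   + M ^+ 2 * (NN * (3 * (r%:R * r%:R)))))).
  by rewrite ler_wpM2l ?divr_ge0 ?sqr_ge0// lerD// (le_trans h1).
by rewrite le_eqVlt; apply/orP; left; apply/eqP; field.
Qed.

(** The constant collecting the two error terms of the averages above. *)
Definition drift_const : R := (36 * r%:R + 288 * r%:R ^+ 2) * M ^+ 2.

(** The drift of [fro2 q] under random reflections is negative, up to errors; the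
square is completed so that only [fro2 q ^+ 2] remains. *)
Lemma sum_drift :
  (2 ^ n)%:R * (2 / n%:R * fro2 q ^+ 2 - drift_const ^+ 2 / (8 * n%:R ^+ 3)) <=
  \sum_e ((fro2 q - fdot (qe e) q) * fro2 q
           - 3 / 2 * (fro2 q * fro2 (q - qe e))).
Proof.
rewrite sumrB -mulr_suml -!mulr_sumr sumrB sumr_const card_ffun card_bool card_ord.
rewrite -[fro2 q *+ _]mulr_natl.
have := sum_fdot_refl; have := sum_dist_refl.
set T := \sum_e fdot _ _; set D := \sum_e fro2 _; rewrite /drift_const.
set N : R := (2 ^ n)%:R; set m : R := n%:R; set F := fro2 q.
set rr : R := r%:R => hD hT.
have F0 : 0 <= F by exact: fro2_ge0.
have m0 : m != 0 by [].
have N0 : 0 <= N by exact: ler0n.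
apply: (@le_trans _ _ ((N * F - N * ((1 - 4 / m) * F
    + 4 / m ^+ 2 * (9 * (M ^+ 2 * rr)))) * F
    - 3 / 2 * (F * (N * (192 * rr ^+ 2 * M ^+ 2 / m ^+ 2))))); last first.
  apply: lerB; first by rewrite ler_wpM2r// lerD2l lerN2.
  by apply: ler_wpM2l; rewrite ?divr_ge0// ler_wpM2l.
rewrite -subr_ge0.
set c : R := (36 * rr + 288 * rr ^+ 2) * M ^+ 2.
rewrite (_ : _ - _ = N * (2 / m * (F - c / (4 * m)) ^+ 2)); last first.
  by rewrite /c; field.
by rewrite mulr_ge0// mulr_ge0 ?sqr_ge0// divr_ge0// ler0n.
Qed.

End compression.

(** With [D] the squared distance of [q] and [q'], the sum is half the square of
[fro2 q - fro2 q'] minus [D * (fro2 q + fro2 q')], and Cauchy-Schwarz applied to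
[q - q'] and [q + q'] bounds that square. The weight [3/2] is chosen for this. *)
Lemma drift_swap m p (q q' : 'M[C]_(m, p)) :
  ((fro2 q - fdot q' q) * fro2 q - 3 / 2 * (fro2 q * fro2 (q - q')))
  + ((fro2 q' - fdot q' q) * fro2 q' - 3 / 2 * (fro2 q' * fro2 (q - q'))) <= 0.
Proof.
have DE := fro2_subE q q'.
have CS := fdot_CS (q - q') (q + q').
have E1 : fdot (q - q') (q + q') = fro2 q - fro2 q'.
  rewrite fdotBl (fdotC q) (fdotC q') !fdotDl !fro2_fdot (fdotC q' q); ring.
have E2 : fro2 (q + q') <= 2 * fro2 q + 2 * fro2 q' by exact: fro2D.
rewrite E1 in CS; have D0 := fro2_ge0 (q - q').
rewrite (fdotC q') in DE *; move: DE CS E2 D0.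
move: (fro2 (q - q')) (fro2 (q + q')) (fro2 q) (fro2 q') (fdot q q').
move=> D S a b t DE CS E2 D0.
have h := ler_wpM2l D0 E2.
have -> : t = (a + b - D) / 2 by rewrite DE; field.
nra.
Qed.

End reflections.

(** * Measurable matrices and laws of pairs *)

Section measurable_matrices.
Context {R : realType} {d} {T : measurableType d}.
Local Notation C := R[i].

(** Measurability by real and imaginary parts, as in the generators of the Borel
sigma-algebra on matrices. *)
Definition cmeas (f : T -> C) :=
  measurable_fun setT (fun x => re (f x) : R) /\
  measurable_fun setT (fun x => im (f x) : R).

Lemma cmeas_cst c : cmeas (fun=> c).
Proof. by split; exact: measurable_cst. Qed.

Lemma cmeasD f g : cmeas f -> cmeas g -> cmeas (fun x => f x + g x).
Proof.
move=> [f1 f2] [g1 g2]; split.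
  by under eq_fun do rewrite reD; exact: measurable_funD.
by under eq_fun do rewrite imD; exact: measurable_funD.
Qed.

Lemma cmeasM f g : cmeas f -> cmeas g -> cmeas (fun x => f x * g x).
Proof.
move=> [f1 f2] [g1 g2]; split.
  by under eq_fun do rewrite reM; apply: measurable_funB; exact: measurable_funM.
by under eq_fun do rewrite imM; apply: measurable_funD; exact: measurable_funM.
Qed.

Lemma cmeas_sum I (s : seq I) (f : I -> T -> C) :
  (forall i, cmeas (f i)) -> cmeas (fun x => \sum_(i <- s) f i x).
Proof.
move=> mf; elim: s => [|i s IH].
  by under eq_fun do rewrite big_nil; exact: cmeas_cst.
by under eq_fun do rewrite big_cons; exact: cmeasD.
Qed.

Definition mxmeas m n (f : T -> 'M[C]_(m, n)) :=
  forall i j, cmeas (fun x => f x i j).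

Lemma mxmeas_cst m n (A : 'M[C]_(m, n)) : mxmeas (fun=> A).
Proof. by move=> i j; exact: cmeas_cst. Qed.

Lemma mxmeasD m n (f g : T -> 'M[C]_(m, n)) :
  mxmeas f -> mxmeas g -> mxmeas (fun x => f x + g x).
Proof. by move=> mf mg i j; under eq_fun do rewrite mxE; exact: cmeasD. Qed.

Lemma mxmeasM m n p (f : T -> 'M[C]_(m, n)) (g : T -> 'M[C]_(n, p)) :
  mxmeas f -> mxmeas g -> mxmeas (fun x => f x *m g x).
Proof.
move=> mf mg i j; under eq_fun do rewrite mxE.
by apply: cmeas_sum => k; exact: cmeasM.
Qed.

Lemma mxmeasZ m n (f : T -> C) (g : T -> 'M[C]_(m, n)) :
  cmeas f -> mxmeas g -> mxmeas (fun x => f x *: g x).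
Proof. by move=> mf mg i j; under eq_fun do rewrite mxE; exact: cmeasM. Qed.

Lemma mxmeasB m n (f g : T -> 'M[C]_(m, n)) :
  mxmeas f -> mxmeas g -> mxmeas (fun x => f x - g x).
Proof.
move=> mf mg; apply: mxmeasD => // i j; under eq_fun do rewrite mxE -mulN1r.
by apply: cmeasM => //; exact: cmeas_cst.
Qed.

Lemma cmeas_tr n (f : T -> 'M[C]_n) : mxmeas f -> cmeas (fun x => \tr (f x)).
Proof. by move=> mf; exact: cmeas_sum. Qed.

Lemma mxmeas_exp n (f : T -> 'M[C]_n) k :
  mxmeas f -> mxmeas (fun x => (f x ^+ k : 'M[C]_n)).
Proof.
move=> mf; elim: k => [|k IH]; first exact: mxmeas_cst.
by under eq_fun do rewrite exprS; exact: mxmeasM.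
Qed.

Lemma measurable_mxBorelP n (f : T -> mxBorel R n) :
  measurable_fun setT f <-> mxmeas (f : T -> 'M[C]_n).
Proof.
split=> [mf i j|mf].
  by split=> _ S mS; rewrite setTI;
    [rewrite -[X in measurable X]/(f @^-1` [set A : 'M[C]_n | S (re (A i j))])
    |rewrite -[X in measurable X]/(f @^-1` [set A : 'M[C]_n | S (im (A i j))])];
    rewrite -[X in measurable X]setTI; apply: mf => //; apply: sub_sigma_algebra;
    exists i, j, S; split => //; [left|right].
apply: (@measurability _ _ T (mxBorel R n) setT f (@mx_cylinders R n)) => //.
move=> _ [_ [i [j [S [mS [->|->]]]]] <-]; rewrite setTI.
  by have [m1 _] := mf i j; rewrite -[X in measurable X]setTI; exact: m1.
by have [_ m2] := mf i j; rewrite -[X in measurable X]setTI; exact: m2.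
Qed.

End measurable_matrices.

Section joint_law.
Context {d d1 d2 : measure_display} {R : realType} {Omega : measurableType d}
  {T1 : measurableType d1} {T2 : measurableType d2} (Pr : probability Omega R).

(** Measurable rectangles form a generating system stable under intersection, so
they determine the law of a pair and with it the expectations. *)
Lemma eq_expectation_pair (X X' : Omega -> T1) (Y Y' : Omega -> T2)
    (h : T1 * T2 -> R) :
  measurable_fun setT X -> measurable_fun setT X' ->
  measurable_fun setT Y -> measurable_fun setT Y' ->
  (forall A B, measurable A -> measurable B ->
    Pr (X @^-1` A `&` Y @^-1` B) = Pr (X' @^-1` A `&` Y' @^-1` B)) ->
  measurable_fun setT h ->
  Pr.-integrable setT (fun w => (h (X w, Y w))%:E) ->
  Pr.-integrable setT (fun w => (h (X' w, Y' w))%:E) ->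
  \int[Pr]_w h (X w, Y w) = \int[Pr]_w h (X' w, Y' w).
Proof.
rewrite /Rintegral => mX mX' mY mY' XY mh iXY iXY'.
have mp := measurable_fun_pair mX mY; have mp' := measurable_fun_pair mX' mY'.
congr fine; have mEh : measurable_fun setT (EFin \o h) by exact/measurable_EFinP.
have := @integral_pushforward _ _ _ _ _ _ mp Pr setT _ mEh; rewrite preimage_setT.
move=> /(_ iXY measurableT)/= <-.
have := @integral_pushforward _ _ _ _ _ _ mp' Pr setT _ mEh; rewrite preimage_setT.
move=> /(_ iXY' measurableT)/= <-.
apply: eq_measure_integral => S mS _.
apply: (measure_unique [set A `*` B | A in measurable & B in measurable]
  (fun=> setT)) => //.
- exact: measurable_prod_measurableType.
- move=> _ _ [A mA [B mB <-]] [A' mA' [B' mB' <-]]; rewrite -setXI.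
  by exists (A `&` A'); [exact: measurableI|exists (B `&` B');
    [exact: measurableI|]].
- by move=> _; exists setT => //; exists setT => //; rewrite setXTT.
- by rewrite bigcup_const.
- move=> _ [A mA [B mB <-]]; exact: XY.
- move=> _; rewrite [X in (X < _)%E](_ : _ = 1%E) ?ltry//.
  exact: (probability_setT Pr).
Qed.

End joint_law.

(** * Diagonal conjugates and the spectral theorem *)

Section diagonal_conjugates.
Context {R : rcfType}.
Local Notation C := R[i].

(** For [S] square unitary this is the matrix with eigenvectors the rows of [S]
and eigenvalues [d]; for [S] with fewer orthonormal rows, the remaining
eigenvalues are zero. Locked, so that unification does not look inside. *)
Definition dgc r n (S : 'M[C]_(r, n)) (d : 'I_r -> R) : 'M[C]_n :=
  locked (S^t* *m diag_mx (\row_j (d j)%:C) *m S).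

Lemma dgc_def r n (S : 'M[C]_(r, n)) d :
  dgc S d = S^t* *m diag_mx (\row_j (d j)%:C) *m S.
Proof. by rewrite /dgc -lock. Qed.

Lemma exists_left_kernel m k (M : 'M[C]_(m, k)) : (k < m)%N ->
  exists2 y : 'rV[C]_m, y != 0 & y *m M = 0.
Proof.
move=> km; have : kermx M != 0.
  by rewrite kermx_eq0 /row_free neq_ltn (leq_ltn_trans (rank_leq_col M)).
by move=> /rowV0Pn[y /sub_kermxP yM y0]; exists y.
Qed.

(** The Hermitian form of [A]; only its real part matters. *)
Definition qf n (A : 'M[C]_n) (x : 'rV[C]_n) : R := re ((x *m A *m x^t*) 0 0).

Section rectangular.
Context r n (S : 'M[C]_(r, n)).
Implicit Types d : 'I_r -> R.

Lemma dgcE d a b :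
  dgc S d a b = \sum_i Num.conj (S i a) * (d i)%:C * S i b.
Proof.
by rewrite dgc_def mxE; apply: eq_bigr => i _; rewrite mul_mx_diag !mxE.
Qed.

Lemma dgc_adj d : (dgc S d)^t* = dgc S d.
Proof.
have DJ : (diag_mx (\row_j (d j)%:C))^t* = diag_mx (\row_j (d j)%:C) :> 'M[C]_r.
  apply/matrixP => i j; rewrite !mxE eq_sym rmorphMn /=.
  by have [->|_] := eqVneq i j; rewrite ?mulr0n// !mulr1n conjCR.
by rewrite dgc_def !adjM trmxCK DJ mulmxA.
Qed.

Lemma dgc_herm d : dgc S d \is hermsymmx.
Proof. exact/hermP/dgc_adj. Qed.

Lemma eq_dgc d d' : d =1 d' -> dgc S d = dgc S d'.
Proof. by move=> /funext ->. Qed.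

Lemma dgcD d d' : dgc S d + dgc S d' = dgc S (fun i => d i + d' i).
Proof.
rewrite !dgc_def -mulmxDl -mulmxDr.
have -> // : diag_mx (\row_j (d j)%:C) + diag_mx (\row_j (d' j)%:C) =
  diag_mx (\row_j (d j + d' j)%:C) :> 'M[C]_r.
by apply/matrixP => i j; rewrite !mxE rmorphD mulrnDl.
Qed.

Lemma dgcZ x d : x%:C *: dgc S d = dgc S (fun i => x * d i).
Proof.
rewrite !dgc_def scalemxAl scalemxAr.
have -> // : x%:C *: diag_mx (\row_j (d j)%:C) =
  diag_mx (\row_j (x * d j)%:C) :> 'M[C]_r.
by apply/matrixP => i j; rewrite !mxE rmorphM mulrnAr.
Qed.

Lemma dgcN d : - dgc S d = dgc S (fun i => - d i).
Proof.
rewrite !dgc_def -mulNmx -mulmxN.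
have -> // : - diag_mx (\row_j (d j)%:C) = diag_mx (\row_j (- d j)%:C) :> 'M[C]_r.
by apply/matrixP => i j; rewrite !mxE rmorphN mulNrn.
Qed.

Lemma dgcB d d' : dgc S d - dgc S d' = dgc S (fun i => d i - d' i).
Proof. by rewrite dgcN dgcD. Qed.

Lemma qf_dgc d x : qf (dgc S d) x = \sum_i d i * nsq ((x *m S^t*) 0 i).
Proof.
rewrite /qf; have -> : x *m dgc S d *m x^t* =
    (x *m S^t*) *m diag_mx (\row_j (d j)%:C) *m (x *m S^t*)^t*.
  by rewrite adjM trmxCK dgc_def !mulmxA.
rewrite mxE re_sum; apply: eq_bigr => i _; rewrite mul_mx_diag.
set y := x *m S^t*; rewrite !mxE mulrAC -nsqE mulrC reZ reC.
by [].
Qed.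

Hypothesis Su : S \is unitarymx.

Lemma dgcM d d' : dgc S d *m dgc S d' = dgc S (fun i => d i * d' i).
Proof.
have DD : diag_mx (\row_j (d j)%:C) *m diag_mx (\row_j (d' j)%:C) =
    diag_mx (\row_j (d j * d' j)%:C) :> 'M[C]_r.
  by rewrite mulmx_diag; congr diag_mx; apply/rowP => i; rewrite !mxE rmorphM.
rewrite !dgc_def -DD !mulmxA; set D := diag_mx _; set D' := diag_mx _.
by rewrite -(mulmxA _ S (S^t*)) (elimT unitarymxP Su) mulmx1.
Qed.

Lemma tr_dgc d : \tr (dgc S d) = (\sum_i d i)%:C.
Proof.
rewrite dgc_def mxtrace_mulC mulmxA (elimT unitarymxP Su) mul1mx mxtrace_diag.
by rewrite rmorph_sum; apply: eq_bigr => i _; rewrite mxE.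
Qed.

End rectangular.

Lemma dgc1 r n (S : 'M[C]_(r, n)) : dgc S (fun=> 1) = S^t* *m S.
Proof.
rewrite dgc_def (_ : diag_mx _ = 1%:M) ?mulmx1//.
by apply/matrixP => i j; rewrite !mxE.
Qed.

Section square.
Context n (S : 'M[C]_n) (Su : S \is unitarymx).
Implicit Types d : 'I_n -> R.

Lemma dgc_scalar x : dgc S (fun=> x) = x%:C%:M.
Proof.
rewrite (@eq_dgc _ _ S _ (fun=> x * 1)); last by move=> i; rewrite mulr1.
by rewrite -dgcZ dgc1 -(invmx_unitary Su) mulVmx ?unitarymx_unit// scalemx1.
Qed.

Lemma dgc_exp d k : dgc S d ^+ k = dgc S (fun i => d i ^+ k).
Proof.
elim: k => [|k IH]; first by rewrite expr0 dgc_scalar.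
rewrite exprS IH; apply: etrans (dgcM Su d _) _.
by apply: eq_dgc => i; rewrite exprS.
Qed.

Lemma fro2_coord (x : 'rV[C]_n) : fro2 x = \sum_i nsq ((x *m S^t*) 0 i).
Proof.
rewrite -(fro2_unitaryr x (V := S^t*)) ?trmxC_unitary//.
by rewrite /fro2 big_ord1.
Qed.

Lemma fro2_mul_dgc d (x : 'rV[C]_n) :
  fro2 (x *m dgc S d) = \sum_i d i ^+ 2 * nsq ((x *m S^t*) 0 i).
Proof.
rewrite fro2_coord; apply: eq_bigr => i _.
rewrite dgc_def !mulmxA -mulmxA (elimT unitarymxP Su) mulmx1 mul_mx_diag !mxE.
by rewrite nsqM nsqR mulrC.
Qed.

Lemma opbound_dgc d M : (forall i, `|d i| <= M) -> opbound M (dgc S d).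
Proof.
move=> dM x; rewrite fro2_mul_dgc fro2_coord mulr_sumr ler_sum// => i _.
rewrite ler_wpM2r ?nsq_ge0// -real_normK ?num_real//.
by rewrite lerXn2r ?nnegrE// (le_trans _ (dM i)).
Qed.

(** The images of [W] and the span of the eigenvectors with index outside [J] meet,
by counting dimensions, and there the form is at most [z] times the squared norm. *)
Lemma exists_qf_le m (W : 'M[C]_(m, n)) d z (J : {set 'I_n}) :
  (#|J| < m)%N -> (forall i, i \notin J -> d i <= z) ->
  exists2 y : 'rV[C]_m, y != 0 & qf (dgc S d) (y *m W) <= z * fro2 (y *m W).
Proof.
move=> Jm dz; pose M := W *m colsub (enum_val (A := J)) (S^t*).
have [y y0 yM] := exists_left_kernel M Jm.
exists y => //; rewrite qf_dgc fro2_coord mulr_sumr ler_sum// => i _.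
have [iJ|iJ] := boolP (i \in J); last by rewrite ler_wpM2r ?nsq_ge0// dz.
suff -> : (y *m W *m S^t*) 0 i = 0 by rewrite nsq0 !mulr0.
have /rowP/(_ (enum_rank_in iJ i)) := yM; rewrite mulmxA.
by rewrite mulmx_colsub [LHS]mxE enum_rankK_in// => ->; rewrite mxE.
Qed.

(** The span of the eigenvectors with index in [J] has dimension larger than the
number of linear conditions in [B], and on it the form is at least [z] times
the squared norm. *)
Lemma exists_qf_ge m (B : 'M[C]_(n, m)) d z (J : {set 'I_n}) :
  (m < #|J|)%N -> (forall i, i \in J -> z <= d i) ->
  exists w : 'rV[C]_n, [/\ w != 0, w *m B = 0 & z * fro2 w <= qf (dgc S d) w].
Proof.
move=> Jm dz; pose f := enum_val (A := J); pose M := rowsub f S *m B.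
have [y y0 yM] := exists_left_kernel M Jm.
pose w := y *m rowsub f S.
have wS i : (w *m S^t*) 0 i = \sum_k y 0 k * (f k == i)%:R.
  rewrite /w -mulmxA mul_rowsub_mx (elimT unitarymxP Su) mxE; apply: eq_bigr => k _.
  by rewrite !mxE.
have wSJ k : (w *m S^t*) 0 (f k) = y 0 k.
  rewrite wS (bigD1 k)//= eqxx mulr1 big1 ?addr0// => j jk.
  by rewrite (inj_eq enum_val_inj) (negbTE jk) mulr0.
exists w; split.
- apply: contraNneq y0 => w0; apply/eqP/rowP => k.
  by rewrite -wSJ w0 mul0mx !mxE.
- by rewrite /w -mulmxA.
rewrite qf_dgc fro2_coord mulr_sumr ler_sum// => i _.
have [iJ|iJ] := boolP (i \in J); first by rewrite ler_wpM2r ?nsq_ge0// dz.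
rewrite wS big1 ?nsq0 ?mulr0// => k _.
by case: eqP => [fk|_]; rewrite ?mulr0//; move: (enum_valP k); rewrite -/f fk (negbTE iJ).
Qed.

End square.
End diagonal_conjugates.

Section spectral_decomposition.
Context {R : rcfType} (n : nat) (A : 'M[R[i]]_n).
Hypothesis Ah : A \is hermsymmx.

Lemma size_eigvals : size (eigvals A) = n.
Proof. by rewrite size_sort size_map size_enum_ord. Qed.

Lemma eigval_mono j k : (j <= k < n)%N -> eigval A k <= eigval A j.
Proof.
move=> /andP[jk kn]; rewrite /eigval.
apply: (sorted_leq_nth (leT := >=%R)) => //.
- by move=> x y z xy yz; exact: le_trans yz xy.
- by move=> x; exact: lexx.
- by apply: sort_sorted => x y; exact: le_total.
- by rewrite inE size_eigvals (leq_ltn_trans jk).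
- by rewrite inE size_eigvals.
Qed.

Lemma eigvals_map : eigvals A = map (fun i : 'I_n => eigval A i) (enum 'I_n).
Proof.
apply: (@eq_from_nth _ 0) => [|k].
  rewrite size_eigvals size_map. by rewrite size_enum_ord.
rewrite size_eigvals => kn.
by rewrite (nth_map (Ordinal kn)) ?size_enum_ord// nth_enum_ord.
Qed.

(** The spectral theorem gives the eigenvalues in some order; permuting the rows
of the unitary matrix sorts them. *)
Lemma spectral_decomposition :
  exists2 S : 'M[R[i]]_n, S \is unitarymx & A = dgc S (fun i => eigval A i).
Proof.
have /orthomx_spectralP A_eq := hermitian_normalmx Ah.
pose P := spectralmx A; pose t := [tuple complex.Re (spectral_diag A 0 i) | i < n].
have Pu : P \is unitarymx by exact: spectral_unitarymx.
have /tuple_permP[p pE] : perm_eq (eigvals A) t by rewrite perm_sort.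
have eE (i : 'I_n) : eigval A i = complex.Re (spectral_diag A 0 (p i)).
  by rewrite /eigval pE -tnth_nth !tnth_mktuple.
have diagR i : ((complex.Re (spectral_diag A 0 i))%:C)%C = spectral_diag A 0 i.
  have /mxOverP /(_ 0 i) := hermitian_spectral_diag_real Ah.
  exact: RRe_real.
exists (row_perm p P).
  have rE i : row i (row_perm p P) = row (p i) P by apply/rowP => j; rewrite !mxE.
  apply/row_unitarymxP => i j; rewrite !rE.
  by move/row_unitarymxP: Pu => ->; rewrite (inj_eq perm_inj).
apply/matrixP => a b; rewrite dgcE {1}A_eq (invmx_unitary Pu) -/P mxE.
rewrite (reindex_inj (@perm_inj _ p)); apply: eq_bigr => i _.
by rewrite mul_mx_diag !mxE eE diagR.
Qed.

End spectral_decomposition.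

Section rank_r_decomposition.
Context {R : rcfType}.

(** The rows of [V] are the eigenvectors kept by the filter, so they come in the
order of [theta]. *)
Lemma nonzero_spectral_decomposition n r (A : 'M[R[i]]_n) (theta : r.-tuple R) :
  A \is hermsymmx -> [seq x <- eigvals A | x != 0] = theta ->
  exists2 V : 'M[R[i]]_(r, n), V \is unitarymx & A = dgc V (tnth theta).
Proof.
move=> Ah thE; have [S Su AS] := spectral_decomposition Ah.
pose I := seq.filter (fun i : 'I_n => eigval A i != 0) (enum 'I_n).
have IE : map (fun i : 'I_n => eigval A i) I = theta.
  by rewrite -thE [in RHS](eigvals_map A) filter_map.
have sI : size I == r by rewrite -(size_map (fun i : 'I_n => eigval A i)) IE size_tuple.
pose J := Tuple sI.
have Jth j : tnth theta j = eigval A (tnth J j).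
  rewrite (tnth_nth 0) -IE (nth_map (tnth J j)) ?(eqP sI)//.
  by rewrite -[I]/(tval J) -tnth_nth.
exists (rowsub (tnth J) S).
  have rE i : row i (rowsub (tnth J) S) = row (tnth J i) S.
    by apply/rowP => j; rewrite !mxE.
  apply/row_unitarymxP => i j; rewrite !rE.
  move/row_unitarymxP: Su => ->; rewrite inj_eq//.
  by apply/tuple_uniqP; rewrite filter_uniq// enum_uniq.
apply/matrixP => a b; rewrite {1}AS !dgcE.
rewrite (bigID (fun i : 'I_n => eigval A i != 0))/= [X in _ + X]big1 ?addr0; last first.
  by move=> i /negPn/eqP ->; rewrite mulr0 mul0r.
transitivity (\sum_(i <- I) Num.conj (S i a) * (eigval A i)%:C * S i b).
  by rewrite big_filter big_enum_cond; exact: eq_bigl.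
rewrite -[I]/(tval J) big_tuple.
by apply: eq_bigr => j _; rewrite Jth !mxE.
Qed.

End rank_r_decomposition.

(** * Range projectors and centred powers *)

Section range_projector.
Context {R : rcfType}.
Local Notation C := R[i].

(** A polynomial in [P] equal to the orthogonal projector onto the range of any
[P] with nonzero eigenvalues [theta]; being a polynomial, it is measurable. *)
Definition range_proj n (theta : seq R) (P : 'M[C]_n) : 'M[C]_n :=
  1%:M - foldr (fun t B => (1%:M - (t^-1)%:C *: P) *m B) 1%:M theta.

(** On the orthogonal complement of the rows of [V] every factor is the identity;
on the [j]-th row the factor for [theta_j] vanishes. *)
Lemma range_projE r n (V : 'M[C]_(r, n)) (theta : r.-tuple R) :
  V \is unitarymx -> (forall i, tnth theta i != 0) ->
  range_proj theta (dgc V (tnth theta)) = V^t* *m V.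
Proof.
move=> Vu th0; rewrite /range_proj; set P := dgc V _.
have P1 : P *m dgc V (fun=> 1) = P.
  by apply: etrans (dgcM Vu _ _) _; apply: eq_dgc => j; rewrite mulr1.
have off t : (1%:M - (t^-1)%:C *: P) *m (1%:M - dgc V (fun=> 1)) =
    1%:M - dgc V (fun=> 1).
  by rewrite mulmxBl mul1mx -scalemxAl (mulmxBr P) mulmx1 P1 subrr scaler0 subr0.
have on t f : (1%:M - (t^-1)%:C *: P) *m dgc V f =
    dgc V (fun j => (1 - t^-1 * tnth theta j) * f j).
  rewrite mulmxBl mul1mx -scalemxAl (dgcM Vu) dgcZ dgcB; apply: eq_dgc => j.
  by rewrite mulrBl mul1r mulrA.
have foldE (s : seq R) :
    foldr (fun t B => (1%:M - (t^-1)%:C *: P) *m B) 1%:M s =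
    1%:M - dgc V (fun=> 1) + dgc V (fun j => \prod_(t <- s) (1 - t^-1 * tnth theta j)).
  elim: s => [|t s IH] /=.
    rewrite (@eq_dgc _ _ _ V (fun j => \prod_(t <- [::]) _) (fun=> 1)) ?subrK//.
    by move=> j; rewrite big_nil.
  rewrite IH mulmxDr off on; congr (_ + _); apply: eq_dgc => j.
  by rewrite big_cons.
rewrite foldE (@eq_dgc _ _ _ V (fun j => \prod_(t <- theta) _) (fun=> 0)).
  rewrite (_ : dgc V (fun=> 0) = 0) ?addr0 ?subKr ?dgc1//.
  apply/matrixP => a b; rewrite dgcE mxE big1// => i _.
  by rewrite mulr0 mul0r.
move=> j; have : tnth theta j \in tval theta by exact: mem_tnth.
elim: (tval theta) => //= t s IH.
rewrite inE big_cons => /predU1P[<-|/IH->]; last by rewrite mulr0.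
by rewrite mulVf// subrr mul0r.
Qed.

End range_projector.

Section centered_powers.
Context {R : realType} (n : nat).
Hypothesis n_gt0 : (0 < n)%N.
Local Notation C := R[i].
Implicit Types X : 'M[C]_n.

Definition centered k X : 'M[C]_n :=
  X ^+ k - (n%:R^-1 * \tr (X ^+ k))%:M.

(** Trace inequalities saying that all eigenvalues are bounded by [L]; unlike
the eigenvalues, traces of powers are manifestly measurable. *)
Definition spec_bounded (L : R) X : Prop :=
  forall m, re (\tr (X ^+ (2 * m))) <= n%:R * L ^+ (2 * m).

Lemma bernoulli_ineq (x : R) m : 0 <= x -> 1 + m%:R * x <= (1 + x) ^+ m.
Proof.
move=> x0; elim: m => [|m IH]; first by rewrite mul0r addr0 expr0.
rewrite exprS; apply: le_trans (ler_wpM2l _ IH); last by rewrite addr_ge0.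
rewrite -natr1; have := mulr_ge0 (ler0n R m) (sqr_ge0 x); nra.
Qed.

(** The power [2 m] of an eigenvalue is at most [n * L ^+ (2 m)]; an eigenvalue
larger than [L] would violate this for large [m]. *)
Lemma spec_bounded_eigval L X : 0 < L -> X \is hermsymmx ->
  spec_bounded L X -> forall i : 'I_n, `|eigval X i| <= L.
Proof.
move=> L0 Xh bX i; have [S Su XE] := spectral_decomposition Xh.
rewrite leNgt; apply/negP => Llt.
have big m : (`|eigval X i| / L) ^+ (2 * m) <= n%:R.
  have := bX m; rewrite {1}XE dgc_exp// tr_dgc// reC (bigD1 i)//= => h.
  rewrite expr_div_n ler_pdivrMr ?exprn_gt0// -normrX ger0_norm; last first.
    by rewrite exprM exprn_ge0// sqr_ge0.
  apply: le_trans h; rewrite lerDl sumr_ge0// => j _.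
  by rewrite exprM exprn_ge0// sqr_ge0.
set q := `|_| / L in big; have q1 : 1 < q by rewrite ltr_pdivlMr ?mul1r.
pose x := q - 1; have x0 : 0 < x by rewrite subr_gt0.
have [m mx] : exists m, n%:R < m%:R * x.
  exists (Num.bound (n%:R / x)); rewrite -ltr_pdivrMr//.
  by apply: archi_boundP; rewrite divr_ge0// ltW.
have := le_trans (bernoulli_ineq (2 * m) (ltW x0)) _.
move=> /(_ n%:R); rewrite (_ : 1 + x = q); last by rewrite /x; ring.
move=> /(_ (big m)); rewrite natrM; have := ler0n R n; lra.
Qed.

Lemma eigval_spec_bounded L X : X \is hermsymmx ->
  (forall i : 'I_n, `|eigval X i| <= L) -> spec_bounded L X.
Proof.
move=> Xh bX m; have [S Su XE] := spectral_decomposition Xh.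
rewrite XE dgc_exp// tr_dgc// reC; apply: le_trans (_ : \sum_(i < n) L ^+ (2 * m) <= _).
  apply: ler_sum => i _; rewrite !exprM lerXn2r ?nnegrE ?sqr_ge0//.
  rewrite -[leLHS]real_normK ?num_real// lerXn2r ?nnegrE//.
  exact: le_trans (bX i).
by rewrite sumr_const card_ord mulr_natl.
Qed.

Lemma centered_herm k X : X \is hermsymmx -> centered k X \is hermsymmx.
Proof.
move=> Xh; have [S Su XE] := spectral_decomposition Xh.
rewrite /centered XE (dgc_exp Su) (tr_dgc Su) -(rmorph_nat (real_complex R)).
rewrite -fmorphV -rmorphM -(dgc_scalar Su) dgcB.
exact: dgc_herm.
Qed.

Lemma tr_centered k X : \tr (centered k X) = 0.
Proof.
rewrite raddfB /= mxtrace_scalar -[_ *+ n]mulr_natl mulVKf ?subrr//.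
by rewrite pnatr_eq0 -lt0n.
Qed.

Lemma centered_opbound L k X : 0 < L -> X \is hermsymmx -> spec_bounded L X ->
  opbound (2 * L ^+ k) (centered k X).
Proof.
move=> L0 Xh bX; have [S Su XE] := spectral_decomposition Xh.
rewrite /centered XE dgc_exp// tr_dgc// -(rmorph_nat (real_complex R)).
rewrite -fmorphV -rmorphM /= -(dgc_scalar Su) dgcB.
have bpow (i : 'I_n) : `|eigval X i ^+ k| <= L ^+ k.
  by rewrite normrX lerXn2r ?nnegrE// ?(ltW L0)//; exact: spec_bounded_eigval.
apply: opbound_dgc => // i; rewrite (le_trans (ler_normB _ _))// mulr_natl mulr2n.
rewrite lerD// normrM ger0_norm ?invr_ge0// ler_pdivrMl ?ltr0n//.
rewrite (le_trans (ler_norm_sum _ _ _))//.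
by rewrite (le_trans (ler_sum _ (fun j _ => bpow j)))// sumr_const card_ord mulr_natl.
Qed.

End centered_powers.

(** * Stationarity and drift *)

Section drift_expectation.
Context {d} {Omega : measurableType d} {R : realType} (Pr : probability Omega R).
Implicit Types f : Omega -> R.

(** Bounded measurable functions, for which integrability is automatic. *)
Definition bounded_rv f :=
  measurable_fun setT f /\ exists M, forall w, `|f w| <= M.

Lemma bounded_rv_integrable f : bounded_rv f -> Pr.-integrable setT (EFin \o f).
Proof.
move=> [mf [M fM]]; apply: measurable_bounded_integrable => //.
  by rewrite [X in (X < _)%E](_ : _ = 1%E) ?ltry//; exact: probability_setT.
exists M; split; first exact: num_real.
by move=> x Mx w _; rewrite /= (le_trans (fM w))// ltW.
Qed.

Lemma bounded_rvD f g : bounded_rv f -> bounded_rv g ->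
  bounded_rv (fun w => f w + g w).
Proof.
move=> [mf [M fM]] [mg [M' gM]]; split; first exact: measurable_funD.
exists (M + M') => w; rewrite (le_trans (ler_normD _ _))// lerD//.
Qed.

Lemma bounded_rv_cst c : bounded_rv (fun=> c).
Proof. by split; [exact: measurable_cst|exists `|c|]. Qed.

Lemma bounded_rv_sum I (s : seq I) (F : I -> Omega -> R) :
  (forall i, bounded_rv (F i)) -> bounded_rv (fun w => \sum_(i <- s) F i w).
Proof.
move=> bF; elim: s => [|i s IH].
  by under eq_fun do rewrite big_nil; exact: bounded_rv_cst.
by under eq_fun do rewrite big_cons; exact: bounded_rvD.
Qed.

Lemma Rintegral_sum_bounded I (s : seq I) (F : I -> Omega -> R) :
  (forall i, bounded_rv (F i)) ->
  \int[Pr]_w (\sum_(i <- s) F i w) = \sum_(i <- s) \int[Pr]_w F i w.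
Proof.
move=> bF; elim: s => [|i s IH].
  under eq_Rintegral do rewrite big_nil.
  by rewrite big_nil Rintegral_cst// mul0r.
under eq_Rintegral do rewrite big_cons.
rewrite RintegralD//; first by rewrite IH big_cons.
  exact: bounded_rv_integrable.
by apply: bounded_rv_integrable; exact: bounded_rv_sum.
Qed.

(** A stationary process cannot have a positive drift: if [h' i] has the same
mean as [h i] but [h i + h' i <= 0], then [h i] has nonpositive mean. *)
Lemma drift_expectation (I : finType) (h h' : I -> Omega -> R) (Y : Omega -> R)
    (N al be : R) :
  (forall i, bounded_rv (h i)) -> (forall i, bounded_rv (h' i)) ->
  (forall i, \int[Pr]_w h i w = \int[Pr]_w h' i w) ->
  (forall i w, h i w + h' i w <= 0) ->
  bounded_rv Y -> 0 < N -> 0 < al ->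
  (forall w, N * (al * Y w - be) <= \sum_i h i w) ->
  \int[Pr]_w Y w <= be / al.
Proof.
move=> bh bh' hh' h0 bY N0 al0 Yh.
have ih i : \int[Pr]_w h i w <= 0.
  have : \int[Pr]_w (h i w + h' i w) <= 0.
    have -> : 0 = \int[Pr]_w (fun=> 0 : R) w :> R by rewrite Rintegral_cst// mul0r.
    apply: le_Rintegral => //; apply: bounded_rv_integrable.
      exact: bounded_rvD.
    exact: bounded_rv_cst.
  rewrite RintegralD//; [|exact: bounded_rv_integrable..].
  rewrite -hh'; lra.
have ZY : bounded_rv (fun w => N * al * Y w).
  case: bY => mY [M YM]; split.
    by apply: measurable_funM => //; exact: measurable_cst.
  exists (`|N * al| * M) => w; rewrite normrM ler_wpM2l//.
have := @le_Rintegral _ _ _ Pr setT (fun w => N * al * Y w + - (N * be))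
  (fun w => \sum_i h i w) measurableT.
move=> /(_ (bounded_rv_integrable (bounded_rvD ZY (bounded_rv_cst _)))).
move=> /(_ (bounded_rv_integrable (bounded_rv_sum _ bh))).
have le1 w : setT w -> N * al * Y w + - (N * be) <= \sum_i h i w.
  by move=> _; apply: le_trans (Yh w); rewrite mulrBr mulrA.
move=> /(_ le1); rewrite RintegralD//; last 2 first.
- exact: bounded_rv_integrable.
- exact/bounded_rv_integrable/bounded_rv_cst.
rewrite Rintegral_cst// (_ : fine _ = 1) ?mulr1; last first.
  by rewrite -[RHS]/(fine 1%:E); congr fine; exact: probability_setT.
rewrite RintegralZl//; last first.
  exact: bounded_rv_integrable.
rewrite Rintegral_sum_bounded// => le2.
have : \sum_i \int[Pr]_w h i w <= 0 by apply: sumr_le0 => i _; exact: ih.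
move=> /(le_trans le2); rewrite subr_le0 -mulrA ler_pM2l// => le3.
by rewrite ler_pdivlMr// mulrC.
Qed.

End drift_expectation.

Section concentration_statistic.
Context {R : realType} (n r : nat) (theta : r.-tuple R) (k : nat) (L : R).
Local Notation C := R[i].
Local Notation signs := {ffun 'I_n -> bool}.
Implicit Types (X P Q A B : 'M[C]_n) (e : signs).

Definition cst4 Q A B : R := re (\tr (Q *m A *m Q *m B)).

(** Written with traces of polynomials in [X] and [P], hence measurable; it is the
squared norm of the compression of the centred power, by [compressE]. *)
Definition compress X P : R :=
  cst4 (range_proj theta P) (centered k X) (centered k X).

Local Notation rA e X := (refl e *m centered k X *m refl e).

(** The summand of [sum_drift] as a function of the pair of matrices, truncated to
the event that the spectrum of the first one is bounded. *)
Definition drift_term e (z : mxBorel R n * mxBorel R n) : R :=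
  let Q := range_proj theta z.2 in let A := centered k z.1 in
  let F := cst4 Q A A in let T := cst4 Q (rA e z.1) A in
  let F' := cst4 Q (rA e z.1) (rA e z.1) in
  \1_[set X : mxBorel R n | spec_bounded L X] z.1 *
  ((F - T) * F - 3 / 2 * (F * (F + F' - 2 * T))).

Section conjugation.
Variables (U : 'M[C]_n) (UU : U *m U = 1%:M).

Let conjU A B : U *m A *m U *m (U *m B *m U) = U *m (A *m B) *m U.
Proof. by rewrite !mulmxA -[_ *m U *m U]mulmxA UU mulmx1 -!mulmxA. Qed.

Lemma exp_conj A m : (U *m A *m U) ^+ m = U *m (A ^+ m) *m U.
Proof.
elim: m => [|m IH]; first by rewrite !expr0 mulmx1 UU.
by rewrite exprS IH [LHS]conjU exprS.
Qed.

Lemma tr_conj A : \tr (U *m A *m U) = \tr A.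
Proof. by rewrite -mulmxA mxtrace_mulC -mulmxA UU mulmx1. Qed.

Lemma cst4_conj Q A B :
  cst4 (U *m Q *m U) (U *m A *m U) (U *m B *m U) = cst4 Q A B.
Proof. by rewrite /cst4 !conjU tr_conj. Qed.

Lemma centered_conj A : centered k (U *m A *m U) = U *m centered k A *m U.
Proof.
rewrite /centered exp_conj tr_conj mulmxBr mulmxBl; congr (_ - _).
by rewrite mul_mx_scalar -scalemxAl UU scalemx1.
Qed.

Lemma range_proj_conj P : range_proj theta (U *m P *m U) = U *m range_proj theta P *m U.
Proof.
rewrite /range_proj mulmxBr mulmxBl mulmx1 UU; congr (_ - _).
elim: (tval theta) => [|t s /= ->]; first by rewrite /= mulmx1 UU.
rewrite -[_ - _](_ : U *m (1%:M - (t^-1)%:C *: P) *m U = _) ?conjU//.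
by rewrite mulmxBr mulmxBl mulmx1 UU -scalemxAr -scalemxAl.
Qed.

Lemma spec_bounded_conj A : spec_bounded L (U *m A *m U) <-> spec_bounded L A.
Proof.
by split=> bA m; have := bA m; rewrite exp_conj tr_conj.
Qed.

End conjugation.

Lemma cst4_cyc Q A B : cst4 Q A B = cst4 Q B A.
Proof. by rewrite /cst4 -[Q *m A *m Q *m B]mulmxA mxtrace_mulC mulmxA. Qed.

End concentration_statistic.

(** * The drift statistic *)

Section statistic_measurability.
Context {R : realType} (n r : nat) (theta : r.-tuple R) (k : nat) (L : R).
Local Notation signs := {ffun 'I_n -> bool}.

Let measurable_drift_expr d (T : measurableType d) (f0 f1 f2 f3 : T -> R) :
  measurable_fun setT f0 -> measurable_fun setT f1 ->
  measurable_fun setT f2 -> measurable_fun setT f3 ->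
  measurable_fun setT (fun z => f0 z * ((f1 z - f2 z) * f1 z
    - 3 / 2 * (f1 z * (f1 z + f3 z - 2 * f2 z)))).
Proof.
move=> m0 m1 m2 m3; apply: measurable_funM; first exact: m0.
apply: measurable_funB.
  by apply: measurable_funM; [apply: measurable_funB; [exact: m1|exact: m2]|exact: m1].
apply: measurable_funM; first exact: measurable_cst.
apply: measurable_funM; first exact: m1.
apply: measurable_funB; first by apply: measurable_funD; [exact: m1|exact: m3].
by apply: measurable_funM; [exact: measurable_cst|exact: m2].
Qed.

Section composed.
Context {d} {T : measurableType d} (f : T -> 'M[R[i]]_n) (mf : mxmeas f).

Lemma mxmeas_range_proj : mxmeas (fun x => range_proj theta (f x)).
Proof.
apply: mxmeasB; first exact: mxmeas_cst.
elim: (tval theta) => [|t s IH]; first exact: mxmeas_cst.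
apply: mxmeasM => //; apply: mxmeasB; first exact: mxmeas_cst.
by apply: mxmeasZ => //; exact: cmeas_cst.
Qed.

Lemma mxmeas_centered : mxmeas (fun x => centered k (f x)).
Proof.
apply: mxmeasB; first exact: mxmeas_exp.
move=> i j; under eq_fun do rewrite mxE -[_ *+ (_ == _)]mulr_natr.
apply: cmeasM; last exact: cmeas_cst.
by apply: cmeasM; [exact: cmeas_cst|apply: cmeas_tr; exact: mxmeas_exp].
Qed.

Lemma measurable_cst4 (g h : T -> 'M[R[i]]_n) : mxmeas g -> mxmeas h ->
  measurable_fun setT (fun x => cst4 (f x) (g x) (h x) : R).
Proof.
move=> mg mh; have [] // : cmeas (fun x => \tr (f x *m g x *m f x *m h x)).
by apply: cmeas_tr; do 3 apply: mxmeasM => //.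
Qed.

End composed.

Lemma measurable_spec_bounded :
  measurable [set X : mxBorel R n | spec_bounded L X].
Proof.
pose g m (X : mxBorel R n) : R := re (\tr ((X : 'M[R[i]]_n) ^+ (2 * m))).
have -> : [set X : mxBorel R n | spec_bounded L X] =
    \bigcap_m (g m @^-1` [set` `]-oo, n%:R * L ^+ (2 * m)]]).
  apply/seteqP; split=> X /= h m; first by move=> _; rewrite /= in_itv/=; exact: h.
  by have := h m Logic.I; rewrite /= in_itv.
apply: bigcapT_measurable => m; rewrite -[X in measurable X]setTI.
have mg : measurable_fun setT (g m).
  have [] // : cmeas (fun X : mxBorel R n => \tr ((X : 'M[R[i]]_n) ^+ (2 * m))).
  apply: cmeas_tr; apply: mxmeas_exp; apply/measurable_mxBorelP.
  exact: measurable_id.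
by apply: mg => //; exact: measurable_itv.
Qed.

Lemma measurable_drift_term (e : signs) :
  measurable_fun setT (drift_term theta k L e).
Proof.
have mX : mxmeas (fun z : mxBorel R n * mxBorel R n => z.1 : 'M[R[i]]_n).
  by apply/measurable_mxBorelP; exact: measurable_fst.
have mP : mxmeas (fun z : mxBorel R n * mxBorel R n => z.2 : 'M[R[i]]_n).
  by apply/measurable_mxBorelP; exact: measurable_snd.
have mA := mxmeas_centered mX; have mQ := mxmeas_range_proj mP.
have mrA : mxmeas (fun z : mxBorel R n * mxBorel R n =>
    refl e *m centered k (z.1 : 'M[R[i]]_n) *m refl e).
  by apply: mxmeasM; [apply: mxmeasM => //|]; exact: mxmeas_cst.
have mF := measurable_cst4 mQ mA mA; have mT := measurable_cst4 mQ mrA mA.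
have mF' := measurable_cst4 mQ mrA mrA.
have mS : measurable_fun setT (fun z : mxBorel R n * mxBorel R n =>
    \1_[set X : mxBorel R n | spec_bounded L X] z.1 : R).
  apply: measurableT_comp; last exact: measurable_fst.
  by apply: measurable_indic; exact: measurable_spec_bounded.
exact: measurable_drift_expr mS mF mT mF'.
Qed.

End statistic_measurability.

Section pointwise_drift.
Context {R : realType} (n r : nat) (theta : r.-tuple R) (k : nat) (L : R).
Hypotheses (n_gt0 : (0 < n)%N) (L_gt0 : 0 < L)
  (theta0 : forall i, tnth theta i != 0).
Local Notation C := R[i].
Local Notation signs := {ffun 'I_n -> bool}.
Variables (X : 'M[C]_n) (V : 'M[C]_(r, n)).
Hypotheses (Xh : X \is hermsymmx) (Vu : V \is unitarymx).
Local Notation P := (dgc V (tnth theta)).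
Local Notation A := (centered k X).
Local Notation rA e := (refl e *m A *m refl e).
Local Notation q := (V *m A *m V^t*).
Local Notation qe e := (V *m rA e *m V^t*).
Local Notation S := [set X : mxBorel R n | spec_bounded L X].

Lemma cst4_fdot B D : D \is hermsymmx ->
  cst4 (range_proj theta P) B D = fdot (V *m B *m V^t*) (V *m D *m V^t*).
Proof.
move=> /hermP Dh; rewrite range_projE// /cst4 /fdot !adjM trmxCK Dh.
rewrite -!mulmxA mxtrace_mulC !mulmxA.
by [].
Qed.

Lemma refl_conj_herm e : rA e \is hermsymmx.
Proof.
by apply/hermP; rewrite !adjM refl_adj (hermP _ (centered_herm k Xh)) mulmxA.
Qed.

Lemma compressE : compress theta k X P = fro2 q.
Proof. by rewrite /compress cst4_fdot ?centered_herm// fro2_fdot. Qed.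

Lemma drift_termE e : drift_term theta k L e (X, P) = \1_S X *
  ((fro2 q - fdot (qe e) q) * fro2 q - 3 / 2 * (fro2 q * fro2 (q - qe e))).
Proof.
rewrite /drift_term/= !cst4_fdot ?centered_herm ?refl_conj_herm//.
move: q (qe e) => a b.
by rewrite (fro2_subE a b) (fro2_fdot a) (fro2_fdot b) (fdotC a b).
Qed.

(** Reflecting the second matrix instead of the first exchanges the roles of the
compression and of its reflected version. *)
Lemma drift_term_swapE e :
  drift_term theta k L e (X, refl e *m P *m refl e) = \1_S X *
  ((fro2 (qe e) - fdot (qe e) q) * fro2 (qe e)
   - 3 / 2 * (fro2 (qe e) * fro2 (q - qe e))).
Proof.
have UU : refl e *m refl e = 1%:M :> 'M[C]_n by exact: reflK.
have UUA (B : 'M[C]_n) : refl e *m (refl e *m B *m refl e) *m refl e = B.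
  by rewrite !mulmxA UU mul1mx -mulmxA UU mulmx1.
have swap B D : cst4 (refl e *m range_proj theta P *m refl e) B D =
    cst4 (range_proj theta P) (refl e *m B *m refl e) (refl e *m D *m refl e).
  by rewrite -[LHS](cst4_conj UU) UUA.
rewrite /drift_term/= range_proj_conj// !swap UUA (cst4_cyc _ A).
rewrite !cst4_fdot ?centered_herm ?refl_conj_herm//; move: q (qe e) => a b.
rewrite (fro2_subE a b) (fro2_fdot a) (fro2_fdot b) (fdotC a b).
by rewrite (addrC (fdot a a)).
Qed.

Lemma drift_term_swap e :
  drift_term theta k L e (X, P)
  + drift_term theta k L e (X, refl e *m P *m refl e) <= 0.
Proof.
rewrite drift_termE drift_term_swapE -mulrDr indicE.
by case: (_ \in _); rewrite ?mul0r// mul1r drift_swap.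
Qed.

Lemma sum_drift_term : (2 ^ n)%:R * (2 / n%:R * (\1_S X * compress theta k X P ^+ 2)
    - drift_const r (2 * L ^+ k) ^+ 2 / (8 * n%:R ^+ 3)) <=
  \sum_e drift_term theta k L e (X, P).
Proof.
under eq_bigr do rewrite drift_termE.
rewrite -mulr_sumr indicE; have [XS|_] := boolP (X \in S); last first.
  rewrite !mul0r mulr0 sub0r mulrN oppr_le0 mulr_ge0// divr_ge0 ?sqr_ge0//.
rewrite !mul1r compressE; apply: sum_drift => //.
- exact: centered_herm.
- exact: tr_centered.
- by apply: centered_opbound => //; rewrite inE in XS.
Qed.

Let c : R := (2 * L ^+ k) ^+ 2 * r%:R.

Let c0 : 0 <= c. Proof. by rewrite mulr_ge0// sqr_ge0. Qed.

Let opbound_rA e : X \in S -> opbound (2 * L ^+ k) (rA e).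
Proof.
rewrite inE => XS x; rewrite mulmxA (fro2_unitaryr _ (refl_unitary n_gt0 e)).
rewrite mulmxA (le_trans (centered_opbound n_gt0 k L_gt0 Xh XS _))//.
by rewrite fro2_unitaryr// refl_unitary.
Qed.

Let numeric_bound (a b D T : R) : 0 <= a <= c -> 0 <= b <= c -> 0 <= D ->
  D = a + b - 2 * T -> D <= 4 * c -> `|(a - T) * a - 3 / 2 * (a * D)| <= 9 * c ^+ 2.
Proof.
move=> /andP[a0 ac] /andP[b0 bc] D0 DE Dc.
have aD : 0 <= a * D <= 4 * c ^+ 2.
  by rewrite mulr_ge0//=; have := ler_pM a0 D0 ac Dc; nra.
have aa : 0 <= a * a <= c ^+ 2.
  by rewrite mulr_ge0//= expr2 ler_pM.
have ab : 0 <= a * b <= c ^+ 2.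
  by rewrite mulr_ge0//= expr2 ler_pM.
have -> : (a - T) * a = (a * a - a * b + a * D) / 2 by rewrite DE; field.
rewrite ler_norml; apply/andP; split; lra.
Qed.

Lemma fro2_q_le : X \in S -> 0 <= fro2 q <= c.
Proof.
move=> XS; rewrite fro2_ge0/=; apply: fro2_compress_le => //.
by apply: centered_opbound => //; rewrite inE in XS.
Qed.

Let fro2_qe_le e : X \in S -> 0 <= fro2 (qe e) <= c.
Proof.
by move=> XS; rewrite fro2_ge0/=; apply: fro2_compress_le => //; exact: opbound_rA.
Qed.

Let matrix_bound (a b : 'M[C]_r) : 0 <= fro2 a <= c -> 0 <= fro2 b <= c ->
  `|(fro2 a - fdot b a) * fro2 a - 3 / 2 * (fro2 a * fro2 (a - b))| <= 9 * c ^+ 2 /\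
  `|(fro2 b - fdot b a) * fro2 b - 3 / 2 * (fro2 b * fro2 (a - b))| <= 9 * c ^+ 2.
Proof.
move=> ab bb; have D0 := fro2_ge0 (a - b).
have DE : fro2 (a - b) = fro2 a + fro2 b - 2 * fdot b a by rewrite fro2_subE fdotC.
have D4 : fro2 (a - b) <= 4 * c.
  have := fro2B a b; move: ab bb => /andP[_ +] /andP[_]; lra.
split; first exact: numeric_bound ab bb D0 DE D4.
by apply: numeric_bound bb ab D0 _ D4; rewrite DE; ring.
Qed.

Let indic_bound (b : bool) (y M : R) : (b -> `|y| <= M) -> 0 <= M ->
  `|b%:R * y| <= M.
Proof. by case: b => [h _|_ M0]; rewrite ?mul1r ?h// mul0r normr0. Qed.

Lemma drift_term_bounded e :
  `|drift_term theta k L e (X, P)| <= 9 * c ^+ 2 /\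
  `|drift_term theta k L e (X, refl e *m P *m refl e)| <= 9 * c ^+ 2.
Proof.
have M0 : 0 <= 9 * c ^+ 2 by rewrite mulr_ge0// sqr_ge0.
rewrite drift_termE drift_term_swapE indicE.
have qb := fro2_q_le; have qeb := fro2_qe_le e; move: q (qe e) qb qeb => a b ab bb.
by split; apply: indic_bound => // XS; have [] := matrix_bound (ab XS) (bb XS).
Qed.

Lemma compress_bounded : `|\1_S X * compress theta k X P ^+ 2| <= c ^+ 2.
Proof.
rewrite indicE; have [XS|_] := boolP (X \in S); last first.
  by rewrite mul0r normr0 sqr_ge0.
have /andP[q0 qc] := fro2_q_le XS.
by rewrite mul1r compressE ger0_norm ?sqr_ge0// lerXn2r// nnegrE// ltW.
Qed.

End pointwise_drift.

(** * Invariance of the law under reflections *)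

Section conjugation_invariance.
Context {R : realType} (n : nat) {d} {Omega : measurableType d}
  (Pr : probability Omega R) (beta : symmetry_class)
  (X P : {RV Pr >-> mxBorel R n}).
Hypotheses (XP : independent X P)
  (inv : conj_invariant beta X \/ conj_invariant beta P).
Variable U : 'M[R[i]]_n.
Hypotheses (Uiso : isometry_group beta U) (Uadj : U^t* = U).

Let cj (A : mxBorel R n) : mxBorel R n := U *m A *m U.

Lemma measurable_conj : measurable_fun setT cj.
Proof.
apply/measurable_mxBorelP; apply: mxmeasM; last exact: mxmeas_cst.
apply: mxmeasM; first exact: mxmeas_cst.
by apply/measurable_mxBorelP; exact: measurable_id.
Qed.

Let mcj (A : set (mxBorel R n)) : measurable A -> measurable (cj @^-1` A).
Proof. by move=> mA; rewrite -[X in measurable X]setTI; exact: measurable_conj. Qed.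

Let mX : measurable_fun setT X. Proof. exact: measurable_funPT. Qed.
Let mP : measurable_fun setT P. Proof. exact: measurable_funPT. Qed.

(** Conjugating the invariant matrix, whichever of the two it is, amounts to
conjugating [P] as long as only conjugation-invariant functions of the pair are
considered. *)
Lemma expectation_conj (h : mxBorel R n * mxBorel R n -> R) :
  measurable_fun setT h ->
  (forall A B, h (cj A, B) = h (A, cj B)) ->
  Pr.-integrable setT (fun w => (h (X w, P w))%:E) ->
  Pr.-integrable setT (fun w => (h (X w, cj (P w)))%:E) ->
  \int[Pr]_w h (X w, P w) = \int[Pr]_w h (X w, cj (P w)).
Proof.
move=> mh hcj i1 i2; case: inv => [Xinv|Pinv].
  under [RHS]eq_Rintegral do rewrite -hcj.
  apply: eq_expectation_pair => //.
  - by apply: measurableT_comp => //; exact: measurable_conj.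
  - move=> A B mA mB; rewrite XP//.
    rewrite -[X in _ = Pr (X `&` _)]/(X @^-1` (cj @^-1` A)) XP//; last exact: mcj.
    congr (_ * _)%E; rewrite -(Xinv U Uiso A mA) Uadj.
    by [].
  - by under eq_fun do rewrite hcj.
apply: eq_expectation_pair => //.
- by apply: measurableT_comp => //; exact: measurable_conj.
move=> A B mA mB; rewrite XP//.
rewrite -[X in _ = Pr (_ `&` X)]/(P @^-1` (cj @^-1` B)) XP//; last exact: mcj.
congr (_ * _)%E; rewrite -(Pinv U Uiso B mB) Uadj.
by [].
Qed.

End conjugation_invariance.

Section concentration.
Context {R : realType} (n r : nat) {d} {Omega : measurableType d}
  (Pr : probability Omega R) (beta : symmetry_class)
  (X P : {RV Pr >-> mxBorel R n}) (theta : r.-tuple R) (k : nat) (L : R).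
Hypotheses (n_gt0 : (0 < n)%N) (L_gt0 : 0 < L)
  (theta0 : forall i, tnth theta i != 0)
  (XP : independent X P)
  (inv : conj_invariant beta X \/ conj_invariant beta P)
  (Xh : forall w, (X w : 'M[R[i]]_n) \is hermsymmx)
  (PV : forall w, exists2 V : 'M[R[i]]_(r, n), V \is unitarymx &
    (P w : 'M[R[i]]_n) = dgc V (tnth theta)).
Local Notation C := R[i].

Definition truncated_compress (w : Omega) : R :=
  \1_[set A : mxBorel R n | spec_bounded L A] (X w) * compress theta k (X w) (P w) ^+ 2.

Lemma drift_term_conj e (A B : 'M[C]_n) :
  drift_term theta k L e (refl e *m A *m refl e, B) =
  drift_term theta k L e (A, refl e *m B *m refl e).
Proof.
have UU : refl e *m refl e = 1%:M :> 'M[C]_n by exact: reflK.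
have UUA (D : 'M[C]_n) : refl e *m (refl e *m D *m refl e) *m refl e = D.
  by rewrite !mulmxA UU mul1mx -mulmxA UU mulmx1.
have swap (Q D E : 'M[C]_n) : cst4 (refl e *m Q *m refl e) D E =
    cst4 Q (refl e *m D *m refl e) (refl e *m E *m refl e).
  by rewrite -[LHS](cst4_conj UU) UUA.
have E1 := range_proj_conj theta UU B; have E2 := centered_conj k UU A.
pose g (i a t b : R) := i * ((a - t) * a - 3 / 2 * (a * (a + b - 2 * t))).
pose D (Q A' : 'M[C]_n) i := let rA' := refl e *m A' *m refl e in
  g i (cst4 Q A' A') (cst4 Q rA' A') (cst4 Q rA' rA').
have DE (Q A' : 'M[C]_n) i : D Q (refl e *m A' *m refl e) i =
    D (refl e *m Q *m refl e) A' i.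
  by rewrite /D/= !swap.
have IE : \1_[set X : mxBorel R n | spec_bounded L X] (refl e *m A *m refl e) =
    \1_[set X : mxBorel R n | spec_bounded L X] A :> R.
  have [bA|bA] := pselect (spec_bounded L A).
    have bA' : spec_bounded L (refl e *m A *m refl e) by apply/spec_bounded_conj.
    by rewrite !indicE (mem_set bA) (mem_set bA').
  have bA' : ~ spec_bounded L (refl e *m A *m refl e).
    by move=> /(spec_bounded_conj L UU).
  by rewrite !indicE (memNset bA) (memNset bA').
transitivity (D (range_proj theta B) (centered k (refl e *m A *m refl e))
  (\1_[set X : mxBorel R n | spec_bounded L X] (refl e *m A *m refl e))).
  by [].
rewrite E2 DE -E1 IE.
by [].
Qed.

Lemma truncated_compress_rv : bounded_rv truncated_compress.
Proof.
split.
  have mX : mxmeas (fun w => X w : 'M[C]_n).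
    by apply/measurable_mxBorelP; exact: measurable_funPT.
  have mP : mxmeas (fun w => P w : 'M[C]_n).
    by apply/measurable_mxBorelP; exact: measurable_funPT.
  apply: measurable_funM.
    apply: measurableT_comp; last exact: measurable_funPT.
    by apply: measurable_indic; exact: measurable_spec_bounded.
  apply: measurable_funX; apply: measurable_cst4.
  - exact: mxmeas_range_proj.
  - exact: mxmeas_centered.
  - exact: mxmeas_centered.
exists (((2 * L ^+ k) ^+ 2 * r%:R) ^+ 2) => w.
have [V Vu PE] := PV w; rewrite /truncated_compress PE.
exact: compress_bounded.
Qed.

(** The law of the pair is stationary under reflections while [sum_drift_term]
gives a drift proportional to minus the second moment; so that moment is of the
order of the error terms. *)
Lemma expectation_truncated_compress :
  \int[Pr]_w truncated_compress w <=
  drift_const r (2 * L ^+ k) ^+ 2 / 16 / n%:R ^+ 2.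
Proof.
have mX : measurable_fun setT X by exact: measurable_funPT.
have mP : measurable_fun setT P by exact: measurable_funPT.
pose h e w := drift_term theta k L e (X w, P w).
pose h' e w := drift_term theta k L e
  (X w, (refl e *m (P w : 'M[C]_n) *m refl e : mxBorel R n)).
have bh e : bounded_rv (h e).
  split.
    apply: measurableT_comp; first exact: measurable_drift_term.
    exact: measurable_fun_pair.
  exists (9 * ((2 * L ^+ k) ^+ 2 * r%:R) ^+ 2) => w.
  have [V Vu PE] := PV w; rewrite /h PE.
  exact: proj1 (drift_term_bounded k n_gt0 L_gt0 theta0 (Xh w) Vu e).
have bh' e : bounded_rv (h' e).
  split.
    apply: measurableT_comp; first exact: measurable_drift_term.
    apply: measurable_fun_pair; first exact: mX.
    exact: (measurableT_comp (measurable_conj (refl e)) mP).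
  exists (9 * ((2 * L ^+ k) ^+ 2 * r%:R) ^+ 2) => w.
  have [V Vu PE] := PV w; rewrite /h' PE.
  exact: proj2 (drift_term_bounded k n_gt0 L_gt0 theta0 (Xh w) Vu e).
have hh' e : \int[Pr]_w h e w = \int[Pr]_w h' e w.
  apply: (expectation_conj XP inv (refl_isometry n_gt0 beta e) (refl_adj e)).
  - exact: measurable_drift_term.
  - by move=> A B; exact: drift_term_conj.
  - exact: bounded_rv_integrable (bh e).
  - exact: bounded_rv_integrable (bh' e).
have h0 e w : h e w + h' e w <= 0.
  by have [V Vu PE] := PV w; rewrite /h /h' PE; exact: drift_term_swap.
have := @drift_expectation _ _ _ Pr _ h h' truncated_compress (2 ^ n)%:R
  (2 / n%:R) (drift_const r (2 * L ^+ k) ^+ 2 / (8 * n%:R ^+ 3)) bh bh' hh' h0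
  truncated_compress_rv.
have n0 : 0 < n%:R :> R by rewrite ltr0n.
have N0 : 0 < (2 ^ n)%:R :> R by rewrite ltr0n expn_gt0.
have al0 : 0 < 2 / n%:R :> R by rewrite divr_gt0.
move=> /(_ N0 al0) H; apply: le_trans (H _) _ => [w|].
  have [V Vu PE] := PV w; rewrite /h /truncated_compress PE.
  exact: sum_drift_term.
by rewrite le_eqVlt; apply/orP; left; apply/eqP; field; rewrite gt_eqF.
Qed.

End concentration.

(** * Almost sure concentration *)

Section summable_expectations.
Context {d} {Omega : measurableType d} {R : realType} (Pr : probability Omega R).

(** Telescoping: [1 / (m + 1) ^+ 2] is at most [1 / m - 1 / (m + 1)]. *)
Lemma sum_inv_sqr_le (u : nat -> R) (C : R) m :
  (forall i, u i <= C / i%:R ^+ 2) -> 0 <= C ->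
  \sum_(0 <= i < m) u i <= 2 * C.
Proof.
move=> uC C0; case: m => [|[|m]].
- by rewrite big_geq// mulr_ge0.
(* The bound vanishes at [i = 0], where the inverse of [0] is [0]. *)
- rewrite big_nat1 (le_trans (uC _))// expr0n invr0 mulr0.
  by rewrite mulr_ge0.
have : \sum_(0 <= i < m.+2) u i <= C * (2 - m.+1%:R^-1).
  elim: m => [|m IH].
    rewrite big_nat_recr// big_nat1/= invr1.
    have := uC 0%N; have := uC 1%N; rewrite expr0n/= invr0 expr1n invr1; lra.
  rewrite big_nat_recr//= (le_trans (lerD IH (uC _)))//.
  rewrite -mulrDr ler_wpM2l//.
  have m1 : 0 < m.+1%:R :> R by rewrite ltr0n.
  rewrite -[m.+2%:R]natr1; set y := m.+1%:R in m1 *.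
  have m2 : 0 < y + 1 by rewrite addr_gt0.
  rewrite -subr_ge0.
  have -> : 2 - (y + 1)^-1 - (2 - y^-1 + ((y + 1) ^+ 2)^-1) =
      (y * (y + 1) ^+ 2)^-1.
    by field; rewrite !gt_eqF.
  by rewrite invr_ge0 mulr_ge0 ?exprn_ge0 ?ltW.
move=> /le_trans; apply; rewrite mulrC ler_wpM2r// gerBl invr_ge0.
exact: ler0n.
Qed.

(** By monotone convergence the sum of the [Y n] has finite mean, so it is almost
surely finite and its terms tend to zero. *)
Lemma ae_cvg0_expectation (Y : nat -> Omega -> R) (C : R) :
  (forall n, bounded_rv (Y n)) -> (forall n w, 0 <= Y n w) ->
  (forall n, \int[Pr]_w Y n w <= C / n%:R ^+ 2) -> 0 <= C ->
  {ae Pr, forall w, Y n w @[n --> \oo] --> (0 : R)}.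
Proof.
move=> bY Y0 EY C0.
pose f n w := (Y n w)%:E.
have mf n : measurable_fun setT (f n).
  by apply/measurable_EFinP; have [] := bY n.
have f0 n w : setT w -> (0%R <= f n w)%E by rewrite lee_fin.
have sumE := integral_nneseries Pr measurableT mf f0.
have fin n : (\int[Pr]_w f n w = (\int[Pr]_w Y n w)%:E)%E.
  rewrite /Rintegral fineK//.
  exact: integrable_fin_num (bounded_rv_integrable _ (bY n)).
have sum_fin : (\int[Pr]_w (\sum_(0 <= n <oo) f n w) <= (2 * C)%:E)%E.
  rewrite sumE; apply: lime_le.
    by apply: is_cvg_nneseries => n _ _; apply: integral_ge0 => w; exact: f0.
  apply: nearW => m; under eq_bigr do rewrite fin.
  by rewrite sumEFin lee_fin; exact: sum_inv_sqr_le.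
have int : Pr.-integrable setT (fun w => \sum_(0 <= n <oo) f n w)%E.
  apply/integrableP; split.
    by apply: ge0_emeasurable_sum => // n w _ _; exact: f0.
  under eq_integral => w _.
    rewrite gee0_abs; last by apply: nneseries_ge0 => n _ _; exact: f0.
    over.
  by rewrite (le_lt_trans sum_fin)// ltry.
have /integrable_ae := int; move=> /(_ measurableT); apply: filterS => w /(_ Logic.I) fw.
have tail0 := @nneseries_tail_cvg R (f ^~ w) xpredT.
have cvgE : (f n w @[n --> \oo] --> 0%E)%E.
  apply: (squeeze_cvge _ (cvg_cst 0%E) (tail0 _ _)).
  - apply: nearW => n; apply/andP; split; first exact: f0.
    have := @nneseries_lim_ge R (f ^~ w) xpredT n n.+1.
    by rewrite big_nat1; apply => i _ _; exact: f0.
  - by move: fw; rewrite ge0_fin_numE//; apply: nneseries_ge0 => n _ _; exact: f0.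
  - by move=> n _; exact: f0.
by move/fine_cvgP : cvgE => [].
Qed.

End summable_expectations.

Section almost_sure_concentration.
Context {d} {Omega : measurableType d} {R : realType} (Pr : probability Omega R)
  (beta : symmetry_class) (X P : forall n, {RV Pr >-> mxBorel R n})
  (r : nat) (theta : r.-tuple R).
Hypotheses (r_gt0 : (0 < r)%N) (theta0 : forall i, tnth theta i != 0)
  (XP : forall n, (r <= n)%N -> independent (X n) (P n))
  (inv : forall n, (r <= n)%N ->
     conj_invariant beta (X n) \/ conj_invariant beta (P n))
  (Xh : forall n w, (X n w : 'M[R[i]]_n) \is hermsymmx)
  (PV : forall n w, (r <= n)%N -> exists2 V : 'M[R[i]]_(r, n), V \is unitarymx &
    (P n w : 'M[R[i]]_n) = dgc V (tnth theta)).

(** The squared compressions have summable expectations. There are countably many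
[k] and [L], so one event serves for all of them; and it serves for all choices
of [V], because the truncated statistic depends on [X] and [P] only. *)
Lemma ae_compress_cvg0 : {ae Pr, forall w, forall (k L : nat),
  (\forall n \near \oo, spec_bounded L.+1%:R (X n w : 'M[R[i]]_n)) ->
  forall V : forall n, 'M[R[i]]_(r, n),
  (forall n, (r <= n)%N -> V n \is unitarymx /\
    (P n w : 'M[R[i]]_n) = dgc (V n) (tnth theta)) ->
  fro2 (V n *m centered k (X n w : 'M[R[i]]_n) *m (V n)^t*) @[n --> \oo] --> (0 : R)}.
Proof.
suff main k L : {ae Pr, forall w,
    (\forall n \near \oo, spec_bounded L.+1%:R (X n w : 'M[R[i]]_n)) ->
    forall V : forall n, 'M[R[i]]_(r, n),
    (forall n, (r <= n)%N -> V n \is unitarymx /\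
      (P n w : 'M[R[i]]_n) = dgc (V n) (tnth theta)) ->
    fro2 (V n *m centered k (X n w : 'M[R[i]]_n) *m (V n)^t*) @[n --> \oo] --> (0 : R)}.
  have h k : {ae Pr, forall w, forall L : nat, _} := ae_foralln (main k).
  exact: ae_foralln h.
have L0 : 0 < L.+1%:R :> R by rewrite ltr0n.
(* For [n < r] there is no rank [r] perturbation to speak of. *)
pose Y n w : R := if (r <= n)%N then
  truncated_compress (X n) (P n) theta k L.+1%:R w else 0.
pose C : R := drift_const r (2 * L.+1%:R ^+ k) ^+ 2 / 16.
have bY n : bounded_rv (Y n).
  rewrite /Y; case: leqP => [rn|_]; last exact: bounded_rv_cst.
  have n0 : (0 < n)%N by exact: leq_trans rn.
  apply: truncated_compress_rv => //.
  by move=> w; exact: PV.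
have Y0 n w : 0 <= Y n w.
  rewrite /Y; case: leqP => // rn; rewrite /truncated_compress.
  by rewrite mulr_ge0 ?sqr_ge0// indicE ler0n.
have EY n : \int[Pr]_w Y n w <= C / n%:R ^+ 2.
  rewrite /Y; case: leqP => [rn|_]; last first.
    rewrite Rintegral_cst// mul0r divr_ge0 ?exprn_ge0//.
    by rewrite divr_ge0 ?sqr_ge0.
  have n0 : (0 < n)%N by exact: leq_trans rn.
  apply: (expectation_truncated_compress k n0 L0 theta0 (XP rn) (inv rn)) => //.
  by move=> w; exact: PV.
have C0 : 0 <= C by rewrite divr_ge0 ?sqr_ge0.
apply: filterS (ae_cvg0_expectation bY Y0 EY C0) => w Yw bX V VP.
set F := fun n => fro2 _.
have F2 : F n ^+ 2 @[n --> \oo] --> (0 : R).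
  apply: cvg_trans Yw; apply: near_eq_cvg; near=> n.
  have rn : (r <= n)%N by near: n; exact: nbhs_infty_ge.
  have bXn : spec_bounded L.+1%:R (X n w : 'M[R[i]]_n) by near: n.
  have [Vu PE] := VP n rn.
  rewrite /Y rn /truncated_compress indicE mem_set// mul1r PE.
  by rewrite compressE.
have : Num.sqrt (F n ^+ 2) @[n --> \oo] --> Num.sqrt (0 : R).
  exact: continuous_cvg (@sqrt_continuous R 0) F2.
rewrite sqrtr0; apply: cvg_trans; apply: near_eq_cvg; apply: nearW => n.
by rewrite /= sqrtr_sqr ger0_norm// fro2_ge0.
Unshelve. all: by end_near.
Qed.

End almost_sure_concentration.

(** * Support of a measure and clipping *)

Section support.
Context {R : realType} (mu : probability (measurableTypeR R) R).

(** A Lindelof argument: a negligible open interval around a point outside the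
support can be shrunk to one with rational endpoints. *)
Lemma negligible_support_compl : mu.-negligible (~` msupport mu).
Proof.
pose I (pq : rat * rat) : set R := [set` `]ratr pq.1, ratr pq.2[ ].
pose F n : set (measurableTypeR R) := if unpickle n is Some pq then
  (if mu (I pq) == 0%E then I pq else set0) else set0.
have nF : mu.-negligible (\bigcup_n F n).
  apply: negligible_bigcup => n; rewrite /F.
  case: unpickle => [pq|]; last exact: negligible_set0.
  case: eqP => [m0|_]; last exact: negligible_set0.
  by exists (I pq); split => //; exact: measurable_itv.
apply: negligibleS nF => x /existsNP[U /not_implyP[oU /not_implyP[Ux /negP]]].
rewrite -leNgt => mU0.
have /nbhs_ballP[e /= e0 eU] : nbhs x U by exact: open_nbhs_nbhs.
have [p] : exists q, ratr q \in `](x - e), x[ by apply: rat_in_itvoo; rewrite gtrBl.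
have [q] : exists q, ratr q \in `]x, (x + e)[ by apply: rat_in_itvoo; rewrite ltrDl.
rewrite !in_itv/= => /andP[xq qe] /andP[ep px].
have IU : I (p, q) `<=` U.
  move=> y; rewrite /I/= in_itv/= => /andP[py yq]; apply: eU => /=.
  by rewrite /ball/= ltr_distlC; apply/andP; split; lra.
exists (pickle (p, q)); [exact: Logic.I|rewrite /F pickleK].
have -> : mu (I (p, q)) == 0%E.
  rewrite eq_le measure_ge0 andbT; apply: le_trans mU0.
  apply: le_measure => //; rewrite inE; first exact: measurable_itv.
  exact: open_measurable.
by rewrite /I/= in_itv/= px xq.
Qed.

Lemma support_nonempty : msupport mu !=set0.
Proof.
apply/set0P/eqP => s0; have := negligible_support_compl; rewrite s0 setC0.
move=> /negligibleP => /(_ measurableT) m0.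
have := etrans (esym (probability_setT mu)) m0 => /eqP.
by rewrite onee_eq0.
Qed.

Hypothesis cmu : compact (msupport mu).
Local Notation a := (inf (msupport mu)).
Local Notation b := (sup (msupport mu)).

Let bnd : has_ubound (msupport mu) /\ has_lbound (msupport mu).
Proof.
have [M [_ Mb]] := compact_bounded cmu.
have h x : msupport mu x -> `|x| <= M + 1 by apply: Mb; rewrite ltrDl.
split; first by exists (M + 1) => x /h; exact: le_trans (ler_norm _).
by exists (- (M + 1)) => x /h; rewrite ler_norml => /andP[].
Qed.

Lemma support_itv x : msupport mu x -> a <= x <= b.
Proof.
move=> sx; have [ub lb] := bnd.
by rewrite (ge_inf lb sx) (ub_le_sup ub sx).
Qed.

Lemma inf_le_sup_support : a <= b.
Proof.
by have [x /support_itv/andP[]] := support_nonempty; exact: le_trans.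
Qed.

Lemma ae_support_itv : {ae mu, forall t : measurableTypeR R, a <= t <= b}.
Proof.
have [N [mN N0 sN]] := negligible_support_compl.
exists N; split => //; apply: subset_trans sN => x /= nab.
by move=> /support_itv.
Qed.

End support.

Section clipping.
Context {R : realType}.
Implicit Types lo hi t : R.

(** Reading a function of [t] through [clip] makes it bounded and continuous on the
whole line when it is continuous on the interval. *)
Definition clip lo hi t : R := Num.max lo (Num.min hi t).

Lemma clip_itv lo hi t : lo <= hi -> lo <= clip lo hi t <= hi.
Proof. by move=> lh; rewrite /clip le_max lexx/= ge_max lh ge_min lexx. Qed.

Lemma clip_id lo hi t : lo <= t <= hi -> clip lo hi t = t.
Proof. by move=> /andP[lt th]; rewrite /clip min_r// max_r. Qed.

Lemma clip_continuous lo hi : continuous (clip lo hi).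
Proof.
apply: max_fun_continuous; first by move=> x; exact: cvg_cst.
by apply: min_fun_continuous; [move=> x; exact: cvg_cst|move=> x; exact: cvg_id].
Qed.

End clipping.

Section inverse_measurable.
Context {R : realType}.

(** Inversion, discontinuous at the origin, is a pointwise limit of continuous
functions. *)
Lemma measurable_invr : measurable_fun setT (fun x : R => x^-1).
Proof.
(* The limit at the origin is [0], which is the inverse of [0] by convention. *)
pose h n (x : R) := x / (x ^+ 2 + n.+1%:R^-1).
apply: (measurable_fun_cvg (h := h)) => [n|x _].
  apply: continuous_measurable_fun => x; apply: cvgM; first exact: cvg_id.
  apply: cvgV; first by rewrite gt_eqF// ltr_wpDl ?sqr_ge0// invr_gt0.
  by apply: cvgD; [exact: exprn_continuous|exact: cvg_cst].
have [->|x0] := eqVneq x 0.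
  rewrite invr0; apply: cvg_near_cst; apply: nearW => n.
  by rewrite /h mul0r.
rewrite (_ : x^-1 = x / (x ^+ 2 + 0)); last by rewrite addr0; field.
apply: cvgM; first exact: cvg_cst.
apply: cvgV; first by rewrite addr0 sqrf_eq0.
by apply: cvgD; [exact: cvg_cst|exact: cvg_harmonic].
Qed.

End inverse_measurable.

(** * The Cauchy transform outside the support *)

Section resolvent_functions.
Context {R : realType}.
Implicit Types (lo hi z t e : R).

Definition gap lo hi e z := (z <= lo - e) \/ (hi + e <= z).

Lemma gap_norm lo hi e z t : gap lo hi e z -> lo <= t <= hi -> e <= `|z - t|.
Proof.
move=> gz /andP[lt th]; rewrite ler_normr; apply/orP.
by case: gz => gz; [right|left]; lra.
Qed.

Lemma gap_neq0 lo hi e z t : 0 < e -> gap lo hi e z -> lo <= t <= hi -> z - t != 0.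
Proof.
by move=> e0 gz /(gap_norm gz) ez; rewrite -normr_gt0 (lt_le_trans e0).
Qed.

Lemma resolvent_continuous lo hi e z k : lo <= hi -> 0 < e -> gap lo hi e z ->
  continuous (fun t => (z - clip lo hi t)^-1 ^+ k).
Proof.
move=> lh e0 gz t.
apply: (@continuous_comp _ _ _ (fun t => (z - clip lo hi t)^-1) (fun x => x ^+ k)).
  apply: cvgV; first by apply: gap_neq0 e0 gz _; exact: clip_itv.
  by apply: cvgB; [exact: cvg_cst|exact: clip_continuous].
exact: exprn_continuous.
Qed.

Lemma resolvent_bound lo hi e z k t : lo <= hi -> 0 < e -> gap lo hi e z ->
  `|(z - clip lo hi t)^-1 ^+ k| <= e^-1 ^+ k.
Proof.
move=> lh e0 gz; rewrite normrX lerXn2r ?nnegrE ?invr_ge0 ?(ltW e0)//.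
rewrite normfV lef_pV2 ?posrE//.
  exact: gap_norm gz (clip_itv _ lh).
by rewrite normr_gt0; apply: gap_neq0 e0 gz _; exact: clip_itv.
Qed.

End resolvent_functions.

Section cauchy_transform.
Context {R : realType} (mu : probability (measurableTypeR R) R).
Hypothesis cmu : compact (msupport mu).
Local Notation a := (inf (msupport mu)).
Local Notation b := (sup (msupport mu)).
Local Notation G := (Cauchy_transform mu).
Local Notation out := (gap a b).

Let ab : a <= b. Proof. exact: inf_le_sup_support. Qed.

(** The moments of the resolvent: [G] for [k = 1], and [- G'] for [k = 2]. Clipping
to the convex hull of the support changes the integrand on a negligible set only. *)
Definition resolvent_moment z k : R := \int[mu]_t (z - clip a b t)^-1 ^+ k.

Lemma resolvent_rv e z k : 0 < e -> out e z ->
  bounded_rv (fun t : measurableTypeR R => (z - clip a b t)^-1 ^+ k).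
Proof.
move=> e0 oz; split.
  by apply: continuous_measurable_fun; exact: resolvent_continuous e0 oz.
by exists (e^-1 ^+ k) => t; exact: resolvent_bound.
Qed.

Lemma integral_clip (f : R -> R) lo hi : lo <= a -> b <= hi ->
  measurable_fun setT f -> measurable_fun setT (f \o clip lo hi) ->
  (\int[mu]_t (f (clip lo hi t))%:E = \int[mu]_t (f t)%:E)%E.
Proof.
move=> la bh mf mfc; apply: ae_eq_integral => //.
- exact/measurable_EFinP.
- exact/measurable_EFinP.
apply: filterS (ae_support_itv cmu) => t /andP[at_ tb] _.
by rewrite clip_id// (le_trans la)// (le_trans tb).
Qed.

Lemma CauchyE e z : 0 < e -> out e z -> G z = resolvent_moment z 1.
Proof.
move=> e0 oz; rewrite /Cauchy_transform /resolvent_moment; congr fine.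
rewrite -(integral_clip (f := fun t => (z - t)^-1) (lexx a) (lexx b)).
- by apply: eq_integral => t _; rewrite expr1.
- apply: (measurableT_comp (f := fun x : R => x^-1)); first exact: measurable_invr.
  by apply: measurable_funB; [exact: measurable_cst|exact: measurable_id].
by have [] := resolvent_rv 1 e0 oz.
Qed.

Let int e z k (e0 : 0 < e) (oz : out e z) :=
  bounded_rv_integrable mu (resolvent_rv k e0 oz).

Let rv_mul (f g : measurableTypeR R -> R) : bounded_rv f -> bounded_rv g ->
  bounded_rv (fun t => f t * g t).
Proof.
move=> [mf [M fM]] [mg [N gN]]; split; first exact: measurable_funM.
by exists (M * N) => t; rewrite normrM ler_pM.
Qed.

(** The resolvent identity, integrated. *)
Lemma CauchyB e z w : 0 < e -> out e z -> out e w ->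
  G z - G w = (w - z) * \int[mu]_t ((z - clip a b t)^-1 ^+ 1 * (w - clip a b t)^-1 ^+ 1).
Proof.
move=> e0 oz ow; rewrite (CauchyE e0 oz) (CauchyE e0 ow) /resolvent_moment.
rewrite -RintegralB//; [|exact: int oz|exact: int ow].
rewrite -RintegralZl//; last first.
  apply: bounded_rv_integrable; apply: rv_mul.
    exact: resolvent_rv oz.
  exact: resolvent_rv ow.
apply: eq_Rintegral => t _; rewrite !expr1.
have z0 : z - clip a b t != 0 by apply: gap_neq0 e0 oz _; exact: clip_itv.
have w0 : w - clip a b t != 0 by apply: gap_neq0 e0 ow _; exact: clip_itv.
by field; rewrite z0 w0.
Qed.

Let Rint_bound (f : measurableTypeR R -> R) M : bounded_rv f ->
  (forall t, f t <= M) -> \int[mu]_t f t <= M.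
Proof.
move=> bf fM; apply: (@le_trans _ _ (\int[mu]_t (fun=> M) t)).
  apply: le_Rintegral => //; apply: bounded_rv_integrable => //.
  exact: bounded_rv_cst.
rewrite Rintegral_cst// (_ : fine _ = 1) ?mulr1//.
by rewrite -[RHS]/(fine 1%:E); congr fine; exact: probability_setT.
Qed.

Let Rint_lbound (f : measurableTypeR R -> R) M : bounded_rv f ->
  (forall t, M <= f t) -> M <= \int[mu]_t f t.
Proof.
move=> bf fM; apply: (@le_trans _ _ (\int[mu]_t (fun=> M) t)).
  rewrite Rintegral_cst// (_ : fine _ = 1) ?mulr1//.
  by rewrite -[RHS]/(fine 1%:E); congr fine; exact: probability_setT.
apply: le_Rintegral => //; apply: bounded_rv_integrable => //.
exact: bounded_rv_cst.
Qed.

Lemma Rint_norm_bound (f : measurableTypeR R -> R) M : bounded_rv f ->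
  (forall t, `|f t| <= M) -> `|\int[mu]_t f t| <= M.
Proof.
move=> bf fM; rewrite ler_norml Rint_bound ?Rint_lbound// => t;
  by have := fM t; rewrite ler_norml => /andP[].
Qed.

Lemma Cauchy_gt0 z : b < z -> 0 < G z.
Proof.
move=> bz; have e0 : 0 < z - b by rewrite subr_gt0.
have oz : out (z - b) z by right; rewrite addrC subrK.
rewrite (CauchyE e0 oz); apply: (@lt_le_trans _ _ ((z - a)^-1)).
  by rewrite invr_gt0 subr_gt0 (le_lt_trans ab).
apply: Rint_lbound; first exact: resolvent_rv oz.
move=> t; have /andP[h1 h2] := clip_itv t ab; rewrite expr1 lef_pV2 ?posrE; lra.
Qed.

Lemma Cauchy_lt0 z : z < a -> G z < 0.
Proof.
move=> za; have e0 : 0 < a - z by rewrite subr_gt0.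
have oz : out (a - z) z by left; rewrite subKr.
rewrite (CauchyE e0 oz); apply: (@le_lt_trans _ _ ((z - b)^-1)); last first.
  by rewrite invr_lt0 subr_lt0 (lt_le_trans za).
apply: Rint_bound; first exact: resolvent_rv oz.
move=> t; have /andP[h1 h2] := clip_itv t ab; rewrite expr1 lef_nV2 ?negrE; lra.
Qed.

Lemma Cauchy_le_inv e z : 0 < e -> out e z -> `|G z| <= e^-1.
Proof.
move=> e0 oz; rewrite (CauchyE e0 oz); apply: Rint_norm_bound.
  exact: resolvent_rv oz.
by move=> t; rewrite -[leRHS]expr1; exact: resolvent_bound.
Qed.

(** In [CauchyB] the two factors of the integrand have the same sign and are bounded
away from zero. *)
Lemma CauchyB_gt0 e z w : 0 < e -> (w <= a - e \/ b + e <= z) -> z < w -> G w < G z.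
Proof.
move=> e0 side zw.
have oz : out e z by case: side => h; [left; lra|right].
have ow : out e w by case: side => h; [left|right; lra].
rewrite -subr_gt0 (CauchyB e0 oz ow) mulr_gt0 ?subr_gt0//.
pose m : R := `|z| + `|w| + `|a| + `|b| + 1.
have m0 : 0 < m by rewrite /m ltr_wpDl// !addr_ge0.
apply: (@lt_le_trans _ _ (m^-1 * m^-1)); first by rewrite mulr_gt0 ?invr_gt0.
apply: Rint_lbound; first by apply: rv_mul; [exact: resolvent_rv oz|exact: resolvent_rv ow].
move=> t; have /andP[h1 h2] := clip_itv t ab; rewrite !expr1 -!invfM.
set c := clip a b t in h1 h2 *.
have cm (x : R) : `|x| <= `|z| + `|w| -> `|x - c| <= m.
  move=> xm; rewrite (le_trans (ler_normB _ _))// /m.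
  have : `|c| <= `|a| + `|b|.
    rewrite ler_norml; apply/andP; split.
      by have := ler_norm (- a); rewrite normrN; have := normr_ge0 b; lra.
    by have := ler_norm b; have := normr_ge0 a; lra.
  lra.
have zm : `|z - c| <= m by apply: cm; rewrite lerDl.
have wm : `|w - c| <= m by apply: cm; rewrite lerDr.
have zwp : 0 < (z - c) * (w - c) by case: side => h; nra.
rewrite lef_pV2 ?posrE//; last exact: mulr_gt0.
rewrite -[leLHS]gtr0_norm// normrM.
exact: ler_pM.
Qed.

(** [CauchyB] writes the difference quotient as an integral whose integrand is
uniformly within a multiple of [h] of the squared resolvent. *)
Lemma Cauchy_is_derive e z : 0 < e -> out e z ->
  is_derive z 1 G (- resolvent_moment z 2).
Proof.
move=> e0 oz; have e2 : 0 < e / 2 by rewrite divr_gt0.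
have oz2 : out (e / 2) z by case: oz => h; [left|right]; lra.
have near_out : \forall h \near 0^', h != 0 /\ out (e / 2) (z + h) /\ `|h| < e / 2.
  near=> h.
  have h0 : h != 0 by near: h; exact: nbhs_dnbhs_neq.
  have hs : `|h| < e / 2 by near: h; exact: dnbhs0_lt.
  split => //; split => //; move: hs; rewrite ltr_norml => /andP[h1 h2].
  by case: oz => h'; [left|right]; lra.
have quot : \forall h \near 0^', h^-1 *: (G (h *: 1 + z) - G z) =
    - \int[mu]_t ((z - clip a b t)^-1 ^+ 1 * (z + h - clip a b t)^-1 ^+ 1).
  apply: filterS near_out => h [h0 [oh _]].
  rewrite [h *: _]mulr1 (addrC h) -opprB (CauchyB e2 oz2 oh) scalerN.
  by rewrite addrAC subrr add0r /GRing.scale/= mulKf.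
have diff : \forall h \near 0^', `|\int[mu]_t ((z - clip a b t)^-1 ^+ 1
    * (z + h - clip a b t)^-1 ^+ 1) - resolvent_moment z 2|
    <= `|h| * ((e / 2)^-1 ^+ 3).
  apply: filterS near_out => h [h0 [oh _]].
  have b2 : bounded_rv (fun t : measurableTypeR R => (z - clip a b t)^-1 ^+ 1
      * (z + h - clip a b t)^-1 ^+ 1).
    by apply: rv_mul; [exact: resolvent_rv oz2|exact: resolvent_rv oh].
  have b3 := resolvent_rv 2 e2 oz2.
  have bN : bounded_rv (fun t : measurableTypeR R => - (z - clip a b t)^-1 ^+ 2).
    case: b3 => m3 [M M3]; split; first exact: measurable_funN.
    by exists M => t; rewrite normrN.
  rewrite /resolvent_moment -RintegralB//; try exact: bounded_rv_integrable.
  apply: Rint_norm_bound; first exact: bounded_rvD b2 bN.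
  move=> t; set c := clip a b t.
  have c1 : z - c != 0 by apply: gap_neq0 e2 oz2 _; exact: clip_itv.
  have c2 : z + h - c != 0 by apply: gap_neq0 e2 oh _; exact: clip_itv.
  have -> : (z - c)^-1 ^+ 1 * (z + h - c)^-1 ^+ 1 - (z - c)^-1 ^+ 2 =
      - h * ((z - c)^-1 ^+ 2 * (z + h - c)^-1 ^+ 1).
    by rewrite !expr1; field; rewrite c1 c2.
  rewrite normrM normrN ler_wpM2l// normrM (exprD (e / 2)^-1 2 1).
  apply: ler_pM => //; first exact: resolvent_bound oz2.
  exact: resolvent_bound oh.
have cvgq : h^-1 *: (G (h *: 1 + z) - G z) @[h --> 0^'] --> - resolvent_moment z 2.
  have : \int[mu]_t ((z - clip a b t)^-1 ^+ 1 * (z + h - clip a b t)^-1 ^+ 1)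
      @[h --> 0^'] --> resolvent_moment z 2.
    apply/cvgrPdist_le => eps eps0; near=> h.
    rewrite distrC; apply: (@le_trans _ _ (`|h| * ((e / 2)^-1 ^+ 3))).
      by near: h; exact: diff.
    rewrite -ler_pdivlMr ?exprn_gt0 ?invr_gt0//.
    near: h; apply: dnbhs0_le.
    by rewrite divr_gt0// exprn_gt0// invr_gt0.
  move=> /cvgN; apply: cvg_trans; apply: near_eq_cvg.
  by apply: filterS quot => h ->.
split; first by apply/cvg_ex; exists (- resolvent_moment z 2).
exact: cvg_lim cvgq.
Unshelve. all: by end_near.
Qed.

End cauchy_transform.

(** * Inverse of the Cauchy transform *)

Section cauchy_inverse.
Context {R : realType} (mu : probability (measurableTypeR R) R).
Hypothesis cmu : compact (msupport mu).
Local Notation a := (inf (msupport mu)).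
Local Notation b := (sup (msupport mu)).
Local Notation G := (Cauchy_transform mu).

Lemma gap_right z : b < z -> 0 < z - b /\ gap a b (z - b) z.
Proof. by move=> bz; rewrite subr_gt0; split => //; right; rewrite addrC subrK. Qed.

Lemma gap_left z : z < a -> 0 < a - z /\ gap a b (a - z) z.
Proof. by move=> za; rewrite subr_gt0; split => //; left; rewrite subKr. Qed.

Lemma Cauchy_derive1 z : z < a \/ b < z ->
  derive1 G z = - resolvent_moment mu z 2.
Proof.
by move=> [/gap_left|/gap_right] [e0 oz]; rewrite derive1E;
  have := Cauchy_is_derive cmu e0 oz => H; exact: derive_val.
Qed.

Lemma Cauchy_derivable z : z < a \/ b < z -> derivable G z 1.
Proof.
by move=> [/gap_left|/gap_right] [e0 oz]; have [] := Cauchy_is_derive cmu e0 oz.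
Qed.

Lemma Cauchy_decr_right z w : b < z -> z < w -> G w < G z.
Proof.
move=> bz zw; have [e0 _] := gap_right bz.
by apply: (CauchyB_gt0 cmu e0) => //; right; rewrite addrC subrK.
Qed.

Lemma Cauchy_decr_left z w : w < a -> z < w -> G w < G z.
Proof.
move=> wa zw; have [e0 _] := gap_left wa.
by apply: (CauchyB_gt0 cmu e0) => //; left; rewrite subKr.
Qed.

Lemma Cauchy_IVT z w y : z <= w -> w < a \/ b < z -> G w <= y <= G z ->
  exists2 c, z <= c <= w & G c = y.
Proof.
move=> zw side /andP[wy yz].
have [c] : exists2 c, c \in `[z, w] & G c = y.
  apply: IVT => //.
    apply: derivable_within_continuous => x; rewrite in_itv/= => /andP[zx xw].
    apply: Cauchy_derivable; case: side => h; [left|right].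
      exact: le_lt_trans xw h.
    exact: lt_le_trans h zx.
  by rewrite ge_min wy orbT le_max yz.
by rewrite in_itv/=; exists c.
Qed.

(** If [G] stayed below [y] so would its limit at [b]; and [G z] is at most the
inverse of [z - b], hence below [y] for large [z]. *)
Lemma Cauchy_surj_right y : 0 < y -> (y%:E < Cauchy_right mu)%E ->
  exists2 z, b < z & G z = y.
Proof.
move=> y0 yG; have [z1 bz1 yz1] : exists2 z, b < z & y < G z.
  apply/not_exists2P => H; move: yG; apply/negP; rewrite -leNgt.
  have Gni : {in Interval (BRight b) +oo%O &, nonincreasing_fun (fun z => (G z)%:E)}.
    move=> z w; rewrite !in_itv/= !andbT => bz bw; rewrite le_eqVlt lee_fin.
    by move=> /predU1P[->//|zw]; rewrite ltW// Cauchy_decr_right.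
  have := @nonincreasing_at_right_cvge _ (fun z => (G z)%:E) b +oo%O isT Gni.
  move=> /cvg_lim => H2; rewrite /Cauchy_right H2//.
  apply: ge_ereal_sup => x [z /=]; rewrite in_itv/= andbT => bz <-{x}.
  by rewrite lee_fin leNgt; apply/negP => yz; case: (H z).
pose z2 := Num.max z1 (b + 2 / y).
have bz2 : b < z2 by rewrite lt_max bz1.
have [e0 oz] := gap_right bz2.
have Gz2 : G z2 <= y.
  rewrite (le_trans (ler_norm _))// (le_trans (Cauchy_le_inv cmu e0 oz))//.
  rewrite invf_ple ?posrE//; apply: (@le_trans _ _ (2 / y)).
    by rewrite ler_peMl ?invr_ge0 ?(ltW y0)// ler1n.
  by rewrite lerBrDl le_max lexx orbT.
have [||c /andP[zc _] Gc] := @Cauchy_IVT z1 z2 y _ (or_intror bz1).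
- by rewrite le_max lexx.
- by rewrite Gz2 ltW.
by exists c => //; exact: lt_le_trans bz1 zc.
Qed.

(** The mirror image of [Cauchy_surj_right]. *)
Lemma Cauchy_surj_left y : y < 0 -> (Cauchy_left mu < y%:E)%E ->
  exists2 z, z < a & G z = y.
Proof.
move=> y0 yG; have [z1 za1 yz1] : exists2 z, z < a & G z < y.
  apply/not_exists2P => H; move: yG; apply/negP; rewrite -leNgt.
  have Gnd : {in Interval (BRight (- a)) +oo%O &,
      nondecreasing_fun (fun z => (G (- z))%:E)}.
    move=> z w; rewrite !in_itv/= !andbT => az aw; rewrite le_eqVlt lee_fin.
    move=> /predU1P[->//|zw]; apply: ltW; apply: Cauchy_decr_left.
      by rewrite ltrNl.
    by rewrite ltrN2.
  have := @nondecreasing_at_right_cvge _ (fun z => (G (- z))%:E) (- a) +oo%O isT Gnd.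
  move=> H1; have /cvg_lim H2 := (cvg_at_leftNP (fun z => (G z)%:E) a _).2 H1.
  rewrite /Cauchy_left H2//.
  apply: le_ereal_inf_tmp => x [z /=]; rewrite in_itv/= andbT => az <-{x}.
  rewrite lee_fin leNgt; apply/negP => yz; case: (H (- z)) => //.
  by rewrite ltrNl.
have Ny0 : 0 < - y by rewrite oppr_gt0.
pose z2 := Num.min z1 (a - 2 / - y).
have za2 : z2 < a by rewrite gt_min za1.
have [e0 oz] := gap_left za2.
have Gz2 : y <= G z2.
  have := Cauchy_le_inv cmu e0 oz; rewrite ler_norml => /andP[+ _].
  apply: le_trans; rewrite lerNr invf_ple ?posrE//.
  apply: (@le_trans _ _ (2 / - y)).
    by rewrite ler_peMl ?invr_ge0 ?(ltW Ny0)// ler1n.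
  by rewrite lerBrDr addrC -lerBrDr ge_min lexx orbT.
have [||c /andP[_ cz] Gc] := @Cauchy_IVT z2 z1 y _ (or_introl za1).
- by rewrite ge_min lexx.
- by rewrite Gz2 ltW.
by exists c => //; exact: le_lt_trans cz za1.
Qed.

(** The sign of [G] tells the two sides of the support apart, so the preimage chosen
by [Cauchy_inv] lies on the right. *)
Lemma Cauchy_inv_right y : 0 < y -> (y%:E < Cauchy_right mu)%E ->
  b < Cauchy_inv mu y /\ G (Cauchy_inv mu y) = y.
Proof.
move=> y0 /(Cauchy_surj_right y0)[z bz Gz].
have : exists x, (x < a \/ b < x) /\ G x = y by exists z; split => //; right.
move=> /(getPex (P := [set x | (x < a \/ b < x) /\ G x = y])) [[lt|] //= Gy].
by have := Cauchy_lt0 cmu lt; rewrite Gy ltNge ltW.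
Qed.

Lemma Cauchy_inv_left y : y < 0 -> (Cauchy_left mu < y%:E)%E ->
  Cauchy_inv mu y < a /\ G (Cauchy_inv mu y) = y.
Proof.
move=> y0 /(Cauchy_surj_left y0)[z za Gz].
have : exists x, (x < a \/ b < x) /\ G x = y by exists z; split => //; left.
move=> /(getPex (P := [set x | (x < a \/ b < x) /\ G x = y])) [[|gt] //= Gy].
by have := Cauchy_gt0 cmu gt; rewrite Gy ltNge ltW.
Qed.

End cauchy_inverse.

(** * Functional calculus and spectral means *)

Section functional_calculus.
Context {R : realType}.
Local Notation C := R[i].

(** A chosen orthonormal eigenbasis, indexed like the sorted eigenvalues. *)
Definition eigbasis n (X : 'M[C]_n) : 'M[C]_n :=
  xget 0 [set S | S \is unitarymx /\ X = dgc S (fun i => eigval X i)].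

Lemma eigbasisP n (X : 'M[C]_n) : X \is hermsymmx ->
  eigbasis X \is unitarymx /\ X = dgc (eigbasis X) (fun i => eigval X i).
Proof.
move=> Xh; have [S Su XE] := spectral_decomposition Xh.
by rewrite /eigbasis; case: xgetP => [S' -> //|/(_ S)/not_andP[]].
Qed.

Definition fcalc n (f : R -> R) (X : 'M[C]_n) : 'M[C]_n :=
  dgc (eigbasis X) (fun i => f (eigval X i)).

Definition spectral_mean n (f : R -> R) (X : 'M[C]_n) : R :=
  n%:R^-1 * \sum_(i < n) f (eigval X i).

Section one_matrix.
Context n (X : 'M[C]_n) (Xh : X \is hermsymmx).

Lemma fcalc_exp k : fcalc (fun t => t ^+ k) X = X ^+ k.
Proof.
have [Su XE] := eigbasisP Xh.
by rewrite [in RHS]XE dgc_exp.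
Qed.

Lemma fcalcM f g : fcalc f X *m fcalc g X = fcalc (fun t => f t * g t) X.
Proof. by have [Su _] := eigbasisP Xh; rewrite [LHS]dgcM. Qed.

Lemma fcalc_resolvent z : (forall i : 'I_n, eigval X i != z) ->
  (z%:C%:M - X) *m fcalc (fun t => (z - t)^-1) X = 1%:M.
Proof.
move=> zX; have [Su XE] := eigbasisP Xh.
rewrite {1}XE -(dgc_scalar Su z) dgcB [LHS]dgcM// -(dgc_scalar Su 1).
by apply: eq_dgc => i; rewrite divff// subr_eq0 eq_sym.
Qed.

Lemma fcalc_centered k : n != 0 ->
  centered k X = fcalc (fun t => t ^+ k) X - (spectral_mean (fun t => t ^+ k) X)%:C%:M.
Proof.
move=> n0; have [Su XE] := eigbasisP Xh.
rewrite /centered fcalc_exp; congr (_ - _%:M).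
rewrite -fcalc_exp tr_dgc// -(rmorph_nat (real_complex R)) -fmorphV.
by rewrite -rmorphM.
Qed.

Lemma opbound_fcalc f M : (forall i : 'I_n, `|f (eigval X i)| <= M) ->
  opbound M (fcalc f X).
Proof. by have [Su _] := eigbasisP Xh; exact: opbound_dgc. Qed.

End one_matrix.

(** Centred by the mean of [f]: it tends to zero when the compression of [f X] is
asymptotically scalar. *)
Definition cmp r n (V : 'M[C]_(r, n)) f (X : 'M[C]_n) : 'M[C]_r :=
  V *m (fcalc f X - (spectral_mean f X)%:C%:M) *m V^t*.

Lemma cmpD r n (V : 'M[C]_(r, n)) f g X :
  cmp V (fun t => f t + g t) X = cmp V f X + cmp V g X.
Proof.
rewrite /cmp -mulmxDl -mulmxDr; congr (_ *m _ *m _).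
have -> : spectral_mean (fun t => f t + g t) X = spectral_mean f X + spectral_mean g X.
  by rewrite /spectral_mean big_split mulrDr.
by rewrite rmorphD raddfD opprD addrACA /fcalc dgcD.
Qed.

Lemma cmpZ r n (V : 'M[C]_(r, n)) c f X :
  cmp V (fun t => c * f t) X = c%:C *: cmp V f X.
Proof.
rewrite /cmp scalemxAl scalemxAr; congr (_ *m _ *m _).
have -> : spectral_mean (fun t => c * f t) X = c * spectral_mean f X.
  by rewrite /spectral_mean -mulr_sumr mulrCA.
by rewrite scalerBr /fcalc dgcZ scale_scalar_mx rmorphM.
Qed.

Lemma fro2_cmp_le r n (V : 'M[C]_(r, n)) f X M : X \is hermsymmx -> V \is unitarymx ->
  (forall i : 'I_n, `|f (eigval X i)| <= M) ->
  fro2 (cmp V f X) <= (2 * M) ^+ 2 * r%:R.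
Proof.
move=> Xh Vu fM; have [Su _] := eigbasisP Xh.
apply: fro2_compress_le => //; rewrite -(dgc_scalar Su) dgcB.
apply: opbound_dgc => // i; rewrite (le_trans (ler_normB _ _))// mulr_natl mulr2n.
have n0 : (0 < n)%N by case: i => i; exact: leq_trans.
rewrite lerD// normrM ger0_norm ?invr_ge0// ler_pdivrMl ?ltr0n//.
rewrite (le_trans (ler_norm_sum _ _ _))//.
by rewrite (le_trans (ler_sum _ (fun j _ => fM j)))// sumr_const card_ord mulr_natl.
Qed.

End functional_calculus.

Section esd_integral.
Context {R : realType} n (X : 'M[R[i]]_n).

Lemma integral_esd (f : R -> R) : (0 < n)%N -> measurable_fun setT f ->
  (forall t, 0 <= f t) -> (\int[esd X]_t (f t)%:E = (spectral_mean f X)%:E)%E.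
Proof.
move=> n0 mf f0; have mEf : measurable_fun setT (EFin \o f) by exact/measurable_EFinP.
rewrite /esd ge0_integral_mscale//; last by move=> t _; rewrite lee_fin.
rewrite ge0_integral_measure_sum//; last by move=> t _; rewrite lee_fin.
rewrite /spectral_mean EFinM -sumEFin; congr (_ * _)%E; apply: eq_bigr => i _.
by rewrite integral_dirac// diracT mul1e.
Qed.

End esd_integral.

Section spectral_limits.
Context {R : realType} (mu : probability (measurableTypeR R) R).
Hypothesis cmu : compact (msupport mu).
Local Notation C := R[i].
Local Notation a := (inf (msupport mu)).
Local Notation b := (sup (msupport mu)).
Variables (X : forall n, 'M[C]_n) (r : nat) (V : forall n, 'M[C]_(r, n)).
Hypotheses (Xh : forall n, X n \is hermsymmx)
  (Vu : forall n, (r <= n)%N -> V n \is unitarymx)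
  (Xmu : weak_cvg (fun n => esd (X n)) mu)
  (Xa : eigval (X n) n.-1 @[n --> \oo] --> a)
  (Xb : eigval (X n) 0 @[n --> \oo] --> b)
  (VX : forall k, fro2 (V n *m centered k (X n) *m (V n)^t*) @[n --> \oo] --> (0 : R)).

Let ab : a <= b. Proof. exact: inf_le_sup_support. Qed.

Lemma near_eigval e : 0 < e -> \forall n \near \oo,
  forall i : 'I_n, a - e <= eigval (X n) i <= b + e.
Proof.
move=> e0; near=> n => i; have n0 : (0 < n)%N by apply: leq_ltn_trans (ltn_ord i).
apply/andP; split.
  apply: (@le_trans _ _ (eigval (X n) n.-1)).
    near: n; apply: cvgr_ge Xa _ _; lra.
  apply: eigval_mono => //; apply/andP; split; last by rewrite ltn_predL.
  by rewrite -ltnS prednK// ltn_ord.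
apply: (@le_trans _ _ (eigval (X n) 0)).
  by apply: eigval_mono => //; rewrite ltn_ord.
near: n; apply: cvgr_le Xb _ _; lra.
Unshelve. all: by end_near.
Qed.

(** Adding a constant makes [f] nonnegative, so that its integrals against the
empirical measures are finite sums. *)
Lemma spectral_mean_cvg (f : R -> R) M : continuous f -> (forall t, `|f t| <= M) ->
  spectral_mean f (X n) @[n --> \oo] --> \int[mu]_t f t.
Proof.
move=> cf fM; pose h t := f t + M.
have mf : measurable_fun setT f by exact: continuous_measurable_fun.
have ch : continuous h by move=> t; apply: cvgD; [exact: cf|exact: cvg_cst].
have M0 : 0 <= M := le_trans (normr_ge0 (f 0)) (fM 0).
have h0 t : 0 <= h t by have := fM t; rewrite ler_norml /h => /andP[]; lra.
have bh : bounded_fun h.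
  exists (M + M); split; first exact: num_real.
  move=> x Mx t _; apply: le_trans (ltW Mx); rewrite (le_trans (ler_normD _ _))//.
  by rewrite lerD// ger0_norm.
have bf : bounded_rv (f : measurableTypeR R -> R) by split => //; exists M.
have Ih : (\int[mu]_t (h t)%:E = (\int[mu]_t f t + M)%:E)%E.
  transitivity ((\int[mu]_t (f t + M))%:E).
    rewrite /Rintegral fineK//; apply: integrable_fin_num => //.
    by apply: bounded_rv_integrable; apply: bounded_rvD bf _; exact: bounded_rv_cst.
  rewrite RintegralD//; [|exact: bounded_rv_integrable|
    exact/bounded_rv_integrable/bounded_rv_cst].
  rewrite Rintegral_cst// (_ : fine _ = 1) ?mulr1//.
  by rewrite -[RHS]/(fine 1%:E); congr fine; exact: probability_setT.
have := Xmu ch bh; rewrite Ih => /fine_cvgP[_ H].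
have H2 : fine (\int[esd (X n)]_t (h t)%:E)%E - M @[n --> \oo] --> \int[mu]_t f t.
  by rewrite -[X in _ --> X](addrK M); apply: cvgB; [exact: H|exact: cvg_cst].
apply: cvg_trans H2.
apply: near_eq_cvg; near=> n.
have n0 : (0 < n)%N by near: n; exact: (nbhs_infty_gt 0).
have mh : measurable_fun setT h by exact: continuous_measurable_fun.
have -> : spectral_mean f (X n) = spectral_mean h (X n) - M.
  rewrite /spectral_mean /h big_split/= sumr_const card_ord mulrDr.
  rewrite -[M *+ n]mulr_natl mulKf ?addrK//.
  by rewrite pnatr_eq0 -lt0n.
by rewrite /= (integral_esd (X n) n0 mh h0).
Unshelve. all: by end_near.
Qed.

Lemma cmp_poly (p : {poly R}) :
  fro2 (cmp (V n) (fun t => p.[t]) (X n)) @[n --> \oo] --> (0 : R).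
Proof.
have cmp_exp k : fro2 (cmp (V n) (fun t => t ^+ k) (X n)) @[n --> \oo] --> (0 : R).
  apply: cvg_trans (VX k); apply: near_eq_cvg; near=> n.
  have n0 : n != 0 by rewrite -lt0n; near: n; exact: (nbhs_infty_gt 0).
  by rewrite fcalc_centered.
suff main m : fro2 (cmp (V n) (fun t => \sum_(i < m) p`_i * t ^+ i) (X n))
    @[n --> \oo] --> (0 : R).
  have -> : (fun t => p.[t]) = (fun t => \sum_(i < size p) p`_i * t ^+ i).
    by apply/funext => t; exact: horner_coef.
  exact: main.
elim: m => [|m IH].
  apply: cvg_near_cst; apply: nearW => n.
  have -> : (fun t : R => \sum_(i < 0) p`_i * t ^+ i) = (fun t => 0 * t ^+ 0).
    by apply/funext => t; rewrite big_ord0 mul0r.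
  by rewrite cmpZ fro2Z nsqR expr0n mul0r.
have split n : cmp (V n) (fun t => \sum_(i < m.+1) p`_i * t ^+ i) (X n) =
    cmp (V n) (fun t => \sum_(i < m) p`_i * t ^+ i) (X n)
    + (p`_m)%:C *: cmp (V n) (fun t => t ^+ m) (X n).
  rewrite -cmpZ -cmpD.
  have -> // : (fun t : R => \sum_(i < m.+1) p`_i * t ^+ i) =
      (fun t => \sum_(i < m) p`_i * t ^+ i + p`_m * t ^+ m).
  by apply/funext => t; rewrite big_ord_recr.
pose F n := fro2 (cmp (V n) (fun t => \sum_(i < m) p`_i * t ^+ i) (X n)).
pose F' n := fro2 (cmp (V n) (fun t => t ^+ m) (X n)).
have lim0 : 2 * F n + 2 * (p`_m ^+ 2 * F' n) @[n --> \oo] --> (0 : R).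
  have l1 : 2 * F n @[n --> \oo] --> (2 * 0 : R).
    by apply: cvgM; [exact: cvg_cst|exact: IH].
  have l2 : 2 * (p`_m ^+ 2 * F' n) @[n --> \oo] --> (2 * (p`_m ^+ 2 * 0) : R).
    apply: cvgM; first exact: cvg_cst.
    by apply: cvgM; [exact: cvg_cst|exact: cmp_exp].
  by have := cvgD l1 l2; rewrite !mulr0 addr0; exact.
apply: (squeeze_cvgr _ _ lim0); last exact: (cvg_cst 0).
apply: nearW => n; rewrite fro2_ge0/= split.
by have := fro2D (cmp (V n) (fun t => \sum_(i < m) p`_i * t ^+ i) (X n))
  ((p`_m)%:C *: cmp (V n) (fun t => t ^+ m) (X n)); rewrite fro2Z nsqR.
Unshelve. all: by end_near.
Qed.

(** For polynomials this is linearity and the case of powers; replacing [f] by a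
polynomial changes the compression by at most the uniform error. *)
Lemma cmp_approx (f : R -> R) :
  (forall d, 0 < d -> exists p : {poly R}, \forall n \near \oo,
    forall i : 'I_n, `|f (eigval (X n) i) - p.[eigval (X n) i]| <= d) ->
  fro2 (cmp (V n) f (X n)) @[n --> \oo] --> (0 : R).
Proof.
move=> fp; apply/cvgrPdist_le => eps eps0.
pose d := Num.min 1 (eps / (16 * (r%:R + 1))).
have d0 : 0 < d by rewrite lt_min ltr01 divr_gt0// mulr_gt0// ltr_wpDl.
have [p pf] := fp d d0.
near=> n; have rn : (r <= n)%N by near: n; exact: nbhs_infty_ge.
rewrite sub0r normrN ger0_norm ?fro2_ge0//.
have -> : cmp (V n) f (X n) = cmp (V n) (fun t => f t - p.[t]) (X n)
    + cmp (V n) (fun t => p.[t]) (X n).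
  have {1}-> : f = (fun t => f t - p.[t] + p.[t]).
    by apply/funext => t; rewrite subrK.
  exact: cmpD.
rewrite (le_trans (fro2D _ _))//.
have h1 : fro2 (cmp (V n) (fun t => f t - p.[t]) (X n)) <= (2 * d) ^+ 2 * r%:R.
  by apply: fro2_cmp_le => //; [exact: Vu|near: n].
have h2 : fro2 (cmp (V n) (fun t => p.[t]) (X n)) <= eps / 4.
  near: n; have /cvgrPdist_le/(_ (eps / 4)) := cmp_poly p.
  rewrite divr_gt0// => /(_ isT); apply: filterS => n.
  by rewrite sub0r normrN ger0_norm ?fro2_ge0.
have h3 : (2 * d) ^+ 2 * r%:R <= eps / 4.
  have dd : d ^+ 2 <= eps / (16 * (r%:R + 1)).
    rewrite expr2; apply: (@le_trans _ _ (1 * d)); last first.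
      by rewrite mul1r ge_min lexx orbT.
    by rewrite ler_wpM2r ?(ltW d0)// ge_min lexx.
  have r0 : 0 < r%:R + 1 :> R by rewrite ltr_wpDl.
  have E : eps / 4 = 4 * (eps / (16 * (r%:R + 1))) * (r%:R + 1).
    by field; rewrite gt_eqF.
  have h := ler_wpM2r (ler0n R r) dd.
  have e0 : 0 <= eps / (16 * (r%:R + 1)) by rewrite (le_trans _ dd)// sqr_ge0.
  have -> : (2 * d) ^+ 2 * r%:R = 4 * (d ^+ 2 * r%:R) by ring.
  by rewrite E -[leRHS]mulrA ler_wpM2l// (le_trans h)// ler_wpM2l// lerDl.
move: (le_trans h1 h3) h2; move: (fro2 _) (fro2 _) => x y; lra.
Unshelve. all: by end_near.
Qed.

End spectral_limits.

(** * Compressed resolvents *)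

Section resolvent_approximation.
Context {R : realType}.
Implicit Types (lo hi z e d : R).

(** Expand the resolvent in a geometric series around the midpoint of the
interval; it converges uniformly since [z] is further from the midpoint than
the endpoints are. *)
Lemma resolvent_poly lo hi e z d : lo <= hi -> 0 < e -> gap lo hi e z -> 0 < d ->
  exists p : {poly R}, forall t, lo <= t <= hi -> `|(z - t)^-1 - p.[t]| <= d.
Proof.
move=> lh e0 gz d0; pose c := (lo + hi) / 2; pose w := z - c.
pose h := (hi - lo) / 2; have h0 : 0 <= h by rewrite divr_ge0// subr_ge0.
have wh : h + e <= `|w|.
  rewrite ler_normr /w /h /c; apply/orP.
  by case: gz => gz; [right|left]; lra.
have w0 : 0 < `|w| by rewrite (lt_le_trans _ wh)// ltr_wpDl.
have wn0 : w != 0 by rewrite -normr_gt0.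
pose q := h / `|w|; have q0 : 0 <= q by rewrite divr_ge0.
have q1 : q < 1 by rewrite ltr_pdivrMr// mul1r (lt_le_trans _ wh)// ltrDl.
have [K qK] : exists K, q ^+ K <= d * e.
  have /cvg_expr/cvgrPdist_le/(_ (d * e)) : `|q| < 1 by rewrite ger0_norm.
  rewrite mulr_gt0// => /(_ isT)[K _ /(_ K (leqnn K))].
  by rewrite sub0r normrN ger0_norm ?exprn_ge0//; exists K.
exists (\sum_(j < K) (w^-1 ^+ j.+1) *: ('X - c%:P) ^+ j) => t tI.
have zt : z - t != 0 by exact: gap_neq0 e0 gz tI.
have et : e <= `|z - t| by exact: gap_norm gz tI.
pose x := (t - c) / w.
have xq : `|x| <= q.
  rewrite normrM normfV ler_wpM2r ?invr_ge0// ler_norml /h /c.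
  by move: tI => /andP[lt th]; apply/andP; split; lra.
have -> : (\sum_(j < K) (w^-1 ^+ j.+1) *: ('X - c%:P) ^+ j).[t] =
    w^-1 * \sum_(j < K) x ^+ j.
  rewrite horner_sum mulr_sumr; apply: eq_bigr => j _.
  by rewrite hornerZ horner_exp !hornerE exprS -mulrA -exprMn (mulrC w^-1 (t - c)).
have E : z - t = w * (1 - x).
  by rewrite mulrBr mulr1 /x mulrCA divff// mulr1 /w; ring.
have x1 : 1 - x != 0 by apply: contraNneq zt => x0; rewrite E x0 mulr0.
have sumE : \sum_(j < K) x ^+ j = (1 - x ^+ K) / (1 - x).
  apply: (mulfI x1); rewrite mulrCA divff// mulr1.
  by rewrite -opprB mulNr -subrX1 opprB.
have -> : (z - t)^-1 - w^-1 * \sum_(j < K) x ^+ j = x ^+ K / (z - t).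
  by rewrite sumE E; field; rewrite wn0 x1.
rewrite normrM normfV normrX ler_pdivrMr ?(lt_le_trans e0)//.
apply: (@le_trans _ _ (q ^+ K)); first by rewrite lerXn2r// nnegrE.
by rewrite (le_trans qK)// ler_wpM2l// ltW.
Qed.

Lemma resolvent_sqr_poly lo hi e z d : lo <= hi -> 0 < e -> gap lo hi e z -> 0 < d ->
  exists p : {poly R}, forall t, lo <= t <= hi -> `|(z - t)^-1 ^+ 2 - p.[t]| <= d.
Proof.
move=> lh e0 gz d0; pose D := 2 / e + 1.
have D0 : 0 < D by rewrite ltr_wpDl// divr_ge0// ltW.
pose d' := Num.min 1 (d / D).
have d'0 : 0 < d' by rewrite lt_min ltr01 divr_gt0.
have [p pd] := resolvent_poly lh e0 gz d'0.
exists (p ^+ 2) => t tI; rewrite horner_exp subr_sqr normrM.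
have h1 := pd t tI; have h2 : `|(z - t)^-1| <= e^-1.
  by rewrite normfV lef_pV2 ?posrE ?(lt_le_trans e0)//; exact: gap_norm gz tI.
have h3 : `|(z - t)^-1 + p.[t]| <= D.
  have -> : (z - t)^-1 + p.[t] = 2 * (z - t)^-1 - ((z - t)^-1 - p.[t]) by ring.
  rewrite (le_trans (ler_normB _ _))// /D lerD//; last first.
    by rewrite (le_trans h1)// ge_min lexx.
  by rewrite normrM ger0_norm// ler_wpM2l.
have h4 : d' <= d / D by rewrite ge_min lexx orbT.
apply: (@le_trans _ _ (d' * D)); first exact: ler_pM.
by rewrite -ler_pdivlMr.
Qed.

End resolvent_approximation.

Section resolvent_limits.
Context {R : realType} (mu : probability (measurableTypeR R) R).
Hypothesis cmu : compact (msupport mu).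
Local Notation C := R[i].
Local Notation a := (inf (msupport mu)).
Local Notation b := (sup (msupport mu)).
Variables (X : forall n, 'M[C]_n) (r : nat) (V : forall n, 'M[C]_(r, n)).
Hypotheses (Xh : forall n, X n \is hermsymmx)
  (Vu : forall n, (r <= n)%N -> V n \is unitarymx)
  (Xmu : weak_cvg (fun n => esd (X n)) mu)
  (Xa : eigval (X n) n.-1 @[n --> \oo] --> a)
  (Xb : eigval (X n) 0 @[n --> \oo] --> b)
  (VX : forall k, fro2 (V n *m centered k (X n) *m (V n)^t*) @[n --> \oo] --> (0 : R)).
Variables (e z : R).
Hypotheses (e0 : 0 < e) (gz : gap a b (e + e) z).

Let ab : a <= b. Proof. exact: inf_le_sup_support. Qed.
Let lo : R := a - e.
Let hi : R := b + e.
Let lh : lo <= hi. Proof. by rewrite /lo /hi; have := ab; have := e0; lra. Qed.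
Let gze : gap lo hi e z.
Proof. by case: gz => h; [left|right]; rewrite /lo /hi; lra. Qed.

Lemma cmp_resolvent k : (k == 1%N) || (k == 2%N) ->
  fro2 (cmp (V n) (fun t => (z - t)^-1 ^+ k) (X n)) @[n --> \oo] --> (0 : R).
Proof.
move=> k12; apply: cmp_approx Xh Vu VX _ _ => d d0.
have [p pd] : exists p : {poly R}, forall t, lo <= t <= hi ->
    `|(z - t)^-1 ^+ k - p.[t]| <= d.
  by move: k12 => /orP[]/eqP->; [exact: resolvent_poly lh e0 gze d0|
    exact: resolvent_sqr_poly lh e0 gze d0].
exists p; have := near_eigval Xa Xb e0; apply: filterS => n ni i.
by apply: pd; exact: ni.
Qed.

(** The resolvent is clipped to a neighbourhood of the support, which eventually
contains all the eigenvalues and leaves the integral unchanged. *)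
Lemma mean_resolvent k :
  spectral_mean (fun t => (z - t)^-1 ^+ k) (X n) @[n --> \oo] --> resolvent_moment mu z k.
Proof.
pose f t := (z - t)^-1 ^+ k.
have mf : measurable_fun setT f.
  apply: measurable_funX; apply: (measurableT_comp (f := fun x : R => x^-1)).
    exact: measurable_invr.
  by apply: measurable_funB; [exact: measurable_cst|exact: measurable_id].
have cfl : continuous (f \o clip lo hi) by exact: resolvent_continuous lh e0 gze.
have cfa : continuous (f \o clip a b).
  apply: (@resolvent_continuous _ _ _ (e + e)) => //; exact: addr_gt0.
have -> : resolvent_moment mu z k = \int[mu]_t (f (clip lo hi t)).
  have mfl := continuous_measurable_fun cfl.
  have mfa := continuous_measurable_fun cfa.
  have la : lo <= a by rewrite /lo; have := e0; lra.
  have bh : b <= hi by rewrite /hi; have := e0; lra.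
  rewrite /resolvent_moment; congr fine.
  rewrite (integral_clip cmu la bh mf mfl).
  by rewrite -(integral_clip cmu (lexx a) (lexx b) mf mfa).
have := @spectral_mean_cvg _ mu X Xmu (f \o clip lo hi) (e^-1 ^+ k) cfl.
move=> /(_ (fun t => resolvent_bound k t lh e0 gze)); apply: cvg_trans.
apply: near_eq_cvg; have := near_eigval Xa Xb e0; apply: filterS => n ni.
rewrite /spectral_mean; congr (_ * _); apply: eq_bigr => i _.
by rewrite /= clip_id//; exact: ni.
Qed.

(** Powers of the resolvent are uniform limits of polynomials near the spectrum, so
their compressions approach their means, which converge to moments of [mu]. *)
Lemma compressed_resolvent_cvg k : (k == 1%N) || (k == 2%N) ->
  fro2 (V n *m fcalc (fun t => (z - t)^-1 ^+ k) (X n) *m (V n)^t*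
        - (resolvent_moment mu z k)%:C%:M) @[n --> \oo] --> (0 : R).
Proof.
move=> k12; pose f t := (z - t)^-1 ^+ k.
pose m n := spectral_mean f (X n) - resolvent_moment mu z k.
have m0 : m n @[n --> \oo] --> (0 : R).
  rewrite -(subrr (resolvent_moment mu z k)).
  by apply: cvgB; [exact: mean_resolvent|exact: cvg_cst].
have l1 : 2 * fro2 (cmp (V n) f (X n)) @[n --> \oo] --> (2 * 0 : R).
  by apply: cvgM; [exact: cvg_cst|exact: cmp_resolvent].
have l2 : 2 * (m n ^+ 2 * r%:R) @[n --> \oo] --> (2 * (0 * 0 * r%:R) : R).
  apply: cvgM; first exact: cvg_cst.
  apply: cvgM; last exact: cvg_cst.
  by under eq_fun do rewrite expr2; apply: cvgM.
have lim0 : 2 * fro2 (cmp (V n) f (X n)) + 2 * (m n ^+ 2 * r%:R) @[n --> \oo] --> (0 : R).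
  by have := cvgD l1 l2; rewrite !(mulr0, mul0r) addr0; exact.
apply: (squeeze_cvgr _ _ lim0); last exact: (cvg_cst 0).
near=> n; rewrite fro2_ge0/=.
have rn : (r <= n)%N by near: n; exact: nbhs_infty_ge.
have VV : V n *m (V n)^t* = 1%:M by apply/unitarymxP; exact: Vu.
have -> : V n *m fcalc f (X n) *m (V n)^t* - (resolvent_moment mu z k)%:C%:M =
    cmp (V n) f (X n) + (m n)%:C *: 1%:M.
  rewrite /cmp mulmxBr mulmxBl mul_mx_scalar -scalemxAl VV /m rmorphB scalerBl.
  by rewrite scalemx1 scalemx1 addrA subrK.
have := fro2D (cmp (V n) f (X n)) ((m n)%:C *: 1%:M); rewrite fro2Z nsqR.
by rewrite (@fro2_unitaryl _ r r 1%:M)//; apply/unitarymxP; rewrite adj1 mulmx1.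
Unshelve. all: by end_near.
Qed.

End resolvent_limits.

(** * Counting eigenvalues of a perturbed matrix *)

Section quadratic_forms.
Context {R : rcfType}.
Local Notation C := R[i].

Lemma qfD n (A B : 'M[C]_n) x : qf (A + B) x = qf A x + qf B x.
Proof. by rewrite /qf mulmxDr mulmxDl mxE reD. Qed.

Lemma qfN n (A : 'M[C]_n) x : qf (- A) x = - qf A x.
Proof. by rewrite /qf mulmxN mulNmx mxE reN. Qed.

Lemma qfB n (A B : 'M[C]_n) x : qf (A - B) x = qf A x - qf B x.
Proof. by rewrite qfD qfN. Qed.

Lemma qf_scalar n c (x : 'rV[C]_n) : qf (c%:C%:M) x = c * fro2 x.
Proof.
rewrite /qf mul_mx_scalar -scalemxAl mxE reZ fro2E trace_mx11.
by [].
Qed.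

Lemma qf_conj m n (A : 'M[C]_n) (B : 'M[C]_(m, n)) x :
  qf (B *m A *m B^t*) x = qf A (x *m B).
Proof. by rewrite /qf adjM !mulmxA. Qed.

Lemma qf_le_fro2 n (D : 'M[C]_n) x : qf D x ^+ 2 <= fro2 D * fro2 x ^+ 2.
Proof.
apply: (@le_trans _ _ (nsq ((x *m D *m x^t*) 0 0))); first exact: re_sqr_le.
apply: (le_trans (row_col_nsq _ _)); rewrite fro2_adj expr2 mulrA ler_wpM2r ?fro2_ge0//.
by rewrite mulrC; exact: fro2M.
Qed.

Lemma qf_diag n (c : 'I_n -> R) x : qf (diag_mx (\row_j (c j)%:C)) x = \sum_j c j * nsq (x 0 j).
Proof.
rewrite /qf mxE re_sum; apply: eq_bigr => j _.
by rewrite mul_mx_diag !mxE mulrAC -nsqE mulrC reZ reC.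
Qed.

(** Cauchy-Schwarz for the compression of [w] to the rows of [V], with a weight
[H] on one side and its inverse [H'] on the other. *)
Lemma compress_CS r n (V : 'M[C]_(r, n)) (H H' : 'M[C]_n) (w : 'rV[C]_n) :
  H *m H' = 1%:M -> H'^t* = H' ->
  fro2 (w *m V^t*) ^+ 2 <= fro2 (w *m H) * fro2 (w *m V^t* *m V *m H').
Proof.
move=> HH' H'J; have := fdot_CS (w *m H) (w *m V^t* *m V *m H').
have -> // : fdot (w *m H) (w *m V^t* *m V *m H') = fro2 (w *m V^t*).
rewrite /fdot (adjM _ H') H'J (mulmxA (w *m H)) -(mulmxA w H H') HH' mulmx1.
by rewrite fro2E (adjM (w *m V^t*) V) (mulmxA w).
Qed.

End quadratic_forms.

Section eigenvalue_counting.
Context {R : rcfType} (n r : nat).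
Local Notation C := R[i].
Variables (S0 S : 'M[C]_n) (d0 d : 'I_n -> R) (V : 'M[C]_(r, n)) (theta : 'I_r -> R).
Hypotheses (S0u : S0 \is unitarymx) (Su : S \is unitarymx).
Hypothesis XP : dgc S0 d0 + dgc V theta = dgc S d.
Variable z : R.
Hypothesis d0z : forall i, d0 i < z.
Let K := V *m dgc S0 (fun i => (z - d0 i)^-1) *m V^t*.

Let zd0 i : 0 < z - d0 i. Proof. by rewrite subr_gt0. Qed.
Let H := dgc S0 (fun i => Num.sqrt (z - d0 i)).
Let H' := dgc S0 (fun i => (Num.sqrt (z - d0 i))^-1).

Let HH' : H *m H' = 1%:M.
Proof.
rewrite -(dgc_scalar S0u 1); apply: etrans (dgcM S0u _ _) _; apply: eq_dgc => i.
by rewrite divff// gt_eqF// sqrtr_gt0.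
Qed.

Let H'J : H'^t* = H'. Proof. exact: dgc_adj. Qed.

Let formH w : fro2 (w *m H) = z * fro2 w - qf (dgc S0 d0) w.
Proof.
rewrite fro2_mul_dgc// qf_dgc// (fro2_coord S0u w) mulr_sumr -sumrB.
by apply: eq_bigr => i _; rewrite sqr_sqrtr ?ltW// mulrBl.
Qed.

Let formK c : fro2 (c *m V *m H') = qf K c.
Proof.
rewrite qf_conj qf_dgc (fro2_mul_dgc S0u); apply: eq_bigr => i _.
by rewrite exprVn sqr_sqrtr ?ltW.
Qed.

(** Otherwise the form of the perturbed matrix would be at least [z] at some [w]
orthogonal to the rows of [V] indexed by [I0]. There the perturbation adds at
most [t] times the squared norm of the coordinates of [w], which by
[compress_CS] is at most [g] times the form of [z - X]; but [t * g < 1]. *)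
Lemma card_eigval_ge (I0 : {set 'I_r}) t g :
  0 < g -> 0 <= t -> t * g < 1 -> (forall j, j \notin I0 -> theta j <= t) ->
  (forall c, qf K c <= g * fro2 c) ->
  (#|[set i | (z <= d i)%R]%SET| <= #|I0|)%N.
Proof.
move=> g0 t0 tg thI Kg; rewrite leqNgt; apply/negP => cardJ.
have [i|w [w0 wV]] :=
    exists_qf_ge Su (colsub (enum_val (A := I0)) (V^t*)) (d := d) (z := z) cardJ.
  by rewrite inE.
rewrite -XP qfD [qf (dgc V _) _]qf_dgc => form.
pose c := w *m V^t*.
have cI j : j \in I0 -> c 0 j = 0.
  move=> jI; have /rowP/(_ (enum_rank_in jI j)) := wV.
  by rewrite mulmx_colsub [LHS]mxE enum_rankK_in// => ->; rewrite mxE.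
have thc : \sum_j theta j * nsq (c 0 j) <= t * fro2 c.
  rewrite /fro2 big_ord1 mulr_sumr ler_sum// => j _.
  have [jI|jI] := boolP (j \in I0); first by rewrite cI// nsq0 !mulr0.
  by rewrite ler_wpM2r ?nsq_ge0// thI.
have wH0 : 0 < fro2 (w *m H).
  rewrite lt_neqAle fro2_ge0 andbT eq_sym; apply: contraNneq w0 => /fro2_eq0 wH.
  by rewrite -(mulmx1 w) -HH' mulmxA wH mul0mx.
have cg : fro2 c <= g * fro2 (w *m H).
  have CS : fro2 c ^+ 2 <= fro2 (w *m H) * qf K c.
    by rewrite -formK; exact: compress_CS HH' H'J.
  have [c0|c0] := leP (fro2 c) 0; first by rewrite (le_trans c0)// mulr_ge0 ?fro2_ge0 ?ltW.
  rewrite -(ler_pM2r c0) -expr2 (le_trans CS)//.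
  by rewrite mulrAC mulrC ler_wpM2r ?fro2_ge0// Kg.
have : fro2 (w *m H) <= t * fro2 c.
  by rewrite formH lerBlDl; exact: le_trans form (lerD (lexx _) thc).
have h := ler_wpM2l t0 cg; rewrite mulrA in h.
have := ltr_pM2r wH0 (t * g) 1; rewrite tg mul1r => h2 h3.
by have := le_lt_trans (le_trans h3 h) h2; rewrite ltxx.
Qed.

(** At the vectors [c V R], with [R] the resolvent of [X] at [z] and [c] supported
in [I1], the form of the perturbed matrix exceeds [z] exactly when the
hypothesis holds; they form a space of dimension the cardinal of [I1]. *)
Lemma card_eigval_gt (I1 : {set 'I_r}) :
  (forall c : 'rV_r, c != 0 -> (forall j, j \notin I1 -> c 0 j = 0) ->
     qf K c < \sum_j theta j * nsq ((c *m K) 0 j)) ->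
  (#|I1| <= #|[set i | (z < d i)%R]%SET|)%N.
Proof.
move=> Kth; rewrite leqNgt; apply/negP => cardJ.
pose E : 'M[C]_(#|I1|, r) := rowsub (enum_val (A := I1)) 1%:M.
have [i|y y0] := exists_qf_le Su (E *m V *m dgc S0 (fun i => (z - d0 i)^-1)) (d := d) (z := z) cardJ.
  by rewrite inE -leNgt.
pose c := y *m E; rewrite (mulmxA y (E *m V)) (mulmxA y E) -/c; set w := c *m V *m _.
have cE j : c 0 j = \sum_k y 0 k * (enum_val k == j)%:R.
  by rewrite mxE; apply: eq_bigr => k _; rewrite !mxE.
have c0 : c != 0.
  apply: contraNneq y0 => c0; apply/eqP/rowP => k.
  have := cE (enum_val k); rewrite c0 (bigD1 k)//= eqxx mulr1 big1 ?addr0.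
    by rewrite !mxE => <-.
  by move=> j jk; rewrite (inj_eq enum_val_inj) (negbTE jk) mulr0.
have cI j : j \notin I1 -> c 0 j = 0.
  move=> jI; rewrite cE big1// => k _; case: eqP => [kj|_]; rewrite ?mulr0//.
  by move: (enum_valP k); rewrite kj (negbTE jI).
have RH : dgc S0 (fun i => (z - d0 i)^-1) *m H = H'.
  apply: etrans (dgcM S0u _ _) _; apply: eq_dgc => i.
  have s0 : Num.sqrt (z - d0 i) != 0 by rewrite gt_eqF// sqrtr_gt0.
  by rewrite -{1}(sqr_sqrtr (ltW (zd0 i))) expr2 invfM -mulrA mulVf// mulr1.
have wH : fro2 (w *m H) = qf K c by rewrite -formK -RH (mulmxA (c *m V)).
have wV : w *m V^t* = c *m K by rewrite /K /w !mulmxA.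
rewrite -XP qfD [qf (dgc V _) _]qf_dgc wV => form.
by have := Kth c c0 cI; rewrite -wH formH ltrBlDl ltNge form.
Qed.

End eigenvalue_counting.

(** * Counting with asymptotically scalar compressions *)

Section near_scalar_forms.
Context {R : rcfType} (r : nat).
Local Notation C := R[i].

Lemma qf_le (D : 'M[C]_r) x d : 0 <= d -> fro2 D <= d ^+ 2 -> `|qf D x| <= d * fro2 x.
Proof.
move=> d0 Dd; rewrite -(@ler_pXn2r _ 2)// ?nnegrE ?mulr_ge0 ?fro2_ge0//.
rewrite real_normK ?num_real// exprMn (le_trans (qf_le_fro2 _ _))//.
by rewrite ler_wpM2r ?sqr_ge0.
Qed.

Variables (theta : 'I_r -> R) (g : R).
Let Th : 'M[C]_r := diag_mx (\row_j (theta j)%:C).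

(** With [K = E + g], every term of the difference contains the factor [E]. *)
Lemma fro2_diag_form (K : 'M[C]_r) (E := K - g%:C%:M) : fro2 E <= 1 ->
  fro2 (K *m Th *m K^t* - K - ((g ^+ 2)%:C *: Th - g%:C%:M)) <=
  fro2 E * (4 * fro2 Th * (2 + 2 * (g ^+ 2 * r%:R)) + 4 * g ^+ 2 * fro2 Th + 2).
Proof.
move=> E1; have KE : K = E + g%:C%:M by rewrite subrK.
have -> : K *m Th *m K^t* - K - ((g ^+ 2)%:C *: Th - g%:C%:M) =
    E *m Th *m K^t* + g%:C *: (Th *m E^t*) - E.
  rewrite {1 3}KE mulmxDl mulmxDl mul_scalar_mx -scalemxAl.
  have -> : Th *m K^t* = Th *m E^t* + g%:C *: Th.
    by rewrite KE adjD adj_scalar mulmxDr mul_mx_scalar.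
  rewrite scalerDr scalerA -rmorphM -expr2.
  move: (E *m Th *m K^t*) (g%:C *: (Th *m E^t*)) ((g ^+ 2)%:C *: Th) => a b c.
  by rewrite !opprD !opprK !addrA; apply/matrixP => i j; rewrite !mxE; ring.
have E0 := fro2_ge0 E; have T0 := fro2_ge0 Th.
have hK : fro2 (K^t*) <= 2 + 2 * (g ^+ 2 * r%:R).
  rewrite fro2_adj KE (le_trans (fro2D _ _))// lerD//.
    by rewrite -[leRHS]mulr1 ler_wpM2l.
  rewrite -scalemx1 fro2Z nsqR (@fro2_unitaryl _ r r 1%:M)//.
  by apply/unitarymxP; rewrite adj1 mulmx1.
have h1 : fro2 (E *m Th *m K^t*) <= fro2 E * fro2 Th * (2 + 2 * (g ^+ 2 * r%:R)).
  by rewrite (le_trans (fro2M _ _))// ler_pM ?fro2_ge0// fro2M.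
have h2 : fro2 (g%:C *: (Th *m E^t*)) <= g ^+ 2 * (fro2 Th * fro2 E).
  by rewrite fro2Z nsqR ler_wpM2l ?sqr_ge0// -(fro2_adj E) fro2M.
have h3 := fro2B (E *m Th *m K^t* + g%:C *: (Th *m E^t*)) E.
have h4 := fro2D (E *m Th *m K^t*) (g%:C *: (Th *m E^t*)).
apply: (le_trans h3); move: h1 h2 h4.
move: (fro2 (_ + _)) (fro2 (_ *m _)) (fro2 (_ *: _)) (2 + _) => x y w k.
nra.
Qed.

End near_scalar_forms.

Section asymptotic_counting.
Context {R : realType} (r : nat).
Local Notation C := R[i].
Variables (S0 S : forall n, 'M[C]_n) (d0 d : forall n, 'I_n -> R).
Variables (V : forall n, 'M[C]_(r, n)) (theta : 'I_r -> R) (z g : R).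
Arguments d0 : clear implicits.
Arguments d : clear implicits.
Let K n := V n *m dgc (S0 n) (fun i => (z - d0 n i)^-1) *m (V n)^t*.
Hypothesis XP : \forall n \near \oo,
  [/\ S0 n \is unitarymx, S n \is unitarymx,
      dgc (S0 n) (d0 n) + dgc (V n) theta = dgc (S n) (d n) &
      forall i, d0 n i < z].
Hypotheses (g0 : 0 < g) (Kg : fro2 (K n - g%:C%:M) @[n --> \oo] --> (0 : R)).

Let near_K e : 0 < e -> \forall n \near \oo, fro2 (K n - g%:C%:M) <= e.
Proof.
move=> e0; move/cvgrPdist_le: Kg => /(_ e e0); apply: filterS => n.
by rewrite sub0r normrN ger0_norm ?fro2_ge0.
Qed.

(** The weight [g + e] in place of [g] absorbs the error of the compressed
resolvent. *)
Lemma near_card_ge t : 0 <= t -> t * g < 1 -> \forall n \near \oo,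
  (#|[set i | (z <= d n i)%R]%SET| <= #|[set j | (t < theta j)%R]%SET|)%N.
Proof.
(* Small enough for [t * (g + e) < 1]. *)
move=> t0 tg; pose e := (1 - t * g) / (2 * (t + 1)).
have t1 : 0 < t + 1 by rewrite ltr_wpDl.
have e0 : 0 < e by rewrite divr_gt0 ?subr_gt0// mulr_gt0.
have te : t * e <= (1 - t * g) / 2.
  have -> : (1 - t * g) / 2 = (t + 1) * e by rewrite /e; field; rewrite gt_eqF.
  by rewrite ler_wpM2r ?(ltW e0)// lerDl.
near=> n.
have [S0u Su XPn d0z] : [/\ S0 n \is unitarymx, S n \is unitarymx,
    dgc (S0 n) (d0 n) + dgc (V n) theta = dgc (S n) (d n) &
    forall i, d0 n i < z] by near: n.
apply: (card_eigval_ge S0u Su XPn d0z (t := t) (g := g + e)) => //.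
- exact: addr_gt0.
- lra.
- by move=> j; rewrite inE -leNgt.
move=> c; have Ke : fro2 (K n - g%:C%:M) <= e ^+ 2.
  by near: n; apply: near_K; exact: exprn_gt0.
have := qf_le c (ltW e0) Ke; rewrite qfB qf_scalar -/(K n) => /(le_trans (ler_norm _)).
lra.
Unshelve. all: by end_near.
Qed.

(** At [K = g] the form to be bounded below is [g * (g * t - 1)] times the squared
norm, which leaves room for half of it as an error. *)
Lemma near_card_gt t : 1 < t * g -> \forall n \near \oo,
  (#|[set j | (t <= theta j)%R]%SET| <= #|[set i | (z < d n i)%R]%SET|)%N.
Proof.
move=> tg; pose Th : 'M[C]_r := diag_mx (\row_j (theta j)%:C).
pose M := 4 * fro2 Th * (2 + 2 * (g ^+ 2 * r%:R)) + 4 * g ^+ 2 * fro2 Th + 2.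
pose e := g * (g * t - 1) / 2.
have e0 : 0 < e by rewrite divr_gt0// mulr_gt0// subr_gt0 mulrC.
have M0 : 0 < M.
  have T0 := fro2_ge0 Th; have g20 := ltW g0.
  by rewrite ltr_wpDl// addr_ge0// !mulr_ge0 ?addr_ge0 ?mulr_ge0.
near=> n.
have [S0u Su XPn d0z] : [/\ S0 n \is unitarymx, S n \is unitarymx,
    dgc (S0 n) (d0 n) + dgc (V n) theta = dgc (S n) (d n) &
    forall i, d0 n i < z] by near: n.
apply: (card_eigval_gt S0u Su XPn d0z) => c c0 cI; rewrite -/(K n).
have c20 : 0 < fro2 c.
  by rewrite lt_neqAle fro2_ge0 andbT eq_sym; apply: contraNneq c0 => /fro2_eq0 ->.
have E1 : fro2 (K n - g%:C%:M) <= 1 by near: n; exact: near_K.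
have Ee : fro2 (K n - g%:C%:M) <= e ^+ 2 / M.
  by near: n; apply: near_K; rewrite divr_gt0// exprn_gt0.
have De := fro2_diag_form theta E1; rewrite -/Th -/M in De.
have {}De : fro2 (K n *m Th *m (K n)^t* - K n - ((g ^+ 2)%:C *: Th - g%:C%:M)) <= e ^+ 2.
  by apply: le_trans De _; rewrite -ler_pdivlMr.
have := qf_le c (ltW e0) De; rewrite ler_norml => /andP[+ _].
have ThE : (g ^+ 2)%:C *: Th = diag_mx (\row_j (g ^+ 2 * theta j)%:C).
  by apply/matrixP => i j; rewrite !mxE mulrnAr -rmorphM.
rewrite qfB (qfB (K n *m _ *m _)) qf_conj qf_diag qfB qf_scalar ThE qf_diag.
have : g ^+ 2 * (t * fro2 c) <= \sum_j g ^+ 2 * theta j * nsq (c 0 j).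
  rewrite /fro2 big_ord1 !mulr_sumr ler_sum// => j _; rewrite -mulrA ler_wpM2l ?sqr_ge0//.
  have [jI|jI] := leP t (theta j); first by rewrite ler_wpM2r ?nsq_ge0.
  by rewrite cI ?nsq0 ?mulr0// inE -ltNge.
have : 0 < e * fro2 c by rewrite mulr_gt0.
have : g ^+ 2 * (t * fro2 c) - g * fro2 c = 2 * (e * fro2 c) by rewrite /e; field.
lra.
Unshelve. all: by end_near.
Qed.

End asymptotic_counting.

(** * Location of the outlying eigenvalue *)

Section ordinal_counting.

Lemma card_ord_lt n k : (k <= n)%N -> #|[set i : 'I_n | (i < k)%N]%SET| = k.
Proof.
move=> kn; rewrite cardsE -sum1_card.
by rewrite -(big_ord_widen n (fun=> 1%N) kn) sum1_card card_ord.
Qed.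

Lemma card_ord_ge n k : (k <= n)%N -> #|[set i : 'I_n | (k <= i)%N]%SET| = (n - k)%N.
Proof.
move=> kn; have -> : [set i : 'I_n | (k <= i)%N]%SET = (~: [set i : 'I_n | (i < k)%N])%SET.
  by apply/setP => i; rewrite !inE leqNgt.
by rewrite cardsCs finset.setCK card_ord card_ord_lt.
Qed.

End ordinal_counting.

Section outlier_location_shifts.

Lemma shift_eq (M : zmodType) (A B D E : M) : A = D -> A + B = E -> D + B = E.
Proof. by move->. Qed.

Lemma shift_dgcN (R : rcfType) n r (A : 'M[R[i]]_n) (S T : 'M[R[i]]_n)
    (V : 'M[R[i]]_(r, n)) d e t :
  A = dgc S d -> A + dgc V t = dgc T e ->
  dgc S (fun i => - d i) + dgc V (fun i => - t i) = dgc T (fun i => - e i).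
Proof.
move=> AE BE; rewrite -(dgcN S d) -(dgcN V t) -(dgcN T e) -BE opprD.
by congr (- _ + _); exact: esym.
Qed.

Lemma form_dgcN (R : rcfType) n r (V : 'M[R[i]]_(r, n)) (S : 'M[R[i]]_n)
    (f h : 'I_n -> R) g : (forall i, h i = - f i) ->
  V *m dgc S h *m V^t* - (- g)%:C%:M = - (V *m dgc S f *m V^t* - g%:C%:M).
Proof.
move=> hf; have -> : dgc S h = - dgc S f by rewrite dgcN; exact: eq_dgc.
have -> : (- g)%:C%:M = - g%:C%:M :> 'M[R[i]]_r by rewrite rmorphN raddfN.
by rewrite mulmxN mulNmx [RHS]opprD.
Qed.

End outlier_location_shifts.

Section outlier_location.
Context {R : realType} (mu : probability (measurableTypeR R) R).
Hypothesis cmu : compact (msupport mu).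
Local Notation C := R[i].
Local Notation a := (inf (msupport mu)).
Local Notation b := (sup (msupport mu)).
Local Notation G := (Cauchy_transform mu).
Variables (X : forall n, 'M[C]_n) (r : nat) (V : forall n, 'M[C]_(r, n)).
Hypotheses (Xh : forall n, X n \is hermsymmx)
  (Vu : forall n, (r <= n)%N -> V n \is unitarymx)
  (Xmu : weak_cvg (fun n => esd (X n)) mu)
  (Xa : eigval (X n) n.-1 @[n --> \oo] --> a)
  (Xb : eigval (X n) 0 @[n --> \oo] --> b)
  (VX : forall k, fro2 (V n *m centered k (X n) *m (V n)^t*) @[n --> \oo] --> (0 : R)).
Variables (theta : r.-tuple R) (i0 : 'I_r) (rho : R).
Hypotheses (sth : sorted >=%R theta) (Grho : G rho = (tnth theta i0)^-1).
Let Xt n : 'M[C]_n := X n + dgc (V n) (tnth theta).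

Lemma perturbed_herm n : Xt n \is hermsymmx.
Proof. by apply/hermP; rewrite adjD dgc_adj (elimT (hermP _) (Xh n)). Qed.

Let theta_mono (i j : 'I_r) : (i <= j)%N -> tnth theta j <= tnth theta i.
Proof.
move=> ij; rewrite !(tnth_nth 0); apply: (sorted_leq_nth (leT := >=%R)) => //.
- by move=> x y z xy yz; exact: le_trans yz xy.
- by move=> x; exact: lexx.
- by rewrite inE size_tuple.
- by rewrite inE size_tuple.
Qed.

Let card_theta_gt : (#|[set j | (tnth theta i0 < tnth theta j)%R]%SET| <= i0)%N.
Proof.
rewrite -[leqRHS](@card_ord_lt r i0) ?(ltnW (ltn_ord _))//.
apply/subset_leq_card/fintype.subsetP => j; rewrite !inE ltnNge; apply: contraTN => ij.
by rewrite -leNgt theta_mono.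
Qed.

Let card_theta_ge : (i0 < #|[set j | (tnth theta i0 <= tnth theta j)%R]%SET|)%N.
Proof.
rewrite -[leqLHS](@card_ord_lt r i0.+1) ?ltn_ord//.
by apply/subset_leq_card/fintype.subsetP => j; rewrite !inE ltnS => /theta_mono.
Qed.

Let card_theta_lt : (#|[set j | (tnth theta j < tnth theta i0)%R]%SET| <= r - i0.+1)%N.
Proof.
rewrite -(@card_ord_ge r i0.+1) ?ltn_ord//.
apply/subset_leq_card/fintype.subsetP => j; rewrite !inE ltnNge; apply: contraTN => ij.
by rewrite -leNgt theta_mono.
Qed.

Let card_theta_le : (r - i0 <= #|[set j | (tnth theta j <= tnth theta i0)%R]%SET|)%N.
Proof.
rewrite -(@card_ord_ge r i0) ?(ltnW (ltn_ord _))//.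
by apply/subset_leq_card/fintype.subsetP => j; rewrite !inE => /theta_mono.
Qed.

Let K_cvg z : z < a \/ b < z ->
  fro2 (V n *m dgc (eigbasis (X n)) (fun i => (z - eigval (X n) i)^-1) *m (V n)^t*
        - (G z)%:C%:M) @[n --> \oo] --> (0 : R).
Proof.
move=> side; have [e e0 gz] : exists2 e, 0 < e & gap a b (e + e) z.
  case: side => side; [exists ((a - z) / 2)|exists ((z - b) / 2)]; try lra.
    by left; lra.
  by right; lra.
rewrite (CauchyE cmu (addr_gt0 e0 e0) gz).
exact: (compressed_resolvent_cvg cmu Xh Vu Xmu Xa Xb VX e0 gz (k := 1)).
Qed.

Let near_right z : b < z -> \forall n \near \oo,
  [/\ eigbasis (X n) \is unitarymx, eigbasis (Xt n) \is unitarymx,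
      dgc (eigbasis (X n)) (fun i => eigval (X n) i) + dgc (V n) (tnth theta) =
      dgc (eigbasis (Xt n)) (fun i => eigval (Xt n) i) &
      forall i : 'I_n, eigval (X n) i < z].
Proof.
move=> bz; have e0 : 0 < (z - b) / 2 by lra.
have := near_eigval Xa Xb e0; apply: filterS => n nX.
have [Su XE] := eigbasisP (Xh n); have [Stu XtE] := eigbasisP (perturbed_herm n).
split; [exact: Su|exact: Stu|exact: shift_eq XE XtE|].
by move=> i; have := nX i; lra.
Qed.

Let near_left z : z < a -> \forall n \near \oo,
  [/\ eigbasis (X n) \is unitarymx, eigbasis (Xt n) \is unitarymx,
      dgc (eigbasis (X n)) (fun i => - eigval (X n) i)
        + dgc (V n) (fun j => - tnth theta j) =
      dgc (eigbasis (Xt n)) (fun i => - eigval (Xt n) i) &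
      forall i : 'I_n, - eigval (X n) i < - z].
Proof.
move=> za; have e0 : 0 < (a - z) / 2 by lra.
have := near_eigval Xa Xb e0; apply: filterS => n nX.
have [Su XE] := eigbasisP (Xh n); have [Stu XtE] := eigbasisP (perturbed_herm n).
split; [exact: Su|exact: Stu| |by move=> i; have := nX i; lra].
exact: shift_dgcN XE XtE.
Qed.

Let KN_cvg z : z < a ->
  fro2 (V n *m dgc (eigbasis (X n)) (fun i => (- z - - eigval (X n) i)^-1) *m (V n)^t*
        - (- G z)%:C%:M) @[n --> \oo] --> (0 : R).
Proof.
move=> za; apply: cvg_trans (K_cvg (or_introl za)); apply: near_eq_cvg.
apply: nearW => n; rewrite (@form_dgcN _ _ _ (V n) _ (fun i => (z - eigval (X n) i)^-1)).
  by rewrite fro2N.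
by move=> i; rewrite -opprD invrN.
Qed.

Section positive.
Hypotheses (brho : b < rho) (th0 : 0 < tnth theta i0).

Let upper z : rho < z -> \forall n \near \oo, eigval (Xt n) i0 < z.
Proof.
move=> rz; have bz : b < z := lt_trans brho rz.
have tg : tnth theta i0 * G z < 1.
  by rewrite mulrC -ltr_pdivlMr// mul1r -Grho (Cauchy_decr_right cmu).
have := near_card_ge (near_right bz) (Cauchy_gt0 cmu bz) (K_cvg (or_intror bz)) (ltW th0) tg.
apply: filter_app; near=> n => card.
have i0n : (i0 < n)%N by apply: leq_trans (ltn_ord i0) _; near: n; exact: nbhs_infty_ge.
rewrite ltNge; apply/negP => ze.
have := leq_trans card card_theta_gt; rewrite leqNgt => /negP; apply.
rewrite -[leqLHS](card_ord_lt i0n); apply/subset_leq_card/fintype.subsetP => i.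
rewrite !inE ltnS => ii0; apply: le_trans ze _; apply: eigval_mono.
by rewrite ii0.
Unshelve. all: by end_near.
Qed.

Let lower z : b < z -> z < rho -> \forall n \near \oo, z < eigval (Xt n) i0.
Proof.
move=> bz zr.
have tg : 1 < tnth theta i0 * G z.
  by rewrite mulrC -ltr_pdivrMr// mul1r -Grho (Cauchy_decr_right cmu).
have := near_card_gt (near_right bz) (Cauchy_gt0 cmu bz) (K_cvg (or_intror bz)) tg.
apply: filter_app; near=> n => card.
have i0n : (i0 < n)%N by apply: leq_trans (ltn_ord i0) _; near: n; exact: nbhs_infty_ge.
rewrite ltNge; apply/negP => ez.
have := leq_trans card_theta_ge card; rewrite ltnNge => /negP; apply.
rewrite -[leqRHS](card_ord_lt (ltnW i0n)); apply/subset_leq_card/fintype.subsetP => i.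
rewrite !inE ltNge; apply: contraNT; rewrite -leqNgt => i0i.
apply: le_trans ez; apply: eigval_mono.
by rewrite i0i ltn_ord.
Unshelve. all: by end_near.
Qed.

(** The threshold [theta * G z = 1] is crossed at [z = rho], since [G] is strictly
decreasing: above [rho] at most [i0] eigenvalues remain, below it at least
[i0 + 1]. *)
Lemma outlier_cvg_right : eigval (Xt n) i0 @[n --> \oo] --> rho.
Proof.
apply/cvgrPdist_le => e e0; pose z := Num.max (rho - e) ((b + rho) / 2).
have zr : z < rho by rewrite gt_max; apply/andP; split; have := brho; lra.
have bz : b < z by rewrite lt_max; apply/orP; right; have := brho; lra.
have re : rho < rho + e by rewrite ltrDl.
have ze : rho - e <= z by rewrite le_max lexx.
apply: filterS2 (upper re) (lower bz zr) => n h1 h2.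
by rewrite ler_norml; apply/andP; split; lra.
Qed.

End positive.

Section negative.
Hypotheses (rhoa : rho < a) (th0 : tnth theta i0 < 0).

Let n0 : tnth theta i0 != 0. Proof. exact: ltr0_neq0. Qed.

Let nG z : z < a -> 0 < - G z.
Proof. by move=> za; rewrite oppr_gt0 Cauchy_lt0. Qed.

Let index_bound n : (r <= n)%N -> (n - r + i0 < n)%N.
Proof. by move=> rn; rewrite -{2}(subnK rn) ltn_add2l. Qed.

Let index_card n : (r <= n)%N -> (n - (n - r + i0) = r - i0)%N.
Proof. by move=> rn; rewrite subnDA subKn. Qed.

Let lower z : z < rho -> \forall n \near \oo, z < eigval (Xt n) (n - r + i0).
Proof.
move=> zr; have za : z < a := lt_trans zr rhoa.
have tg : - tnth theta i0 * - G z < 1.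
  rewrite mulrNN mulrC -[ltRHS](mulVf n0).
  by rewrite ltr_nM2r// -Grho (Cauchy_decr_left cmu).
have t0 : 0 <= - tnth theta i0 by rewrite oppr_ge0 ltW.
have := near_card_ge (near_left za) (nG za) (KN_cvg za) t0 tg.
apply: filter_app; near=> n => card.
have rn : (r <= n)%N by near: n; exact: nbhs_infty_ge.
rewrite ltNge; apply/negP => ez.
have {card}card := leq_trans card _; have := card (r - i0.+1)%N.
have -> : #|[set j | (- tnth theta i0 < - tnth theta j)%R]%SET| =
          #|[set j | (tnth theta j < tnth theta i0)%R]%SET|.
  by apply: eq_card => j; rewrite !inE ltrN2.
move=> /(_ card_theta_lt); rewrite leqNgt => /negP; apply.
rewrite subnSK ?ltn_ord// -(index_card rn) -card_ord_ge ?(ltnW (index_bound rn))//.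
apply/subset_leq_card/fintype.subsetP => i.
rewrite !inE lerN2 => ii; apply: le_trans ez; apply: eigval_mono.
by rewrite ii ltn_ord.
Unshelve. all: by end_near.
Qed.

Let upper z : rho < z -> z < a -> \forall n \near \oo, eigval (Xt n) (n - r + i0) < z.
Proof.
move=> rz za.
have tg : 1 < - tnth theta i0 * - G z.
  rewrite mulrNN mulrC -[ltLHS](mulVf n0).
  by rewrite ltr_nM2r// -Grho (Cauchy_decr_left cmu).
have := near_card_gt (near_left za) (nG za) (KN_cvg za) tg.
apply: filter_app; near=> n => card.
have rn : (r <= n)%N by near: n; exact: nbhs_infty_ge.
rewrite ltNge; apply/negP => ze; move: card.
have -> : #|[set j | (- tnth theta i0 <= - tnth theta j)%R]%SET| =
          #|[set j | (tnth theta j <= tnth theta i0)%R]%SET|.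
  by apply: eq_card => j; rewrite !inE lerN2.
move=> /(leq_trans card_theta_le); rewrite leqNgt => /negP; apply.
rewrite -(index_card rn) -(subnSK (index_bound rn)) ltnS.
rewrite -card_ord_ge ?index_bound//.
apply/subset_leq_card/fintype.subsetP => i.
rewrite !inE ltrN2 ltnNge => ez; apply/negP => ii.
move: ez; rewrite ltNge (le_trans ze)//; apply: eigval_mono.
by rewrite ii index_bound.
Unshelve. all: by end_near.
Qed.

(** The same count for the opposite matrices at [- z]: eigenvalues are then counted
from the bottom, where [n - r + i0] corresponds to [r - 1 - i0]. *)
Lemma outlier_cvg_left : eigval (Xt n) (n - r + i0) @[n --> \oo] --> rho.
Proof.
apply/cvgrPdist_le => e e0; pose z := Num.min (rho + e) ((a + rho) / 2).
have rz : rho < z by rewrite lt_min; apply/andP; split; have := rhoa; lra.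
have za : z < a by rewrite gt_min; apply/orP; right; have := rhoa; lra.
have re : rho - e < rho by rewrite ltrBlDr ltrDl.
have ze : z <= rho + e by rewrite ge_min lexx.
apply: filterS2 (upper rz za) (lower re) => n h1 h2.
by rewrite ler_norml; apply/andP; split; lra.
Qed.

End negative.

End outlier_location.

(** * Projections onto eigenspaces *)

Section eigenspace_projections.
Context {R : rcfType} (r n : nat).
Local Notation C := R[i].
Variables (V : 'M[C]_(r, n)) (theta : 'I_r -> R).
Hypothesis Vu : V \is unitarymx.

(** The orthogonal projection onto the span of the rows of [V] indexed by [J]. *)
Let Q (J : pred 'I_r) := dgc V (fun j => (J j)%:R).
Let P := dgc V theta.

(** The projector onto the row space of [F] agrees with [Q J], which reads off the
coordinates of [u] on the rows of [V] indexed by [J]. *)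
Lemma proj_norm_rows m (F : 'M[C]_(m, n)) (J : pred 'I_r) (u : 'rV[C]_n) :
  (Q J <= F)%MS -> F *m Q J = F ->
  proj_norm u F ^+ 2 = \sum_(j | J j) nsq ((u *m V^t*) 0 j).
Proof.
move=> QF FQ; have QQ : Q J *m Q J = Q J.
  by rewrite [LHS]dgcM//; apply: eq_dgc => j; rewrite -natrM mulnb andbb.
have uQ : u *m proj_ortho F = u *m Q J.
  rewrite -{1}(subrK (u *m Q J) u) mulmxDl proj_ortho_0; last first.
    apply/orthomx1P; rewrite -FQ adjM mulmxA; have -> : (Q J)^t* = Q J by exact: dgc_adj.
    by rewrite mulmxBl -(mulmxA u) QQ subrr mul0mx.
  by rewrite add0r proj_ortho_id// (submx_trans (submxMl _ _)).
rewrite /proj_norm sqr_sqrtr; last by rewrite sqnormE fro2_ge0.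
rewrite uQ sqnormE /Q dgc_def !mulmxA fro2_unitaryr//.
rewrite /fro2 big_ord1 [RHS]big_mkcond; apply: eq_bigr => j _.
by rewrite mul_mx_diag !mxE nsqM nsqR; case: (J j); rewrite ?expr1n ?expr0n ?mulr1 ?mulr0.
Qed.

Let row_in_eigenspace j : (row j V <= eigenspace P (theta j)%:C)%MS.
Proof.
apply/eigenspaceP; apply/rowP => k.
rewrite /P dgc_def !mulmxA -row_mul (elimT unitarymxP Vu) row1 -rowE.
by rewrite mxE (bigD1 j)//= !mxE eqxx mulr1n big1 ?addr0// => i ij;
  rewrite !mxE eq_sym (negbTE ij) mul0r.
Qed.

Let rows_sub m (F : 'M[C]_(m, n)) (J : pred 'I_r) :
  (forall j, J j -> (row j V <= F)%MS) -> (Q J <= F)%MS.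
Proof.
move=> VF; rewrite /Q dgc_def -mulmxA; apply: submx_trans (submxMl _ _) _.
apply/row_subP => j; have -> : row j (diag_mx (\row_j ((J j)%:R : R)%:C) *m V) =
    (J j)%:R%:C *: row j V by apply/rowP => k; rewrite mxE mul_diag_mx !mxE.
have [Jj|Jj] := boolP (J j); first by rewrite scalemx_sub// VF.
by rewrite scale0r sub0mx.
Qed.

(** Eigenvectors for a nonzero [t] have no component off the rows of [V], where [P]
vanishes, nor on the rows with another eigenvalue. *)
Let eigenspace_Q t : t != 0 ->
  eigenspace P t%:C *m Q (fun j => theta j == t) = eigenspace P t%:C.
Proof.
move=> t0; set F := eigenspace _ _.
have FP : F *m P = t%:C *: F by apply/eigenspaceP.
have F0 d : F *m dgc V (fun j => (theta j - t) * d j) = 0.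
  have -> : dgc V (fun j => (theta j - t) * d j) = P *m dgc V d - t%:C *: dgc V d.
    by rewrite [P *m _]dgcM// dgcZ dgcB; apply: eq_dgc => j; rewrite mulrBl.
  by rewrite mulmxBr mulmxA FP -scalemxAl scalemxAr subrr.
have tC0 : t%:C != 0 :> C by rewrite eq_complex /= (negbTE t0).
have PE : P = t%:C *: Q (fun j => theta j == t)
    + dgc V (fun j => (theta j - t) * (theta j / (theta j - t))).
  rewrite dgcZ dgcD; apply: eq_dgc => j; have [->|tj] := eqVneq (theta j) t.
    by rewrite mulr1 subrr mul0r addr0.
  by rewrite mulr0 add0r mulrCA divff ?mulr1// subr_eq0.
by apply: (scalerI tC0); rewrite -FP PE mulmxDr F0 addr0 scalemxAr.
Qed.

Lemma proj_norm_eigenspace t (u : 'rV[C]_n) : t != 0 ->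
  proj_norm u (eigenspace P t%:C) ^+ 2 =
  \sum_(j | theta j == t) nsq ((u *m V^t*) 0 j).
Proof.
move=> t0; apply: proj_norm_rows; last exact: eigenspace_Q.
by apply: rows_sub => j /eqP <-.
Qed.

Lemma proj_norm_sum_eigenspaces (s : seq R) (p : pred R) (u : 'rV[C]_n) :
  (forall j, theta j \in s) -> (forall t, t \in s -> t != 0) ->
  proj_norm u (\sum_(t <- s | p t) eigenspace P t%:C)%MS ^+ 2 =
  \sum_(j | p (theta j)) nsq ((u *m V^t*) 0 j).
Proof.
move=> ths s0; apply: proj_norm_rows.
  apply: rows_sub => j pj; rewrite (big_rem (theta j))//= pj.
  exact: submx_trans (row_in_eigenspace j) (addsmxSl _ _).
have QQ : Q (fun j => p (theta j)) *m Q (fun j => p (theta j)) = Q (fun j => p (theta j)).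
  by rewrite [LHS]dgcM//; apply: eq_dgc => j; rewrite -natrM mulnb andbb.
suff /submxP[D ->] : (\sum_(t <- s | p t) eigenspace P t%:C <= Q (fun j => p (theta j)))%MS.
  by rewrite -mulmxA QQ.
rewrite big_seq_cond; elim/big_ind: _ => [|A B hA hB|t /andP[ts pt]].
- exact: sub0mx.
- by rewrite addsmx_sub hA hB.
rewrite -(eigenspace_Q (s0 t ts)).
have -> : Q (fun j => theta j == t) = Q (fun j => theta j == t) *m Q (fun j => p (theta j)).
  rewrite [RHS]dgcM//; apply: eq_dgc => j; rewrite -natrM mulnb.
  by case: eqP => [->|//]; rewrite pt.
by rewrite mulmxA submxMl.
Qed.

End eigenspace_projections.

(** * Asymptotics of the eigenvector *)

Section one_eigenvector.
Context {R : realType} (r n : nat).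
Local Notation C := R[i].
Variables (X : 'M[C]_n) (V : 'M[C]_(r, n)) (u : 'rV[C]_n) (theta : 'I_r -> R).
Variables (lam rho e : R).
Hypotheses (Xh : X \is hermsymmx) (Vu : V \is unitarymx) (u1 : fro2 u = 1)
  (uX : u *m (X + dgc V theta) = lam%:C *: u)
  (e0 : 0 < e) (eX : forall i : 'I_n, e <= `|rho - eigval X i|).
Let c := u *m V^t*.
Let D : 'M[C]_r := diag_mx (\row_j (theta j)%:C).
Let Rs := fcalc (fun t => (rho - t)^-1) X.
Let y := (rho - lam)%:C *: (u *m Rs).
Let w := c *m D *m V *m Rs.

(** Multiply the eigenvector equation by the resolvent of [X] at [rho]. *)
Let eigvec_split : u = w + y.
Proof.
have rX (i : 'I_n) : eigval X i != rho.
  apply/eqP => h; have := eX i; rewrite h subrr normr0; have := e0; lra.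
have RsE : (rho%:C%:M - X) *m Rs = 1%:M := fcalc_resolvent Xh (z := rho) rX.
have uE : u *m (rho%:C%:M - X) = c *m D *m V + (rho - lam)%:C *: u.
  have uXE : u *m X = lam%:C *: u - c *m D *m V.
    by rewrite -uX mulmxDr dgc_def !mulmxA addrK.
  by rewrite mulmxBr mul_mx_scalar uXE rmorphB scalerBl opprB addrCA addrA.
by rewrite -[LHS]mulmx1 -RsE mulmxA uE mulmxDl -scalemxAl.
Qed.

Let fro2_y : fro2 y <= ((rho - lam) / e) ^+ 2.
Proof.
have : opbound e^-1 Rs.
  by apply: opbound_fcalc => // i; rewrite normfV lef_pV2 ?posrE ?(lt_le_trans e0).
move=> /(_ u); rewrite u1 mulr1 => h.
by rewrite /y fro2Z nsqR exprMn ler_wpM2l ?sqr_ge0.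
Qed.

Let fro2_cD : fro2 (c *m D) <= fro2 D.
Proof.
have c1 : fro2 c <= 1 by rewrite -u1; exact: fro2_projr.
by rewrite (le_trans (fro2M _ _))// -[leRHS]mul1r ler_wpM2r ?fro2_ge0.
Qed.

(** Compress [eigvec_split] to the rows of [V]: the compressed resolvent is close
to [g], and the remainder carries the factor [rho - lam]. *)
Lemma eigvec_coord_bound g :
  fro2 (c - g%:C *: (c *m D)) <=
  2 * (fro2 D * fro2 (V *m Rs *m V^t* - g%:C%:M)) + 2 * ((rho - lam) / e) ^+ 2.
Proof.
have -> : c - g%:C *: (c *m D) = c *m D *m (V *m Rs *m V^t* - g%:C%:M) + y *m V^t*.
  rewrite mulmxBr mul_mx_scalar {1}/c {1}eigvec_split mulmxDl /w !mulmxA.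
  by rewrite [RHS]addrAC.
rewrite (le_trans (fro2D _ _))// lerD// ler_wpM2l//.
  by rewrite (le_trans (fro2M _ _))// ler_wpM2r ?fro2_ge0.
by rewrite (le_trans _ fro2_y)// fro2_projr.
Qed.

(** In [eigvec_split] the first summand has squared norm close to one, and that
squared norm is the form of the compressed squared resolvent at [c D]. *)
Lemma eigvec_norm_bound kappa d : 0 <= d <= 1 ->
  ((rho - lam) / e) ^+ 2 <= d ^+ 2 ->
  fro2 (V *m fcalc (fun t => (rho - t)^-1 ^+ 2) X *m V^t* - kappa%:C%:M) <= d ^+ 2 ->
  `|1 - kappa * fro2 (c *m D)| <= (3 + fro2 D) * d.
Proof.
move=> /andP[d0 d1] yd K2.
have yd' := le_trans fro2_y yd.
have wE : fro2 w = qf (V *m fcalc (fun t => (rho - t)^-1 ^+ 2) X *m V^t*) (c *m D).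
  rewrite qf_conj /qf -(fcalcM Xh (fun t => (rho - t)^-1) (fun t => (rho - t)^-1)).
  rewrite fro2E trace_mx11 /w; have RsJ : Rs^t* = Rs by exact: dgc_adj.
  by rewrite -/Rs (adjM (c *m D *m V) Rs) RsJ !mulmxA.
have qK := qf_le (c *m D) d0 K2; rewrite qfB qf_scalar -wE in qK.
have wu : fro2 w = 1 + fro2 y - 2 * fdot u y.
  have uy : u - y = w by rewrite {1}eigvec_split addrK.
  by rewrite -uy fro2_subE u1.
have fd : `|fdot u y| <= d.
  rewrite -(@ler_pXn2r _ 2)// ?nnegrE// real_normK ?num_real//.
  by rewrite (le_trans (fdot_CS _ _))// u1 mul1r.
have dd : d ^+ 2 <= d by rewrite expr2 ler_piMl.
have yy := fro2_ge0 y; have T := ler_wpM2r d0 fro2_cD.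
move: qK fd; rewrite !ler_norml wu => /andP[h1 h2] /andP[h3 h4].
by apply/andP; split; lra.
Qed.

End one_eigenvector.

Lemma cvg_sum0 (R : realType) (I : Type) (s : seq I) (p : pred I) (f : I -> nat -> R) :
  (forall j, p j -> f j n @[n --> \oo] --> (0 : R)) ->
  (\sum_(j <- s | p j) f j n) @[n --> \oo] --> (0 : R).
Proof.
move=> f0; elim: s => [|j s IH].
  by apply: cvg_near_cst; apply: nearW => n; rewrite big_nil.
have [pj|pj] := boolP (p j).
  have -> : (fun n => \sum_(j <- j :: s | p j) f j n) =
      (fun n => f j n + \sum_(j <- s | p j) f j n).
    by apply/funext => n; rewrite big_cons pj.
  by rewrite -[X in _ --> X](addr0 (0 : R)); apply: cvgD; [exact: f0|exact: IH].
have -> // : (fun n => \sum_(j <- j :: s | p j) f j n) =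
    (fun n => \sum_(j <- s | p j) f j n).
by apply/funext => n; rewrite big_cons (negbTE pj).
Qed.

Section eigenvector_limits.
Context {R : realType} (r : nat).
Local Notation C := R[i].
Variables (X : forall n, 'M[C]_n) (V : forall n, 'M[C]_(r, n)) (u : forall n, 'rV[C]_n).
Variables (theta : 'I_r -> R) (lam : nat -> R) (rho e t0 kappa : R).
Hypotheses (Xh : forall n, X n \is hermsymmx) (e0 : 0 < e) (t00 : t0 != 0).
Hypothesis nearH : \forall n \near \oo,
  [/\ V n \is unitarymx, fro2 (u n) = 1,
      u n *m (X n + dgc (V n) theta) = (lam n)%:C *: u n &
      forall i : 'I_n, e <= `|rho - eigval (X n) i|].
Hypothesis lamrho : lam n @[n --> \oo] --> rho.
Hypothesis K1 : fro2 (V n *m fcalc (fun t => (rho - t)^-1) (X n) *m (V n)^t*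
  - (t0^-1)%:C%:M) @[n --> \oo] --> (0 : R).
Hypothesis K2 : fro2 (V n *m fcalc (fun t => (rho - t)^-1 ^+ 2) (X n) *m (V n)^t*
  - kappa%:C%:M) @[n --> \oo] --> (0 : R).
Let c n := u n *m (V n)^t*.
Let D : 'M[C]_r := diag_mx (\row_j (theta j)%:C).

Let lam_cvg0 : ((rho - lam n) / e) ^+ 2 @[n --> \oo] --> (0 : R).
Proof.
have h : (rho - lam n) / e @[n --> \oo] --> ((rho - rho) / e : R).
  by apply: cvgM; [apply: cvgB; [exact: cvg_cst|exact: lamrho]|exact: cvg_cst].
rewrite subrr mul0r in h; rewrite -(mulr0 (0 : R)).
by under eq_fun do rewrite expr2; apply: cvgM.
Qed.

(** By [eigvec_coord_bound] the products [c_j * (1 - theta_j / t0)] tend to zero. *)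
Lemma eigvec_coord_cvg0 j : theta j != t0 -> nsq (c n 0 j) @[n --> \oo] --> (0 : R).
Proof.
move=> tj; pose f n := 2 * (fro2 D * fro2 (V n *m fcalc (fun t => (rho - t)^-1) (X n)
  *m (V n)^t* - (t0^-1)%:C%:M)) + 2 * ((rho - lam n) / e) ^+ 2.
have f0 : f n @[n --> \oo] --> (0 : R).
  rewrite -[X in _ --> X](_ : 2 * (fro2 D * 0) + 2 * 0 = 0); last by rewrite !mulr0 addr0.
  apply: cvgD; apply: cvgM; try exact: cvg_cst; last exact: lam_cvg0.
  by apply: cvgM; [exact: cvg_cst|exact: K1].
pose q := (1 - theta j / t0) ^+ 2.
have q0 : 0 < q.
  rewrite exprn_even_gt0//= subr_eq0 eq_sym; apply: contra tj => /eqP h.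
  by rewrite -[theta j](divfK t00) h mul1r.
have fq0 : f n / q @[n --> \oo] --> (0 : R).
  by rewrite -(mul0r q^-1); apply: cvgM f0 _; exact: cvg_cst.
apply: (squeeze_cvgr _ _ fq0); last exact: (cvg_cst 0).
apply: filterS nearH => n [Vu u1 uX eX]; rewrite nsq_ge0/= ler_pdivlMr//.
have h := eigvec_coord_bound (Xh n) Vu u1 uX e0 eX t0^-1.
apply: le_trans h; rewrite -/(c n) -/D; apply: le_trans (nsq_le_fro2 _ 0 j).
have -> : (c n - (t0^-1)%:C *: (c n *m D)) 0 j = c n 0 j * (1 - theta j / t0)%:C.
  by rewrite mxE [X in _ + X]mxE mxE mul_mx_diag !mxE rmorphB rmorphM /=; ring.
by rewrite nsqM nsqR.
Qed.

Let norm_cvg1 : kappa * fro2 (c n *m D) @[n --> \oo] --> (1 : R).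
Proof.
apply/cvgrPdist_le => eps eps0; pose T := 3 + fro2 D.
have T0 : 0 < T by rewrite ltr_pwDl// fro2_ge0.
pose d := Num.min 1 (eps / T).
have d0 : 0 < d by rewrite lt_min ltr01 divr_gt0.
have dT : T * d <= eps by rewrite mulrC -ler_pdivlMr// ge_min lexx orbT.
have d20 : 0 < d ^+ 2 by exact: exprn_gt0.
move/cvgrPdist_le: lam_cvg0 => /(_ _ d20) hl.
move/cvgrPdist_le: K2 => /(_ _ d20) hK.
apply: filterS3 nearH hl hK => n [Vu u1 uX eX] {}hl {}hK.
rewrite sub0r normrN ger0_norm ?fro2_ge0// in hK.
rewrite sub0r normrN ger0_norm ?sqr_ge0// in hl.
apply: le_trans dT; apply: (eigvec_norm_bound (Xh n) Vu u1 uX e0 eX _ hl hK).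
by rewrite (ltW d0) ge_min lexx.
Qed.

Let mass n := \sum_(j | theta j == t0) nsq (c n 0 j).

Let mass_cvg : kappa * t0 ^+ 2 * mass n @[n --> \oo] --> (1 : R).
Proof.
have rest : kappa * (\sum_(j | theta j != t0) theta j ^+ 2 * nsq (c n 0 j))
    @[n --> \oo] --> (0 : R).
  rewrite -[X in _ --> X](mulr0 kappa); apply: cvgM; first exact: cvg_cst.
  apply: cvg_sum0 => j tj; rewrite -(mulr0 (theta j ^+ 2)).
  by apply: cvgM; [exact: cvg_cst|exact: eigvec_coord_cvg0].
have -> : (fun n => kappa * t0 ^+ 2 * mass n) = (fun n => kappa * fro2 (c n *m D)
    - kappa * (\sum_(j | theta j != t0) theta j ^+ 2 * nsq (c n 0 j))).
  apply/funext => n; rewrite -mulrBr -mulrA; congr (_ * _).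
  have -> : fro2 (c n *m D) = \sum_j theta j ^+ 2 * nsq (c n 0 j).
    rewrite /fro2 big_ord1; apply: eq_bigr => j _.
    by rewrite mul_mx_diag !mxE nsqM nsqR mulrC.
  rewrite (bigID (fun j => theta j == t0))/= addrK mulr_sumr.
  by apply: eq_bigr => j /eqP ->.
by rewrite -[X in _ --> X](subr0 (1 : R)); apply: cvgB; [exact: norm_cvg1|exact: rest].
Qed.

(** In the limit of [eigvec_norm_bound] only the coordinates with [theta j = t0]
survive, each weighted by [t0 ^+ 2]; this also shows that [kappa] is nonzero. *)
Lemma eigvec_mass_cvg : mass n @[n --> \oo] --> (kappa * t0 ^+ 2)^-1.
Proof.
have k0 : kappa * t0 ^+ 2 != 0.
  apply/eqP => k0; have := mass_cvg; rewrite k0.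
  have -> : (fun n => 0 * mass n) = (fun=> 0) by apply/funext => n; rewrite mul0r.
  move=> /(cvg_lim (@Rhausdorff R)); rewrite (cvg_lim (@Rhausdorff R) (cvg_cst (0 : R))).
  by move/eqP; rewrite eq_sym oner_eq0.
have -> : mass = (fun n => (kappa * t0 ^+ 2)^-1 * (kappa * t0 ^+ 2 * mass n)).
  by apply/funext => n; rewrite mulKf.
rewrite -[X in _ --> X]mulr1.
by apply: cvgM; [exact: cvg_cst|exact: mass_cvg].
Qed.

End eigenvector_limits.

(** * Limits along one realization *)

Section outlier_limits.
Context {R : realType} (mu : probability (measurableTypeR R) R).
Hypothesis cmu : compact (msupport mu).
Local Notation C := R[i].
Local Notation a := (inf (msupport mu)).
Local Notation b := (sup (msupport mu)).
Local Notation G := (Cauchy_transform mu).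
Variables (X P : forall n, 'M[C]_n) (r : nat) (V : forall n, 'M[C]_(r, n)).
Variables (theta : r.-tuple R) (i0 : 'I_r) (u : forall n, 'rV[C]_n).
Hypotheses (Xh : forall n, X n \is hermsymmx)
  (PV : forall n, (r <= n)%N -> V n \is unitarymx /\ P n = dgc (V n) (tnth theta))
  (Xmu : weak_cvg (fun n => esd (X n)) mu)
  (Xa : eigval (X n) n.-1 @[n --> \oo] --> a)
  (Xb : eigval (X n) 0 @[n --> \oo] --> b)
  (VX : forall k, fro2 (V n *m centered k (X n) *m (V n)^t*) @[n --> \oo] --> (0 : R))
  (sth : sorted >=%R theta) (theta0 : forall j, tnth theta j != 0).
Local Notation t0 := (tnth theta i0).
Hypothesis t0G : (Cauchy_left mu < (t0^-1)%:E < Cauchy_right mu)%E.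
Let lt n := if 0 < t0 then eigval (X n + P n) i0 else eigval (X n + P n) (n - r + i0).
Hypothesis uH : forall n, (r <= n)%N ->
  sqnorm (u n) = 1 /\ u n *m (X n + P n) = (lt n)%:C *: u n.
Let rho := Cauchy_inv mu t0^-1.

Let Vu n : (r <= n)%N -> V n \is unitarymx.
Proof. by case/PV. Qed.

Let near_PV : \forall n \near \oo, P n = dgc (V n) (tnth theta).
Proof. by exists r => // n /PV[]. Qed.

Let rhoP : (0 < t0 /\ b < rho \/ t0 < 0 /\ rho < a) /\ G rho = t0^-1.
Proof.
have /andP[tl tr] := t0G; case: (ltgtP 0 t0) => [tp|tn|t00].
- have [h1 h2] := Cauchy_inv_right cmu (etrans (invr_gt0 t0) tp) tr.
  by split => //; left.
- have [h1 h2] := Cauchy_inv_left cmu (etrans (invr_lt0 t0) tn) tl.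
  by split => //; right.
by move: (theta0 i0); rewrite -t00 eqxx.
Qed.

Lemma outlier_cvg : lt n @[n --> \oo] --> rho.
Proof.
have [[[tp br]|[tn ra]] Gr] := rhoP.
  have h := outlier_cvg_right cmu Xh Vu Xmu Xa Xb VX sth Gr br tp.
  apply: cvg_trans h; apply: near_eq_cvg; apply: filterS near_PV => n PE.
  by rewrite /lt tp PE.
have h := outlier_cvg_left cmu Xh Vu Xmu Xa Xb VX sth Gr ra tn.
apply: cvg_trans h; apply: near_eq_cvg; apply: filterS near_PV => n PE.
by rewrite /lt ltNge (ltW tn) PE.
Qed.

Let side : rho < a \/ b < rho.
Proof. by have [[[_ h]|[_ h]] _] := rhoP; [right|left]. Qed.

Let exists_gap : exists2 e, 0 < e & gap a b (e + e) rho.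
Proof.
case: side => h; [exists ((a - rho) / 2)|exists ((rho - b) / 2)]; try lra.
  by left; lra.
by right; lra.
Qed.

Let near_eigvec e : 0 < e -> gap a b (e + e) rho -> \forall n \near \oo,
  [/\ V n \is unitarymx, fro2 (u n) = 1,
      u n *m (X n + dgc (V n) (tnth theta)) = (lt n)%:C *: u n &
      forall i : 'I_n, e <= `|rho - eigval (X n) i|].
Proof.
move=> e0 gz; have nE := near_eigval Xa Xb e0; near=> n; have rn : (r <= n)%N by near: n; exact: nbhs_infty_ge.
have [Vun PE] := PV rn; have [u1 uX] := uH rn.
split; [exact: Vun|by rewrite -sqnormE|by rewrite -PE|move=> i].
have nX : forall i : 'I_n, a - e <= eigval (X n) i <= b + e.
  by near: n.
apply: gap_norm (nX i); case: gz => h; [left|right]; lra.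
Unshelve. all: by end_near.
Qed.

(** The mass limit of the coordinates, with [kappa] equal to minus the derivative of
the Cauchy transform. *)
Lemma eigvec_proj_cvg : proj_norm (u n) (eigenspace (P n) t0%:C) ^+ 2 @[n --> \oo] -->
  - 1 / (t0 ^+ 2 * derive1 G rho).
Proof.
have [e e0 gz] := exists_gap; have [_ Gr] := rhoP.
have K1 := compressed_resolvent_cvg cmu Xh Vu Xmu Xa Xb VX e0 gz (k := 1) isT.
have K2 := compressed_resolvent_cvg cmu Xh Vu Xmu Xa Xb VX e0 gz (k := 2) isT.
rewrite -(CauchyE cmu (addr_gt0 e0 e0) gz) Gr in K1.
have := eigvec_mass_cvg Xh e0 (theta0 i0) (near_eigvec e0 gz) outlier_cvg K1 K2.
have -> : - 1 / (t0 ^+ 2 * derive1 G rho) = (resolvent_moment mu rho 2 * t0 ^+ 2)^-1.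
  by rewrite (Cauchy_derive1 cmu side) mulrN invrN mulrNN mul1r mulrC.
apply: cvg_trans; apply: near_eq_cvg; near=> n.
have rn : (r <= n)%N by near: n; exact: nbhs_infty_ge.
have [Vun PE] := PV rn.
by rewrite PE (proj_norm_eigenspace _ Vun _ (theta0 i0)).
Unshelve. all: by end_near.
Qed.

Lemma eigvec_proj_others_cvg0 :
  proj_norm (u n) (\sum_(t <- undup theta | t != t0) eigenspace (P n) t%:C)%MS
    @[n --> \oo] --> (0 : R).
Proof.
have [e e0 gz] := exists_gap; have [_ Gr] := rhoP.
have K1 := compressed_resolvent_cvg cmu Xh Vu Xmu Xa Xb VX e0 gz (k := 1) isT.
rewrite -(CauchyE cmu (addr_gt0 e0 e0) gz) Gr in K1.
pose S n := \sum_(j | tnth theta j != t0) nsq ((u n *m (V n)^t*) 0 j).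
have S0 : S n @[n --> \oo] --> (0 : R).
  apply: cvg_sum0 => j tj.
  exact: eigvec_coord_cvg0 Xh e0 (theta0 i0) (near_eigvec e0 gz) outlier_cvg K1 _ tj.
have : Num.sqrt (S n) @[n --> \oo] --> (Num.sqrt 0 : R).
  by apply: continuous_cvg S0; exact: sqrt_continuous.
rewrite sqrtr0; apply: cvg_trans; apply: near_eq_cvg; near=> n.
have rn : (r <= n)%N by near: n; exact: nbhs_infty_ge.
have [Vun PE] := PV rn.
rewrite /S -(proj_norm_sum_eigenspaces Vun (s := undup theta) (fun t => t != t0)).
- by rewrite PE sqrtr_sqr ger0_norm// sqrtr_ge0.
- by move=> j; rewrite mem_undup mem_tnth.
- by move=> t; rewrite mem_undup => /tnthP[j ->].
Unshelve. all: by end_near.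
Qed.

End outlier_limits.

(** * Outlying eigenvalues and eigenvectors *)

Theorem theorem2p2 (beta : symmetry_class) (R : realType)
    (d : measure_display) (Omega : measurableType d) (Pr : probability Omega R)
    (X P : forall n : nat, {RV Pr >-> mxBorel R n})
    (mu : probability (measurableTypeR R) R) (a b : R)
    (r s : nat) (theta : r.-tuple R) (i0 : 'I_r)
    (u : forall n : nat, Omega -> 'rV[R[i]]_n) :
  (* assumptions on X_n and mu_X *)
  (forall n w, self_adjoint beta (X n w)) ->
  {ae Pr, forall w, weak_cvg (fun n => esd (X n w)) mu} ->
  compact (msupport mu) ->
  a = inf (msupport mu) ->
  b = sup (msupport mu) ->
  {ae Pr, forall w, eigval (X n w) n.-1 @[n --> \oo] --> a} ->
  {ae Pr, forall w, eigval (X n w) 0 @[n --> \oo] --> b} ->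
  (* assumptions on theta_1, ..., theta_r and P_n *)
  sorted >=%R theta ->
  (s <= r)%N ->
  (forall i : 'I_r, (i < s)%N -> 0 < tnth theta i) ->
  (forall i : 'I_r, (s <= i)%N -> tnth theta i < 0) ->
  (forall n w, (r <= n)%N ->
     [/\ self_adjoint beta (P n w),
         \rank (P n w : 'M[R[i]]_n) = r
       & [seq x <- eigvals (P n w) | x != 0] = theta]) ->
  (* joint assumptions *)
  (forall n, (r <= n)%N -> independent (X n) (P n)) ->
  (forall n, (r <= n)%N ->
     conj_invariant beta (X n) \/ conj_invariant beta (P n)) ->
  (* assumptions on i_0 and the eigenvector *)
  (Cauchy_left mu < ((tnth theta i0)^-1)%:E < Cauchy_right mu)%E ->
  let Xt n w : 'M[R[i]]_n := (X n w : 'M[R[i]]_n) + (P n w : 'M[R[i]]_n) in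
  let lt n w : R := if 0 < tnth theta i0 then eigval (Xt n w) i0
                    else eigval (Xt n w) (n - r + i0) in
  (forall n w, (r <= n)%N ->
     [/\ entries_in beta (u n w),
         sqnorm (u n w) = 1
       & u n w *m Xt n w = (lt n w)%:C *: u n w]) ->
  let rho := Cauchy_inv mu (tnth theta i0)^-1 in
  [/\ {ae Pr, forall w, lt n w @[n --> \oo] --> rho},
      {ae Pr, forall w,
        proj_norm (u n w) (eigenspace (P n w) (tnth theta i0)%:C) ^+ 2
          @[n --> \oo] -->
        - 1 / (tnth theta i0 ^+ 2 * derive1 (Cauchy_transform mu) rho)}
    & {ae Pr, forall w,
        proj_norm (u n w)
          (\sum_(t <- undup theta | t != tnth theta i0)
             eigenspace (P n w) t%:C)%MS
          @[n --> \oo] --> (0 : R)}].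
Proof.
move=> Xsa Xmu cmu aE bE Xa Xb sth sr thp thn Psa ind inv t0G Xt lt uH rho.
have theta0 j : tnth theta j != 0.
  by case: (ltnP j s) => js; [rewrite gt_eqF ?thp|rewrite lt_eqF ?thn].
have r0 : (0 < r)%N by case: (i0) => k; exact: leq_ltn_trans.
have Xh n w : (X n w : 'M[R[i]]_n) \is hermsymmx by have [] := Xsa n w.
have PV n w : (r <= n)%N ->
    exists2 V : 'M[R[i]]_(r, n), V \is unitarymx & P n w = dgc V (tnth theta).
  by move=> rn; have [[_ Ph] _ Pth] := Psa n w rn; exact: nonzero_spectral_decomposition.
have VX := ae_compress_cvg0 r0 theta0 ind inv Xh PV.
rewrite aE in Xa; rewrite bE in Xb.
suff main : {ae Pr, forall w, [/\ lt n w @[n --> \oo] --> rho,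
    proj_norm (u n w) (eigenspace (P n w) (tnth theta i0)%:C) ^+ 2
      @[n --> \oo] --> - 1 / (tnth theta i0 ^+ 2 * derive1 (Cauchy_transform mu) rho)
  & proj_norm (u n w) (\sum_(t <- undup theta | t != tnth theta i0)
      eigenspace (P n w) t%:C)%MS @[n --> \oo] --> (0 : R)]}.
  by split; apply: filterS main => w [].
apply: filterS3 Xmu (filterI Xa Xb) VX => w {}Xmu [{}Xa {}Xb] {}VX.
have exV n : exists V : 'M[R[i]]_(r, n), (r <= n)%N ->
    V \is unitarymx /\ P n w = dgc V (tnth theta).
  have [rn|rn] := leqP r n; last by exists 0.
  by have [V Vu PE] := PV n w rn; exists V.
pose V n := sval (cid (exV n)).
have VP n : (r <= n)%N -> V n \is unitarymx /\ P n w = dgc (V n) (tnth theta).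
  exact: svalP (cid (exV n)).
have {}VX k : fro2 (V n *m centered k (X n w) *m (V n)^t*) @[n --> \oo] --> (0 : R).
  (* Eventually all eigenvalues lie within distance [1] of the convex hull of the
  support, hence in the interval from [- M] to [M]. *)
  pose M := `|inf (msupport mu)| + `|sup (msupport mu)| + 1.
  have M0 : 0 <= M by rewrite /M !addr_ge0.
  apply: VX (Num.bound M) _ V VP.
  have := near_eigval Xa Xb ltr01; apply: filterS => n nX.
  apply: eigval_spec_bounded (Xh n w) _ => i.
  have ML : M <= (Num.bound M).+1%:R.
    by rewrite (le_trans (ltW (archi_boundP M0)))// ler_nat.
  apply: le_trans ML; have /andP[h1 h2] := nX i; rewrite /M ler_norml.
  have := ler_norm (sup (msupport mu)); have := ler_norm (- inf (msupport mu)).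
  rewrite normrN => h3 h4; have h5 := normr_ge0 (inf (msupport mu)).
  by have h6 := normr_ge0 (sup (msupport mu)); apply/andP; split; lra.
have uw n : (r <= n)%N -> sqnorm (u n w) = 1 /\
    u n w *m ((X n w : 'M[R[i]]_n) + P n w) = (lt n w)%:C *: u n w.
  by move=> /(uH n w)[].
split.
- exact: (outlier_cvg cmu (fun n => Xh n w) VP Xmu Xa Xb VX sth theta0 t0G).
- exact: (eigvec_proj_cvg cmu (fun n => Xh n w) VP Xmu Xa Xb VX sth theta0 t0G uw).
exact: (eigvec_proj_others_cvg0 cmu (fun n => Xh n w) VP Xmu Xa Xb VX sth theta0 t0G uw).
Qed.
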